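(* Suppose that $V_h$ is the space of continuous piecewise polynomials of degree $r>1$ and that $\alpha\neq 0$ (and set $p=2$ in the definitions of $B_h$, of the discrete problem and of the energy norm), and let $\theta>0$ be sufficiently small. Then there is a constant $C$, independent of $h$, such that the error $u-u_h$ satisfies $$|||u-u_h|||^2\ \le\ C\inf_{\chi\in V_h}\left(|||u-\chi|||^2+\int_0^T (h^2\nu)^{-1}\|u-\chi\|^2+\alpha h^2\|\Delta(u-\chi)\|^2\,dt\right),$$ where $\Delta(u-\chi)$ is understood elementwise.
   Context: Let $\Omega_s\subset\mathbb{R}^d$ be a bounded spatial domain, $T>0$, and $\Omega=\Omega_s\times(0,T)$ the space-time domain. Let $\alpha\ge 0$, $\gamma\ge 0$ and $\boldsymbol\beta\in\mathbb{R}^d$ be constants, and set $$Lu=u_t-\alpha\Delta u+\boldsymbol\beta\cdot\nabla u+\gamma u ,$$ where $\nabla,\Delta$ act in the space variables only. $\mathcal H^1_E(\Omega)$ is the subspace of $H^1(\Omega)$ of functions vanishing on $\partial\Omega_s\times(0,T)$ and on $\Omega_s\times\{t=0\}$. Write $(u,v)=\int_{\Omega_s}uv\,dx$ and $\|\cdot\|$ for the $L^2(\Omega_s)$ inner product and norm, and $$B(u,v)=\int_0^T (u_t,v)+\alpha(\nabla u,\nabla v)+(\boldsymbol\beta\cdot\nabla u,v)+\gamma(u,v)\,dt,\qquad F(v)=\int_0^T (f,v)\,dt .$$ The exact solution $u\in\mathcal H^1_E(\Omega)$ solves $Lu=f$, with weak form $B(u,v)=F(v)$ for all $v\in\mathcal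 H^1_E(\Omega)$; $u$ is assumed regular enough that the expressions below make sense. $\Omega$ is covered by a shape regular quasiuniform tessellation $\mathcal T_h$ of elements of size $h$, and $V_h\subset\mathcal H^1_E(\Omega)$ is a $C^0$ conforming piecewise polynomial finite element space on $\mathcal T_h$. Let $\nu=(|\boldsymbol\beta|^2+1)^{-1/2}$. With exponent $p$ and parameter $\theta$, $$B_h(u,v)=B(u,v)+\int_0^T\big(Lu,\ \theta h^p\nu(\boldsymbol\beta\cdot\nabla v+v_t)\big)\,dt ,$$ where the last term is interpreted elementwise on $\mathcal T_h$. The streamline diffusion solution $u_h\in V_h$ is defined by $$B_h(u_h,v)=F\big(v+\theta h^p\nu(\boldsymbol\beta\cdot\nabla v+v_t)\big)\quad\text{for all }v\in V_h .$$ The energy norm is $$|||u|||^2=\|u(T)\|^2+\int_0^T \alpha\|\nabla u\|^2+h^p\nu\|\boldsymbol\beta\cdot\nabla u+u_t\|^2+\gamma\|u\|^2\,dt .$$ *)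

(* Defs.v *)
From HB Require Import structures.
From mathcomp Require Import all_boot all_order all_algebra.
From mathcomp Require Import all_classical all_reals all_analysis.

Set Implicit Arguments.
Unset Strict Implicit.
Unset Printing Implicit Defensive.

Import Order.TTheory GRing.Theory Num.Theory.
Import numFieldNormedType.Exports.

Local Open Scope classical_set_scope.
Local Open Scope ring_scope.

Definition measure_rV_display : measure_display -> measure_display.
Proof. exact. Qed.

Section measurable_rV.
Context {d} {T : sigmaRingType d}.
Variable n : nat.

Let coors : 'I_n -> 'rV[T]_n -> T := fun i x => x ord0 i.

Let rV_set0 : g_sigma_preimage coors set0.
Proof. exact: sigma_algebra0. Qed.

Let rV_setC A : g_sigma_preimage coors A -> g_sigma_preimage coors (~` A).
Proof. exact: sigma_algebraC. Qed.

Let rV_bigcup (F : _^nat) : (forall i, g_sigma_preimage coors (F i)) ->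
  g_sigma_preimage coors (\bigcup_i (F i)).
Proof. exact: sigma_algebra_bigcup. Qed.

HB.instance Definition _ := @isMeasurable.Build (measure_rV_display d)
  'rV[T]_n (g_sigma_preimage coors) rV_set0 rV_setC rV_bigcup.

End measurable_rV.

Lemma measurable_coord_rV d (T : sigmaRingType d) n (i : 'I_n) :
  measurable_fun [set: 'rV[T]_n] (fun x : 'rV[T]_n => x ord0 i).
Proof.
move=> _ Y mY; rewrite setTI; apply: sub_sigma_algebra => /=.
rewrite -bigcup_seq/=; exists i => /=; first by rewrite mem_index_enum.
by exists Y => //; rewrite setTI.
Qed.

Lemma measurable_fun_rVP d1 d2 (T1 : measurableType d1)
    (T2 : measurableType d2) n (f : T1 -> 'rV[T2]_n) :
  measurable_fun [set: T1] f <->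
  forall i, measurable_fun [set: T1] (fun x => f x ord0 i).
Proof.
split=> [mf i|mf].
  exact: (measurableT_comp (measurable_coord_rV i) mf).
suff : (@measurable _ 'rV[T2]_n) `<=` [set A | measurable (f @^-1` A)].
  by move=> H _ A /H; rewrite setTI.
apply: smallest_sub; first split => /=.
- by rewrite preimage_set0.
- by move=> A mA; rewrite setTD preimage_setC; apply: measurableC.
- by move=> F mF; rewrite preimage_bigcup; apply: bigcup_measurable => k _.
rewrite -bigcup_seq/=; apply: bigcup_sub => i _ A [B mB <-] /=.
by rewrite setTI -[X in measurable X]setTI; exact: mf.
Qed.

(* Lebesgue measure on R^n, slicing along the first coordinate. *)
Fixpoint lebesgue_rV (R : realType) n : set 'rV[R]_n -> \bar R :=
  match n with
  | 0 => fun A => dirac (0 : 'rV[R]_0) A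
  | n'.+1 => fun A => (\int[lebesgue_measure]_x
      lebesgue_rV [set y : 'rV[R]_n' | A (row_mx (x : R)%:M y : 'rV_(1 + n'))])%E
  end.
Arguments lebesgue_rV R n : clear implicits.

Section lebesgue_rV_measure.
Variable R : realType.

Let cons_rV n (p : measurableTypeR R * 'rV[R]_n) : 'rV[R]_(1 + n) :=
  row_mx (p.1 : R)%:M p.2.

Let measurable_cons_rV n : measurable_fun setT (@cons_rV n).
Proof.
apply/measurable_fun_rVP => i; case: (split_ordP i) => j ->.
  rewrite (_ : (fun _ => _) = fst); first exact: measurable_fst.
  by apply/funext => p; rewrite row_mxEl mxE (ord1 j) eqxx mulr1n.
rewrite (_ : (fun _ => _) = (fun x : 'rV[R]_n => x ord0 j) \o snd).
  exact: measurableT_comp (measurable_coord_rV j) measurable_snd.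
by apply/funext => p; rewrite row_mxEr.
Qed.

Let uncons_rV n (v : 'rV[R]_(1 + n)) : measurableTypeR R * 'rV[R]_n :=
  (v ord0 (lshift n ord0), \row_j v ord0 (rshift 1 j)).

Let measurable_uncons_rV n : measurable_fun setT (@uncons_rV n).
Proof.
apply/measurable_fun_pairP; split; first exact: measurable_coord_rV.
apply/measurable_fun_rVP => i /=.
rewrite (_ : (fun _ => _) = fun v : 'rV[R]_(1 + n) => v ord0 (rshift 1 i)).
  exact: measurable_coord_rV.
by apply/funext => v /=; rewrite mxE.
Qed.

Let cons_rVK n : cancel (@cons_rV n) (@uncons_rV n).
Proof.
move=> [x y]; congr pair => /=.
  by rewrite row_mxEl mxE eqxx mulr1n.
by apply/rowP => j; rewrite mxE row_mxEr.
Qed.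

Section step.
Variable n : nat.
Variable m : {sigma_finite_measure set 'rV[R]_n -> \bar R}.

Let leb : {sigma_finite_measure set (measurableTypeR R) -> \bar R} :=
  lebesgue_measure.

Definition lebesgue_cons_rV : set 'rV[R]_(1 + n) -> \bar R :=
  pushforward (leb \x m)%E (@cons_rV n).

Let nu : {measure set 'rV[R]_(1 + n) -> \bar R} :=
  measure_function_pushforward__canonical__measure_function_Measure
    (leb \x m)%E
    (@measurable_cons_rV n).

HB.instance Definition _ := isMeasure.Build _ _ _ lebesgue_cons_rV
  (measure0 nu) (measure_ge0 nu) (@measure_semi_sigma_additive _ _ _ nu).

Let lebesgue_cons_rV_sigma_finite : sigma_finite setT lebesgue_cons_rV.
Proof.
have /sigma_finiteP[F [TF ndF Foo]] := sigma_finiteT leb.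
have /sigma_finiteP[G [TG ndG Goo]] := sigma_finiteT m.
exists (fun k => @uncons_rV n @^-1` (F k `*` G k)).
  rewrite -preimage_bigcup (_ : \bigcup_i (F i `*` G i) = setT) ?preimage_setT//.
  rewrite -subTset => -[x y] _.
  have [i _ Fix] : (\bigcup_i F i) x by rewrite -TF.
  have [j _ Gjy] : (\bigcup_i G i) y by rewrite -TG.
  exists (maxn i j) => //; split.
    by move: Fix; exact/subsetPset/ndF/leq_maxl.
  by move: Gjy; exact/subsetPset/ndG/leq_maxr.
move=> k; have [mF Fk] := Foo k; have [mG Gk] := Goo k; split.
  rewrite -[X in measurable X]setTI.
  by apply: measurable_uncons_rV => //; exact: measurableX.
rewrite /lebesgue_cons_rV /pushforward /= -comp_preimage.
rewrite (_ : _ \o _ = id) ?preimage_id; last first.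
  by apply/funext => p; exact: cons_rVK.
by rewrite product_measure1E// lte_mul_pinfty// ge0_fin_numE.
Qed.

HB.instance Definition _ := Measure_isSigmaFinite.Build _ _ _ lebesgue_cons_rV
  lebesgue_cons_rV_sigma_finite.

End step.

Lemma lebesgue_rVP n : exists m : {sigma_finite_measure set 'rV[R]_n -> \bar R},
  lebesgue_rV R n = m.
Proof.
elim: n => [|n [m IH]].
  by exists (dirac (0 : 'rV[R]_0)).
exists (lebesgue_cons_rV m).
apply/funext => A /=; rewrite IH /lebesgue_cons_rV /pushforward.
apply: eq_integral => x _ /=; congr (m _).
by apply/seteqP; split => y /=; rewrite /xsection /= inE.
Qed.

Section instances.
Variable n : nat.
Let m := projT1 (cid (lebesgue_rVP n)).
Let mE : lebesgue_rV R n = m := projT2 (cid (lebesgue_rVP n)).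

Let lebesgue_rV0 : lebesgue_rV R n set0 = 0%E.
Proof. by rewrite mE measure0. Qed.

Let lebesgue_rV_ge0 A : (0 <= lebesgue_rV R n A)%E.
Proof. by rewrite mE measure_ge0. Qed.

Let lebesgue_rV_sigma_additive : semi_sigma_additive (lebesgue_rV R n).
Proof. by rewrite mE; exact: measure_semi_sigma_additive. Qed.

HB.instance Definition _ := isMeasure.Build _ _ _ (lebesgue_rV R n)
  lebesgue_rV0 lebesgue_rV_ge0 lebesgue_rV_sigma_additive.

Let lebesgue_rV_sigma_finite : sigma_finite setT (lebesgue_rV R n).
Proof. by rewrite mE; exact: sigma_finiteT. Qed.

HB.instance Definition _ := Measure_isSigmaFinite.Build _ _ _ (lebesgue_rV R n)
  lebesgue_rV_sigma_finite.

End instances.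

End lebesgue_rV_measure.

Definition L2 (R : realType) dX (X : measurableType dX)
    (mu : {measure set X -> \bar R}) (K : set X) (u : X -> R) : Prop :=
  measurable_fun K u /\ mu.-integrable K (fun z => (u z ^+ 2)%:E).

Section weak_derivatives.
Variables (R : realType) (d : nat).

Implicit Types (K : set ('rV[R]_d * R)) (u v w g phi : 'rV[R]_d * R -> R).

(* Space-time points are pairs (x, t). *)
Definition lebesgue_st : set ('rV[R]_d * measurableTypeR R) -> \bar R :=
  (lebesgue_rV R d \x lebesgue_measure)%E.

HB.instance Definition _ := Measure.on lebesgue_st.

Definition dir_x (i : 'I_d) : 'rV[R]_d * R := (delta_mx ord0 i, 0).
Definition dir_t : 'rV[R]_d * R := (0, 1).

Definition C1_along phi (a : 'rV[R]_d * R) : Prop :=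
  (forall z, derivable phi z a) /\ continuous (fun z => 'D_a phi z).

Definition C1 phi : Prop :=
  continuous phi /\ (forall i, C1_along phi (dir_x i)) /\ C1_along phi dir_t.

Definition C1c K phi : Prop :=
  C1 phi /\ compact (closure [set z | phi z != 0]) /\
  closure [set z | phi z != 0] `<=` K.

(* g is the weak derivative of u on the open set K in the direction a. Only
   first derivatives are tested, hence C^1 test functions with compact support;
   C^oo ones give the same notion by mollification. *)
Definition is_wderiv K (a : 'rV[R]_d * R) u g : Prop :=
  L2 lebesgue_st K g /\
  forall phi, C1c K phi ->
    (\int[lebesgue_st]_(z in K) (u z * 'D_a phi z))%R =
    - (\int[lebesgue_st]_(z in K) (g z * phi z))%R.

(* A representative of the weak derivative; 0 if there is none. It is unique up
   to null sets and always exists where it is used on elements of H1. *)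
Definition wderiv K (a : 'rV[R]_d * R) u : 'rV[R]_d * R -> R :=
  xget (cst 0) [set g | is_wderiv K a u g].

Definition wdx K i u := wderiv K (dir_x i) u.
Definition wdt K u := wderiv K dir_t u.

Definition H1 K u : Prop :=
  L2 lebesgue_st K u /\
  (forall i, exists g, is_wderiv K (dir_x i) u g) /\
  (exists g, is_wderiv K dir_t u g).

Definition H1_sqnorm K u : \bar R :=
  (\int[lebesgue_st]_(z in K)
     (u z ^+ 2 + \sum_(i < d) wdx K i u z ^+ 2 + wdt K u z ^+ 2)%:E)%E.

(* Laplacian in the space variables, in divergence form. *)
Definition is_wlap K u w : Prop :=
  L2 lebesgue_st K w /\
  forall phi, C1c K phi ->
    (\int[lebesgue_st]_(z in K)
       (\sum_(i < d) wdx K i u z * 'D_(dir_x i) phi z))%R =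
    - (\int[lebesgue_st]_(z in K) (w z * phi z))%R.

Definition wlap K u : 'rV[R]_d * R -> R := xget (cst 0) [set w | is_wlap K u w].

End weak_derivatives.

Section problem.
Variables (R : realType) (d : nat) (OmS : set 'rV[R]_d) (T : R).
Variables (alpha gamma : R) (beta : 'rV[R]_d).
Implicit Types (K : set ('rV[R]_d * R)) (u v f chi : 'rV[R]_d * R -> R).

Local Notation mu := (@lebesgue_st R d).

Definition cyl : set ('rV[R]_d * R) := OmS `*` `]0, T[.
Local Notation Om := cyl.

(* The part of the boundary carrying the boundary and initial conditions. *)
Definition bdryE : set ('rV[R]_d * R) :=
  ((closure OmS `\` OmS) `*` `]0, T[) `|` (OmS `*` [set 0]).

Definition vanishes_near (A : set ('rV[R]_d * R)) u : Prop :=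
  exists U : set ('rV[R]_d * R),
    [/\ open U, closure A `<=` U & forall z, U z -> u z = 0].

(* No regularity of the boundary is assumed, so that "u vanishes on bdryE" is
   meant in the sense of H^1: u is an H^1 limit of C^1 functions vanishing near
   bdryE. *)
Definition H1E u : Prop :=
  H1 Om u /\
  exists phi : nat -> 'rV[R]_d * R -> R,
    (forall n, C1 (phi n) /\ vanishes_near bdryE (phi n)) /\
    H1_sqnorm Om (phi n \- u) @[n --> \oo] --> 0%E.

(* g = u(T): the trace is the extension by continuity, from H^1 to L^2(OmS), of
   the restriction of C^1 functions to t = T. *)
Definition is_traceT u (g : 'rV[R]_d -> R) : Prop :=
  L2 (lebesgue_rV R d) OmS g /\
  exists phi : nat -> 'rV[R]_d * R -> R,
    [/\ forall n, C1 (phi n),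
        H1_sqnorm Om (phi n \- u) @[n --> \oo] --> 0%E &
        (\int[lebesgue_rV R d]_(x in OmS) ((phi n (x, T) - g x) ^+ 2)%:E)%E
          @[n --> \oo] --> 0%E].

Definition traceT u : 'rV[R]_d -> R := xget (cst 0) [set g | is_traceT u g].

(* beta . grad u + u_t *)
Definition strm K u : 'rV[R]_d * R -> R :=
  fun z => \sum_(i < d) beta ord0 i * wdx K i u z + wdt K u z.

Definition Lop K u : 'rV[R]_d * R -> R := fun z =>
  wdt K u z - alpha * wlap K u z
  + \sum_(i < d) beta ord0 i * wdx K i u z + gamma * u z.

(* Integrals over (0, T) of L^2(OmS) inner products and norms are written as
   integrals over the space-time domain. *)
Definition Bform u v : R :=
  (\int[mu]_(z in Om)
     (wdt Om u z * v z
      + alpha * (\sum_(i < d) wdx Om i u z * wdx Om i v z)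
      + (\sum_(i < d) beta ord0 i * wdx Om i u z) * v z
      + gamma * (u z * v z)))%R.

Definition Fform f v : R := (\int[mu]_(z in Om) (f z * v z))%R.

Definition nu : R := (Num.sqrt (\sum_(i < d) beta ord0 i ^+ 2 + 1))^-1.

Definition weak_solution f u : Prop :=
  H1E u /\ forall v, H1E v -> Bform u v = Fform f v.

Definition strong_solution f u : Prop :=
  (exists w, is_wlap Om u w) /\
  {ae mu, forall z, Om z -> Lop Om u z = f z}.

Section discretization.
Variables (p : nat) (theta h : R) (N : nat) (tess : 'I_N -> set ('rV[R]_d * R)).

Definition Bh u v : R :=
  Bform u v +
  \sum_(k < N) (\int[mu]_(z in tess k)
    (Lop (tess k) u z * (theta * h ^+ p * nu * strm (tess k) v z)))%R.

Definition energy2 u : \bar R :=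
  (\int[lebesgue_rV R d]_(x in OmS) (traceT u x ^+ 2)%:E
   + \int[mu]_(z in Om)
       (alpha * (\sum_(i < d) wdx Om i u z ^+ 2)
        + h ^+ p * nu * strm Om u z ^+ 2 + gamma * u z ^+ 2)%:E)%E.

(* int_0^T (h^2 nu)^-1 ||u||^2 + alpha h^2 ||Delta u||^2 dt, Delta elementwise *)
Definition approx2 u : \bar R :=
  (\int[mu]_(z in Om) ((h ^+ 2 * nu)^-1 * u z ^+ 2)%:E
   + \sum_(k < N)
       \int[mu]_(z in tess k) (alpha * h ^+ 2 * wlap (tess k) u z ^+ 2)%:E)%E.

End discretization.
End problem.

Section finite_elements.
Variables (R : realType) (d : nat).
Implicit Types (K : set ('rV[R]_d * R)).

Definition edist (z w : 'rV[R]_d * R) : R :=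
  Num.sqrt (\sum_(i < d) (z.1 ord0 i - w.1 ord0 i) ^+ 2 + (z.2 - w.2) ^+ 2).

Definition diam K : R := sup [set edist z w | z in K & w in K].

(* Elements are represented by their interiors. *)
Definition tessellation (Om : set ('rV[R]_d * R)) N
    (tess : 'I_N -> set ('rV[R]_d * R)) : Prop :=
  [/\ forall k, [/\ open (tess k), tess k !=set0 & tess k `<=` Om],
      forall k, (@lebesgue_st R d).-negligible (closure (tess k) `\` tess k),
      trivIset setT tess &
      closure Om = \bigcup_k closure (tess k)].

Definition shape_regular (kappa : R) N
    (tess : 'I_N -> set ('rV[R]_d * R)) : Prop :=
  forall k, exists c,
    [set z | edist c z < diam (tess k) / kappa] `<=` tess k.

Definition quasiuniform (kappa h : R) N
    (tess : 'I_N -> set ('rV[R]_d * R)) : Prop :=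
  forall k, diam (tess k) <= h <= kappa * diam (tess k).

(* Polynomials in (x, t) of total degree at most r. *)
Definition poly_deg_le (r : nat) (q : 'rV[R]_d * R -> R) : Prop :=
  exists c : {ffun 'I_d -> 'I_r.+1} -> 'I_r.+1 -> R, forall z,
    q z = \sum_(a : {ffun 'I_d -> 'I_r.+1}) \sum_(k < r.+1 | (\sum_i a i + k <= r)%N)
            c a k * (\prod_i z.1 ord0 i ^+ a i) * z.2 ^+ k.

Definition Vh (OmS : set 'rV[R]_d) (T : R) (r N : nat)
    (tess : 'I_N -> set ('rV[R]_d * R)) (v : 'rV[R]_d * R -> R) : Prop :=
  [/\ H1E OmS T v,
      {within closure (cyl OmS T), continuous v} &
      forall k, exists2 q, poly_deg_le r q & forall z, tess k z -> v z = q z].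

End finite_elements.

Definition sd_solution (R : realType) (d : nat) (OmS : set 'rV[R]_d) (T : R)
    (alpha gamma : R) (beta : 'rV[R]_d) (p : nat) (theta h : R) (r N : nat)
    (tess : 'I_N -> set ('rV[R]_d * R)) (f uh : 'rV[R]_d * R -> R) : Prop :=
  Vh OmS T r tess uh /\
  forall v, Vh OmS T r tess v ->
    Bh OmS T alpha gamma beta p theta h tess uh v =
    Fform OmS T f
      (fun z => v z + theta * h ^+ p * nu beta * strm beta (cyl OmS T) v z).

(* Main.v *)
(* Let eta = u - chi, xi = uh - chi, S w = beta.grad w + w_t and c = h^2 nu.
   For w in H1E one has q(w) := 2 (w, S w) = |w(T)|^2 >= 0; this is integration
   by parts for C^1 functions vanishing near bdryE, and it extends by density
   because (t/T) w_t + w/T integrates over (0, T) to w(T), which makes the trace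
   H^1-continuous.  From q(eta - xi/2) >= 0,
     (S eta, xi) + (S xi, eta) <= q(eta) + q(xi)/4,
   so no derivative of xi in the streamline direction survives outside the term
   (eta, S xi), which theta c |S xi|^2 absorbs.  Since f = Lu on the elements,
   B_h(eta, xi) = B_h(xi, xi); the elementwise Laplacian of xi is controlled by
   the inverse inequality |Delta xi|_K^2 <= Cinv h^-2 |grad xi|_K^2, and
   theta <= 1/(2 alpha Cinv) lets alpha |grad xi|^2 absorb it.  Young's
   inequality then bounds the energy of xi by the right-hand side.

   The inverse inequality needs no scaling to a reference element: an element
   lies between two concentric cubes of comparable size, and a polynomial of one
   variable is bounded on the larger interval, with its derivative, by its L^2
   norm on the smaller one (Lagrange interpolation at nodes where its square is at
   most a local mean); Tonelli iterates this over the coordinates. *)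
Require Import Defs.
From HB Require Import structures.
From mathcomp Require Import all_boot all_order all_algebra.
From mathcomp Require Import all_classical all_reals all_analysis.
From mathcomp Require Import measurable_realfun ring lra.
Import Order.TTheory GRing.Theory Num.Theory.
Import numFieldNormedType.Exports.
Local Open Scope classical_set_scope.
Local Open Scope ring_scope.
Set Implicit Arguments.
Unset Strict Implicit.
Unset Printing Implicit Defensive.

(** The derivatives, Laplacians and traces of the definitions are representatives picked by [xget],
    so nothing can be computed from them pointwise. Uniqueness almost everywhere, that is the
    fundamental lemma of the calculus of variations with C^1 tests, is the only access to them.
    Identities are therefore carried over to real L^2 inner products [ip], where null sets
    disappear. The same uniqueness identifies derivatives taken on an element with those taken on
    the whole cylinder; only the Laplacian stays elementwise.

    No regularity of the boundary is available, so boundary terms are removed by extending functions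
    that vanish near [bdryE] by 0 to the whole space, slice by slice in time.

    Independence of h has a hidden cost: Young's inequality leaves theta h^2 nu gamma^2 |eta|^2,
    which compares with gamma |eta|^2 only when h is bounded. The bound is h <= kappa diam K for any
    element K, whose diameter is controlled by the size of the cylinder. *)

(* Coordinates of space-time points are indexed by [option 'I_d], [None] being time. *)
Definition co (R : realType) (d : nat) (j : option 'I_d) (z : 'rV[R]_d * R) : R :=
  if j is Some i then z.1 ord0 i else z.2.

Definition dir (R : realType) (d : nat) (j : option 'I_d) : 'rV[R]_d * R :=
  if j is Some i then dir_x R i else dir_t R d.

Definition box (R : realType) (d : nat) (a b : option 'I_d -> R) :
    set ('rV[R]_d * R) := [set z | forall j, a j < co j z < b j].

(** * Borel measurability from the coordinate sigma-algebra *)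

Section measurability.
Variables (R : realType) (d : nat).
Implicit Types (a b : option 'I_d -> R) (z w : 'rV[R]_d * R).

Lemma measurable_co (j : option 'I_d) : measurable_fun setT (@co R d j).
Proof.
case: j => [i|]; last exact: measurable_snd.
exact: (measurableT_comp (@measurable_coord_rV _ R d i)
  measurable_fst).
Qed.

Lemma continuous_co (j : option 'I_d) : continuous (@co R d j).
Proof.
case: j => [i|] z; last exact: cvg_snd.
apply: (@continuous_comp _ _ _ fst (fun x : 'rV[R]_d => x ord0 i)).
  exact: cvg_fst.
exact: coord_continuous.
Qed.

Lemma box_setE a b : box a b =
  \big[setI/setT]_(j : option 'I_d) (@co R d j @^-1` [set` `]a j, b j[]).
Proof.
apply/seteqP; split=> z.
  move=> zab; apply: (big_ind (fun A : set ('rV[R]_d * R) => A z)) => //.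
  by move=> j _; rewrite /= in_itv; exact: zab.
move=> + j; rewrite (bigD1 j)//= => -[+ _].
by rewrite /= in_itv.
Qed.

Lemma measurable_box a b : measurable (box a b : set ('rV[R]_d * measurableTypeR R)).
Proof.
rewrite box_setE; apply: bigsetI_measurable => j _.
rewrite -[X in measurable X]setTI.
exact: (@measurable_co j measurableT _ (measurable_itv _)).
Qed.

Lemma ball_coP z w (e : R) : 0 < e ->
  ball z e w <-> forall j, `|co j z - co j w| < e.
Proof.
move=> e0; split=> [[zw1 zw2] [i|]|zw].
- by case: zw1 => _ /(_ ord0 i).
- exact: zw2.
- split; last exact: (zw None).
  by split => // i j; rewrite (ord1 i); exact: (zw (Some j)).
Qed.

(** Rational boxes are countably many, which is how the topology meets a sigma-algebra generated by
    coordinates. That even the closed boxes lie in [K] is recorded for later: they will contain the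
    supports of test functions on [K]. *)
Lemma open_bigcup_box (K : set ('rV[R]_d * R)) : open K ->
  exists ab : nat -> (option 'I_d -> R) * (option 'I_d -> R),
   (forall n, forall z, (forall j, (ab n).1 j <= co j z <= (ab n).2 j) -> K z) /\
   K = \bigcup_n box (ab n).1 (ab n).2.
Proof.
move=> oK.
pose I := ({ffun option 'I_d -> rat} * {ffun option 'I_d -> rat})%type.
pose B (i : I) := ((fun j => ratr (i.1 j) : R), (fun j => ratr (i.2 j) : R)).
pose ok (i : I) := `[< forall z, (forall j, (B i).1 j <= co j z <= (B i).2 j) -> K z >].
(* Indices that decode to nothing, or to a box sticking out of [K], get lower bounds 1 and upper
   bounds 0, an empty box. *)
pose ab n := if unpickle n is Some i then if ok i then B i else
  (cst 1, cst 0) else (cst 1 : option 'I_d -> R, cst 0 : option 'I_d -> R).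
have abK n z : (forall j, (ab n).1 j <= co j z <= (ab n).2 j) -> K z.
  have bad : (forall j, (cst 1 : option 'I_d -> R) j <= co j z <=
     (cst 0 : option 'I_d -> R) j) -> K z.
    by move=> /(_ None) /=; lra.
  rewrite /ab; case: (unpickle n) => [i|//].
  by case: ifP => // /asboolP; apply.
exists ab; split => //; apply/seteqP; split => [z Kz|z [n _ zn]]; last first.
  by apply: (abK n) => j; have /andP[/ltW -> /ltW ->] := zn j.
have /nbhs_ballP[e /= e0 ze] : nbhs z K by exact: open_nbhs_nbhs.
have /choice[a a_] j : exists q, co j z - e < ratr q < co j z.
  have /rat_in_itvoo[q] : co j z - e < co j z by lra.
  by rewrite in_itv/=; exists q.
have /choice[b b_] j : exists q, co j z < ratr q < co j z + e.
  have /rat_in_itvoo[q] : co j z < co j z + e by lra.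
  by rewrite in_itv/=; exists q.
pose i : I := ([ffun j => a j], [ffun j => b j]).
have oki : ok i.
  apply/asboolP => w wi; apply: ze; apply/(@ball_coP z w) => // j.
  have := wi j; have := a_ j; have := b_ j; rewrite /= !ffunE => *.
  by rewrite ltr_norml; apply/andP; split; lra.
exists (pickle i) => //; rewrite /ab pickleK oki => j /=.
rewrite !ffunE; have := a_ j; have := b_ j; lra.
Qed.

Lemma open_measurable_st (K : set ('rV[R]_d * R)) : open K ->
  measurable (K : set ('rV[R]_d * measurableTypeR R)).
Proof.
move=> /open_bigcup_box[ab [_ ->]].
by apply: bigcupT_measurable => n; exact: measurable_box.
Qed.

Lemma continuous_measurable_st (f : 'rV[R]_d * R -> R) : continuous f ->
  measurable_fun setT (f : 'rV[R]_d * measurableTypeR R -> measurableTypeR R).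
Proof.
move=> /continuousP cf.
apply: (measurability _ (RGenOpens.measurableE R)) => //=.
move=> _ [_ [a [b ->] <-]]; rewrite setTI.
apply: open_measurable_st; apply: cf; exact: interval_open.
Qed.

End measurability.

Section measurability_rV.
Variables (R : realType) (n : nat).

(** The open space-time cylinder over [A] has [A] as its section at time 0, and sections of
    measurable sets are measurable. *)
Lemma open_measurable_rV (A : set 'rV[R]_n) : open A ->
  measurable (A : set 'rV[R]_n).
Proof.
move=> oA.
have := @open_measurable_st R n (fst @^-1` A).
move=> H.
have /H/(measurable_ysection (0 : measurableTypeR R)) : open (fst @^-1` A : set ('rV[R]_n * R)).
  by apply: open_comp => // z _; exact: cvg_fst.
rewrite (_ : ysection _ _ = A)//.
by apply/seteqP; split=> x; rewrite /ysection /= inE.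
Qed.

Lemma continuous_measurable_rV (f : 'rV[R]_n -> R) : continuous f ->
  measurable_fun setT (f : 'rV[R]_n -> measurableTypeR R).
Proof.
move=> /continuousP cf.
apply: (measurability _ (RGenOpens.measurableE R)) => //=.
move=> _ [_ [a [b ->] <-]]; rewrite setTI.
apply: open_measurable_rV; apply: cf; exact: interval_open.
Qed.

End measurability_rV.

(** * Slices, cubes and integrals of partial derivatives *)

(** Lebesgue measure in dimension n+1 is the image of a product measure under this map, which makes
    Fubini available one coordinate at a time. *)
Definition consp (R : realType) n (p : measurableTypeR R * 'rV[R]_n) : 'rV[R]_n.+1 :=
  row_mx (p.1 : R)%:M p.2.

Section slicing.
Variables (R : realType) (n : nat).
Let leb : {sigma_finite_measure set (measurableTypeR R) -> \bar R} := lebesgue_measure.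
Let lrV := lebesgue_rV R n.

Lemma consp0 (p : measurableTypeR R * 'rV[R]_n) : consp p ord0 ord0 = p.1.
Proof.
have -> : consp p ord0 ord0 = row_mx (p.1 : R)%:M p.2 ord0 (lshift n ord0).
  by congr (row_mx _ _ _ _); exact/val_inj.
by rewrite row_mxEl mxE eqxx mulr1n.
Qed.

Lemma conspS (p : measurableTypeR R * 'rV[R]_n) (i : 'I_n) :
  consp p ord0 (lift ord0 i) = p.2 ord0 i.
Proof.
have -> : consp p ord0 (lift ord0 i) = row_mx (p.1 : R)%:M p.2 ord0 (rshift 1 i).
  by congr (row_mx _ _ _ _); exact/val_inj.
by rewrite row_mxEr.
Qed.

Lemma measurable_consp : measurable_fun setT (@consp R n).
Proof.
apply/measurable_fun_rVP => i; case: (unliftP ord0 i) => [j|] ->.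
  rewrite (_ : (fun _ => _) = (fun x : 'rV[R]_n => x ord0 j) \o snd).
    exact: (measurableT_comp (@measurable_coord_rV _ R n j) measurable_snd).
  by apply/funext => p; rewrite conspS.
rewrite (_ : (fun _ => _) = fst); first exact: measurable_fst.
by apply/funext => p; rewrite consp0.
Qed.

Lemma lebesgue_rVS : lebesgue_rV R n.+1 = pushforward (leb \x lrV)%E (@consp R n).
Proof.
apply/funext => A /=; rewrite /pushforward.
apply: eq_integral => x _ /=; congr (lebesgue_rV R n _).
by apply/seteqP; split => y /=; rewrite /xsection /= inE.
Qed.

Let m : {measure set 'rV[R]_n.+1 -> \bar R} :=
  measure_function_pushforward__canonical__measure_function_Measure
    (leb \x lrV)%E measurable_consp.

Let integral_m (f : 'rV[R]_n.+1 -> \bar R) :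
  (\int[lebesgue_rV R n.+1]_z f z = \int[m]_z f z)%E.
Proof.
apply: eq_measure_integral => A _ _.
exact: (congr1 (fun h => h A) lebesgue_rVS).
Qed.

Lemma ge0_integral_rVS (f : 'rV[R]_n.+1 -> \bar R) :
  measurable_fun setT f -> (forall x, 0 <= f x)%E ->
  (\int[lebesgue_rV R n.+1]_z f z =
   \int[leb]_x \int[lrV]_y f (consp (x, y)))%E.
Proof.
move=> mf f0.
rewrite integral_m ge0_integral_pushforward//= ?preimage_setT; last exact: measurable_consp.
rewrite fubini_tonelli1//.
exact: (measurableT_comp mf measurable_consp).
Qed.

Lemma integrable_rVS (f : 'rV[R]_n.+1 -> \bar R) :
  (lebesgue_rV R n.+1).-integrable setT f ->
  (leb \x lrV)%E.-integrable setT (f \o @consp R n).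
Proof.
move=> /integrableP[mf fi]; apply/integrableP; split.
  exact: (measurableT_comp mf measurable_consp).
move: fi; rewrite ge0_integral_rVS//; last exact: measurableT_comp.
rewrite fubini_tonelli1//.
by apply: measurableT_comp => //; exact: (measurableT_comp mf measurable_consp).
Qed.

Lemma integral_rVS (f : 'rV[R]_n.+1 -> \bar R) :
  (lebesgue_rV R n.+1).-integrable setT f ->
  (\int[lebesgue_rV R n.+1]_z f z = \int[(leb \x lrV)%E]_z f (consp z))%E.
Proof.
move=> intf; rewrite integral_m.
rewrite integral_pushforward//=; first exact: measurable_consp.
  exact: measurable_int intf.
by rewrite preimage_setT; exact: integrable_rVS.
Qed.

End slicing.

(** A directional derivative only sees the restriction of the function to a line. Derivatives thus
    pass between R, row vectors and space-time through a common parametrisation of that line. *)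
Lemma is_derive_line (R : realType) (V W : normedModType R) (f : V -> R) (g : W -> R)
    a v b w (l : R) :
  (forall h : R, f (h *: v + a) = g (h *: w + b)) ->
  is_derive b w g l -> is_derive a v f l.
Proof.
move=> fg.
have fa : f a = g b by have := fg 0; rewrite !scale0r !add0r.
have E : (fun h : R => h^-1 *: ((f \o shift a) (h *: v) - f a)) =
         (fun h : R => h^-1 *: ((g \o shift b) (h *: w) - g b)).
  by apply/funext => h /=; rewrite fg fa.
move=> [dg gl]; split.
  by move: dg; rewrite /derivable -E.
by move: gl; rewrite /derive -E.
Qed.

Lemma continuous_pairr (U V : topologicalType) (u : U) :
  continuous (fun v : V => (u, v)).
Proof.
move=> v A [[B C] [Bu Cv] BCA]; apply: filterS Cv => w Cw.
by apply: BCA; split => //; exact: nbhs_singleton.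
Qed.

Lemma continuous_pairl (U V : topologicalType) (v : V) :
  continuous (fun u : U => (u, v)).
Proof.
move=> u A [[B C] [Bu Cv] BCA]; apply: filterS Bu => w Bw.
by apply: BCA; split => //; exact: nbhs_singleton.
Qed.

Lemma continuous_consp (R : realType) n :
  continuous (@consp R n : R * 'rV[R]_n -> 'rV[R]_n.+1).
Proof.
move=> p; apply/cvg_ballP => e e0.
have := nbhsx_ballx (p : (R * 'rV[R]_n)%type) _ e0.
apply: filterS => q [q1 q2].
split => // i j; rewrite (ord1 i); case: (unliftP ord0 j) => [k|] ->.
  by rewrite !conspS; case: q2 => _; exact.
by rewrite !consp0.
Qed.

Lemma coord_le_norm (R : realType) n (x : 'rV[R]_n) i : `|x ord0 i| <= `|x|.
Proof.
rewrite [leRHS]/Num.norm /= mx_normrE; apply/bigmax_geP; right => /=.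
by exists (ord0, i).
Qed.

Lemma rV_norm_le (R : realType) n (x : 'rV[R]_n) c :
  0 <= c -> (forall i, `|x ord0 i| <= c) -> `|x| <= c.
Proof.
move=> c0 xc; rewrite [leLHS]/Num.norm /= mx_normrE; apply/bigmax_leP; split => //= -[a i] _.
by rewrite (ord1 a).
Qed.

Lemma norm_consp_l (R : realType) n (t : R) (y : 'rV[R]_n) : `|t| <= `|consp (t, y)|.
Proof. by rewrite -[X in `|X| <= _](consp0 (t, y)) coord_le_norm. Qed.

Lemma norm_consp_r (R : realType) n (t : R) (y : 'rV[R]_n) : `|y| <= `|consp (t, y)|.
Proof. by apply: rV_norm_le => // i; rewrite -(conspS (t, y)) coord_le_norm. Qed.

Lemma rV_lineE (R : realType) n (h : R) (k : 'I_n) (x : 'rV[R]_n) j :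
  (h *: delta_mx ord0 k + x) ord0 j = h * (j == k)%:R + x ord0 j.
Proof. by rewrite mxE [in X in X + _]mxE [in X in X + _]mxE. Qed.

Lemma consp_dir0 (R : realType) n (h t : R) (y : 'rV[R]_n) :
  consp (h *: 1 + t, y) = h *: delta_mx ord0 ord0 + consp (t, y).
Proof.
apply/rowP => j; rewrite rV_lineE; case: (unliftP ord0 j) => [k|] ->.
  by rewrite !conspS mulr0 add0r.
by rewrite !consp0.
Qed.

Lemma consp_dirS (R : realType) n (h t : R) (y : 'rV[R]_n) k :
  consp (t, h *: delta_mx ord0 k + y) =
  h *: delta_mx ord0 (lift ord0 k) + consp (t, y).
Proof.
apply/rowP => j; rewrite rV_lineE; case: (unliftP ord0 j) => [l|] ->.
  by rewrite !conspS rV_lineE (inj_eq lift_inj).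
by rewrite !consp0 mulr0 add0r.
Qed.

Lemma is_derive_bsupp (R : realType) (V : normedModType R) (W : V -> R) (M : R) x v d :
  (forall x, M < `|x| -> W x = 0) -> is_derive x v W d -> M < `|x| -> d = 0.
Proof.
move=> W0 [_ <-] Mx; rewrite (@near_eq_derive _ _ _ W (cst 0)) ?derive_cst//.
have : \forall y \near x, M < `|y|.
  apply: (@cvgr_gt _ _ (nbhs x) _ Num.norm `|x|) => //.
  exact: norm_continuous.
by apply: filterS => y /W0.
Qed.

Lemma measurable_cube (R : realType) n (c : 'rV[R]_n) (s : R) :
  measurable [set x : 'rV[R]_n | forall i, `|x ord0 i - c ord0 i| <= s].
Proof.
rewrite (_ : mkset _ = \bigcap_(i in [set: 'I_n])
   ((fun x : 'rV[R]_n => x ord0 i) @^-1` `[c ord0 i - s, c ord0 i + s]%classic)).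
  apply: fin_bigcap_measurable => [|i _]; first exact: finite_finset.
  rewrite -[X in measurable X]setTI.
  exact: (@measurable_coord_rV _ R n i measurableT _ (measurable_itv _)).
apply/seteqP; split => x /= H i.
  by move=> _; have := H i; rewrite /= in_itv/= ler_norml; lra.
by have := H i I; rewrite /= in_itv/= ler_norml; lra.
Qed.

Lemma lebesgue_rV_cube (R : realType) n (c : 'rV[R]_n) (s : R) : 0 <= s ->
  lebesgue_rV R n [set x | forall i, `|x ord0 i - c ord0 i| <= s] = ((2 * s) ^+ n)%:E.
Proof.
move=> s0; elim: n c => [|n IH] c.
  rewrite expr0 /= diracE mem_set//= => i; by case: i.
rewrite lebesgue_rVS /pushforward.
pose c' : 'rV[R]_n := \row_i c ord0 (lift ord0 i).
rewrite (_ : _ @^-1` _ = `[c ord0 ord0 - s, c ord0 ord0 + s]%classic `*`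
   [set x : 'rV[R]_n | forall i, `|x ord0 i - c' ord0 i| <= s]); last first.
  apply/seteqP; split=> -[t y] /=.
    move=> H; split; first by have := H ord0; rewrite consp0/= in_itv/= ler_norml; lra.
    by move=> i; have := H (lift ord0 i); rewrite conspS mxE.
  move=> [+ H] i; case: (unliftP ord0 i) => [k|] ->; rewrite ?conspS ?consp0 /=.
    by have := H k; rewrite mxE.
  by rewrite in_itv/= ler_norml; lra.
rewrite product_measure1E//=; last exact: measurable_cube.
rewrite IH// lebesgue_measure_itv/=.
case: ifPn => h; first by rewrite exprS EFinM; congr (_ * _)%E; rewrite -EFinB; congr EFin; ring.
(* The interval is degenerate only for [s = 0], and both sides then vanish because the exponent
   [n.+1] is positive. *)
have -> : s = 0 by move: h; rewrite lte_fin; lra.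
by rewrite mul0e mulr0 expr0n.
Qed.

Lemma integrable_bsupp_rV (R : realType) n (W : 'rV[R]_n -> R) (M : R) :
  continuous W -> (forall x, M < `|x| -> W x = 0) ->
  (lebesgue_rV R n).-integrable setT (EFin \o W).
Proof.
move=> cW.
wlog M0 : M / 0 <= M => [H W0|W0].
  apply: (H (Num.max M 0)); first by rewrite le_max lexx orbT.
  by move=> x; rewrite gt_max => /andP[/W0].
have mW := continuous_measurable_rV cW.
pose B := [set x : 'rV[R]_n | forall i, `|x ord0 i - (0 : 'rV[R]_n) ord0 i| <= M].
have mB : measurable B by exact: measurable_cube.
have Bfin : (lebesgue_rV R n B < +oo)%E by rewrite lebesgue_rV_cube// ltry.
have cB : compact B.
  rewrite (_ : B = [set x | forall i, `[- M, M]%classic (x ord0 i)]).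
    by apply: (@rV_compact R n (fun=> `[- M, M]%classic)) => i; exact: segment_compact.
  by apply/seteqP; split=> x /= H i; have := H i; rewrite in_itv/= mxE subr0 ler_norml.
have WB : W = W \_ B.
  apply/funext => x; rewrite patchE; case: ifPn => // /negP; rewrite inE => nB.
  apply: W0; rewrite ltNge; apply: contra_notN nB => xM i.
  by rewrite mxE subr0 (le_trans (coord_le_norm _ _)).
have [K [_ WK]] : bounded_set (W @` B).
  apply: compact_bounded; apply: continuous_compact => //.
  exact: continuous_subspaceT.
rewrite WB (_ : EFin \o _ = (EFin \o W) \_ B); last by rewrite restrict_EFin.
apply/(integrable_mkcond _ mB).1; apply: (@measurable_bounded_integrable _ _ _ _ W) => //.
- exact: measurable_funTS.
- exists K; split; first exact: num_real.
  by move=> y Ky x Bx /=; apply: WK => //; exists x.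
Qed.

Section integral_of_derivative.
Variable R : realType.
Local Notation leb := (@lebesgue_measure R).

Lemma integral_deriv_R (g dg : R -> R) (M : R) :
  (forall t : R, is_derive t (1 : R) g (dg t)) -> continuous dg ->
  (forall t, M < `|t| -> g t = 0) -> (\int[leb]_t (dg t)%:E = 0)%E.
Proof.
move=> dgg cdg.
wlog M0 : M / 0 <= M => [H W0|g0].
  apply: (H (Num.max M 0)); first by rewrite le_max lexx orbT.
  by move=> x; rewrite gt_max => /andP[/W0].
have cg : continuous g.
  by move=> t; apply/differentiable_continuous/derivable1_diffP; have [] := dgg t.
have dg0 t : M < `|t| -> dg t = 0 by exact: is_derive_bsupp.
(* The ends [M + 1] lie strictly in the region where [g] vanishes; at [M] itself nothing is
   known. *)
rewrite (_ : (fun t => _) = (EFin \o dg) \_ `[- (M + 1), M + 1]); last first.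
  apply/funext => x; rewrite patchE; case: ifPn => // /negP; rewrite inE /= in_itv/= => h.
  rewrite dg0//; apply: (@lt_trans _ _ (M + 1)); first by rewrite ltrDl.
  by rewrite ltNge ler_norml; apply/negP.
rewrite -integral_mkcond (@continuous_FTC2 _ _ g)//; last 4 first.
- by lra.
- exact: continuous_subspaceT.
- split=> [x _| |]; first by have [] := dgg x.
    by apply: cvg_at_right_filter; exact: cg.
  by apply: cvg_at_left_filter; exact: cg.
- by move=> x _; rewrite derive1E; have [] := dgg x.
rewrite !g0 ?subee//; first by rewrite normrN ger0_norm; lra.
by rewrite ger0_norm; lra.
Qed.

(** Fubini with the variable of differentiation innermost. Along the first coordinate the inner
    integral vanishes by the fundamental theorem of calculus; along another one the slice at a fixed
    first coordinate falls under the induction hypothesis. *)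
Lemma integral_partial_rV n (i : 'I_n) (W DW : 'rV[R]_n -> R) (M : R) :
  (forall x, is_derive x (delta_mx ord0 i) W (DW x)) -> continuous DW ->
  (forall x, M < `|x| -> W x = 0) ->
  (\int[lebesgue_rV R n]_x (DW x)%:E = 0)%E.
Proof.
elim: n i W DW => [[]//|n IH] i W DW dW cDW W0.
have DW0 x : M < `|x| -> DW x = 0 by exact: is_derive_bsupp.
have iDW := integrable_bsupp_rV cDW DW0.
rewrite (integral_rVS iDW).
have iDW' := integrable_rVS iDW.
case: (unliftP ord0 i) => [k|] ik; subst i.
  rewrite -(integral12_prod_meas1 iDW') integral0_eq// => t _.
  apply: (IH k (fun y => W (consp (t, y)))).
  - by move=> y; apply: (is_derive_line _ (dW (consp (t, y)))) => h; rewrite consp_dirS.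
  - move=> y; apply: continuous_comp; last exact: cDW.
    apply: (@continuous_comp _ _ _ (fun y => (t, y)) (@consp R n)); last exact: continuous_consp.
    exact: continuous_pairr.
  - by move=> y My; apply: W0; apply: lt_le_trans My (norm_consp_r _ _).
rewrite -(integral21_prod_meas1 iDW') integral0_eq// => y _.
apply: (@integral_deriv_R (fun t => W (consp (t, y))) _ M).
- by move=> t; apply: (is_derive_line _ (dW (consp (t, y)))) => h; rewrite consp_dir0.
- move=> t; apply: continuous_comp; last exact: cDW.
  apply: (@continuous_comp _ _ _ (fun t => (t, y)) (@consp R n)); last exact: continuous_consp.
  exact: continuous_pairl.
- by move=> t Mt; apply: W0; apply: lt_le_trans Mt (norm_consp_l _ _).
Qed.

End integral_of_derivative.

Section cubes.
Variables (R : realType) (d : nat).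
Local Notation mu := (@lebesgue_st R d).
Implicit Types (c z : 'rV[R]_d * R).

Definition cube c (s : R) : set ('rV[R]_d * R) :=
  [set z | forall j, `|co j z - co j c| <= s].

Lemma cubeE c s : cube c s =
  [set x : 'rV[R]_d | forall i, `|x ord0 i - c.1 ord0 i| <= s] `*`
  `[c.2 - s, c.2 + s]%classic.
Proof.
apply/seteqP; split => z /=.
  by move=> H; split; [move=> i; exact: (H (Some i))|have := H None; rewrite /= in_itv/= ler_norml; lra].
by move=> [H1 H2] [i|]; [exact: H1|move: H2; rewrite /= in_itv/= ler_norml; lra].
Qed.

Lemma measurable_cube_st c s : measurable (cube c s : set ('rV[R]_d * measurableTypeR R)).
Proof.
by rewrite cubeE; apply: measurableX; [exact: measurable_cube|exact: measurable_itv].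
Qed.

Lemma lebesgue_st_cube c s : 0 <= s -> mu (cube c s) = ((2 * s) ^+ d.+1)%:E.
Proof.
move=> s0; rewrite cubeE /lebesgue_st product_measure1E//=; first last.
- exact: measurable_cube.
rewrite lebesgue_rV_cube// lebesgue_measure_itv/=.
case: ifPn => h; first by rewrite exprSr EFinM -EFinB; congr (_ * _)%E; congr EFin; ring.
have -> : s = 0 by move: h; rewrite lte_fin; lra.
by rewrite mule0 mulr0 expr0n.
Qed.

Lemma compact_cube c s : compact (cube c s).
Proof.
rewrite cubeE; apply: compact_setX; last exact: segment_compact.
rewrite (_ : [set x | _] = [set x : 'rV[R]_d | forall i, `[c.1 ord0 i - s, c.1 ord0 i + s]%classic (x ord0 i)]).
  by apply: (@rV_compact R d (fun i => `[c.1 ord0 i - s, c.1 ord0 i + s]%classic)) => i; exact: segment_compact.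
by apply/seteqP; split=> x /= H i; have := H i; rewrite in_itv/= ler_norml; lra.
Qed.

Lemma norm_co_le z j : `|co j z| <= `|z|.
Proof.
rewrite [leRHS]/Num.norm /= le_max; case: j => [i|] /=; last by rewrite lexx orbT.
by rewrite coord_le_norm.
Qed.

Lemma bounded_cube (A : set ('rV[R]_d * R)) (M : R) : (forall z, A z -> `|z| <= M) -> A `<=` cube 0 M.
Proof.
move=> AM z /AM zM j; apply: le_trans zM.
rewrite (_ : co j 0 = 0); last by case: j => //= i; rewrite mxE.
by rewrite subr0 norm_co_le.
Qed.

Lemma continuous_bounded_cube (f : 'rV[R]_d * R -> R) c s : continuous f ->
  exists2 M, 0 <= M & forall z, cube c s z -> `|f z| <= M.
Proof.
move=> cf; have [K [_ WK]] : bounded_set (f @` cube c s).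
  apply: compact_bounded; apply: continuous_compact; last exact: compact_cube.
  exact: continuous_subspaceT.
exists (`|K| + 1); first by rewrite addr_ge0.
move=> z cz; apply: WK; last by exists z.
by rewrite (le_lt_trans (ler_norm K))// ltrDl.
Qed.

Lemma integrable_bounded_st (f : 'rV[R]_d * R -> R) (K : set ('rV[R]_d * R)) (c : 'rV[R]_d * R) s M :
  measurable (K : set ('rV[R]_d * measurableTypeR R)) -> K `<=` cube c s ->
  measurable_fun K (f : 'rV[R]_d * measurableTypeR R -> _) -> (forall z, K z -> `|f z| <= M) ->
  mu.-integrable K (EFin \o f).
Proof.
move=> mK; wlog s0 : s / 0 <= s => [H Kc|Kc].
  apply: (H (Num.max s 0)); first by rewrite le_max lexx orbT.
  by move=> z /Kc cz j; rewrite le_max cz.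
move=> mf fM; apply: measurable_bounded_integrable => //.
  apply: (@le_lt_trans _ _ (mu (cube c s))); last by rewrite lebesgue_st_cube// ltry.
  by apply: le_measure; rewrite ?inE//; exact: measurable_cube_st.
exists M; split; first exact: num_real.
by move=> y My x Kx /=; apply: le_trans (fM _ Kx) (ltW My).
Qed.

Lemma integrable_continuous_st (f : 'rV[R]_d * R -> R) (K : set ('rV[R]_d * R)) c s :
  measurable (K : set ('rV[R]_d * measurableTypeR R)) -> K `<=` cube c s ->
  continuous f -> mu.-integrable K (EFin \o f).
Proof.
move=> mK Kc cf; have [M _ fM] := continuous_bounded_cube c s cf.
apply: (integrable_bounded_st (M := M) mK Kc) => //.
  by apply: measurable_funTS; exact: continuous_measurable_st.
by move=> z /Kc; exact: fM.
Qed.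

Lemma integrable_bsupp_st (W : 'rV[R]_d * R -> R) (M : R) :
  continuous W -> (forall z, M < `|z| -> W z = 0) ->
  mu.-integrable setT (EFin \o W).
Proof.
move=> cW W0.
have -> : EFin \o W = (EFin \o W) \_ (cube 0 M).
  apply/funext => z; rewrite patchE; case: ifPn => // /negP; rewrite inE => nB.
  rewrite /= W0// ltNge; apply: contra_notN nB => zM.
  by apply: (bounded_cube (A:=[set z])) => // _ ->.
apply: (integrable_mkcond _ (measurable_cube_st _ _)).1.
by apply: (integrable_continuous_st (c:=0) (s:=M)) => //; exact: measurable_cube_st.
Qed.

Lemma co_line (h : R) j z k : co k (h *: dir R j + z) = h * (k == j)%:R + co k z.
Proof.
case: j k => [i|] [l|] /=; rewrite ?mulr1 ?mulr0 ?scaler0 ?add0r//.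
  by rewrite rV_lineE.
by rewrite /GRing.scale /= mulr1.
Qed.

Lemma integral_partial_st (j : option 'I_d) (W DW : 'rV[R]_d * R -> R) (M : R) :
  (forall z, is_derive z (dir R j) W (DW z)) -> continuous DW ->
  (forall z, M < `|z| -> W z = 0) ->
  (\int[mu]_z (DW z)%:E = 0)%E.
Proof.
move=> dW cDW W0.
have DW0 z : M < `|z| -> DW z = 0 by exact: is_derive_bsupp.
have iDW := integrable_bsupp_st cDW DW0.
rewrite /lebesgue_st.
case: j dW => [i|] dW.
  rewrite -(integral21_prod_meas1 iDW) integral0_eq// => t _.
  apply: (@integral_partial_rV R d i (fun x => W (x, t)) _ M).
  - move=> x; apply: (is_derive_line _ (dW (x, t))) => h.
    by congr W; congr pair; rewrite /= scaler0 add0r.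
  - move=> x; apply: continuous_comp; last exact: cDW.
    exact: continuous_pairl.
  - by move=> x Mx; apply: W0; rewrite /Num.norm /= lt_max Mx.
rewrite -(integral12_prod_meas1 iDW) integral0_eq// => x _.
apply: (@integral_deriv_R _ (fun t => W (x, t)) _ M).
- move=> t; apply: (is_derive_line _ (dW (x, t))) => h.
  by congr W; congr pair; rewrite /= scaler0 add0r.
- move=> t; apply: continuous_comp; last exact: cDW.
  exact: continuous_pairr.
- by move=> t Mt; apply: W0; rewrite /Num.norm /= lt_max Mt orbT.
Qed.

End cubes.

(** * C^1 functions and uniqueness of weak derivatives *)

Section C1_calculus.
Variables (R : realType) (d : nat).
Local Notation mu := (@lebesgue_st R d).
Local Notation pt := ('rV[R]_d * R)%type.
Implicit Types (phi psi : pt -> R) (z : pt) (j : option 'I_d).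

(** [C1] with the gradient carried as data, so that the sum, product and chain rules compute
    derivatives explicitly. *)
Definition has_grad phi (D : option 'I_d -> pt -> R) : Prop :=
  [/\ continuous phi, forall j z, is_derive z (dir R j) phi (D j z) &
      forall j, continuous (D j)].

Lemma has_gradC1 phi D : has_grad phi D -> C1 phi.
Proof.
move=> [cphi dphi cD].
have DE j : (fun z => 'D_(dir R j) phi z) = D j.
  by apply/funext => z; exact: derive_val.
have along j : C1_along phi (dir R j).
  by split; [move=> z; have [] := dphi j z|rewrite DE].
by split => //; split; [move=> i; exact: (along (Some i))|exact: (along None)].
Qed.

Lemma C1_has_grad phi : C1 phi -> has_grad phi (fun j z => 'D_(dir R j) phi z).
Proof.
move=> [cphi [dx dt]].
have along j : C1_along phi (dir R j) by case: j.
by split => // j => [z|]; have [H1 H2] := along j => //; exact: derivableP.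
Qed.

Lemma has_grad_ext phi psi D E : has_grad phi D -> phi =1 psi ->
  (forall j, D j =1 E j) -> has_grad psi E.
Proof.
move=> h /funext <- DE.
by rewrite (_ : E = D)//; apply/funext => j; apply/funext => z; rewrite DE.
Qed.

Lemma has_grad_cst (c : R) : has_grad (cst c) (fun _ => cst 0).
Proof. by split => *; [exact: cst_continuous|exact: is_derive_cst|exact: cst_continuous]. Qed.

Lemma has_gradD phi psi D E : has_grad phi D -> has_grad psi E ->
  has_grad (fun z => phi z + psi z) (fun j z => D j z + E j z).
Proof.
move=> [c1 d1 D1] [c2 d2 D2]; split => [z|j z|j z]; last exact: cvgD (D1 j z) (D2 j z).
  exact: cvgD (c1 z) (c2 z).
exact: is_deriveD.
Qed.

Lemma has_gradM phi psi D E : has_grad phi D -> has_grad psi E ->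
  has_grad (fun z => phi z * psi z) (fun j z => phi z * E j z + psi z * D j z).
Proof.
move=> [c1 d1 D1] [c2 d2 D2]; split => [z|j z|j z].
- exact: cvgM (c1 z) (c2 z).
- exact: is_deriveM.
- exact: cvgD (cvgM (c1 z) (D2 j z)) (cvgM (c2 z) (D1 j z)).
Qed.

Lemma has_gradZ c phi D : has_grad phi D ->
  has_grad (fun z => c * phi z) (fun j z => c * D j z).
Proof.
move=> h; apply: (has_grad_ext (has_gradM (has_grad_cst c) h)) => // j z.
by rewrite mulr0 addr0.
Qed.

Lemma has_gradB phi psi D E : has_grad phi D -> has_grad psi E ->
  has_grad (fun z => phi z - psi z) (fun j z => D j z - E j z).
Proof.
move=> h1 h2; apply: (has_grad_ext (has_gradD h1 (has_gradZ (-1) h2))).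
  by move=> z; rewrite mulN1r.
by move=> j z; rewrite mulN1r.
Qed.

Lemma has_grad_sum (I : finType) (P : pred I) (F : I -> pt -> R) D :
  (forall i, has_grad (F i) (D i)) ->
  has_grad (fun z => \sum_(i | P i) F i z) (fun j z => \sum_(i | P i) D i j z).
Proof.
move=> h.
suff : forall s : seq I, has_grad (fun z => \sum_(i <- s | P i) F i z)
    (fun j z => \sum_(i <- s | P i) D i j z) by exact.
elim=> [|i s IH].
  by apply: (has_grad_ext (has_grad_cst 0)) => [z|j z]; rewrite big_nil.
case Pi : (P i); last first.
  by apply: (has_grad_ext IH) => [z|j z]; rewrite big_cons Pi.
by apply: (has_grad_ext (has_gradD (h i) IH)) => [z|j z]; rewrite big_cons Pi.
Qed.

Lemma has_grad_co k : has_grad (co k) (fun j => cst (k == j)%:R).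
Proof.
split => [|j z|j]; [exact: continuous_co| |exact: cst_continuous].
apply: (@is_derive_line R pt R (co k) (fun h : R => h * (k == j)%:R + co k z) z (dir R j) 0 1).
  by move=> h; rewrite co_line addr0 /GRing.scale /= mulr1.
apply: is_derive_eq; rewrite /GRing.scale/=; ring.
Qed.

Lemma has_grad_comp phi D (f df : R -> R) : has_grad phi D ->
  (forall x : R, is_derive x (1 : R) f (df x)) -> continuous df ->
  has_grad (fun z => f (phi z)) (fun j z => df (phi z) * D j z).
Proof.
move=> [c1 d1 D1] ff cdf.
have cf : continuous f.
  by move=> t; apply/differentiable_continuous/derivable1_diffP; have [] := ff t.
split => [z|j z|j z].
- by apply: (@continuous_comp _ _ _ phi f); [exact: c1|exact: cf].
- apply: (@is_derive_line R pt R _ (f \o (fun h : R => phi (h *: dir R j + z))) z (dir R j) 0 1).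
    by move=> h; rewrite /= addr0 /GRing.scale /= mulr1.
  apply: is_derive1_comp; first by rewrite scale0r add0r; exact: ff.
  apply: (@is_derive_line R R pt _ phi 0 1 z (dir R j) (D j z)).
  by move=> h; rewrite /= addr0 /GRing.scale /= mulr1.
- by apply: cvgM (D1 j z); apply: (@continuous_comp _ _ _ phi df); [exact: c1|exact: cdf].
Qed.

Lemma C1c_bsupp K psi : C1c K psi -> exists M, forall z, M < `|z| -> psi z = 0.
Proof.
move=> [_ [/compact_bounded[M [_ suppM]] _]]; exists (`|M| + 1) => z zM.
apply/eqP; apply: contraTT zM => psiz; rewrite -leNgt.
by apply: suppM; [rewrite (le_lt_trans (ler_norm M))// ltrDl|exact: subset_closure].
Qed.

Lemma C1c_supp K psi z : C1c K psi -> ~ K z -> psi z = 0.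
Proof.
move=> [_ [_ psiK]] Kz; apply/eqP; apply: contra_notT Kz => psiz.
by apply: psiK; exact: subset_closure.
Qed.

Lemma C1c_supp_deriv K psi z j : C1c K psi -> ~ K z -> 'D_(dir R j) psi z = 0.
Proof.
move=> [_ [_ psiK]] Kz; rewrite (@near_eq_derive _ _ _ psi (cst 0)) ?derive_cst//.
have : nbhs z (~` closure [set z | psi z != 0]).
  by apply: open_nbhs_nbhs; split; [apply: closed_openC; exact: closed_closure|move=> /psiK].
apply: filterS => y ny; apply/eqP; apply: contra_notT ny => psiy.
exact: subset_closure.
Qed.

(** Both integrands vanish off [K] because [psi] has its support there, so the identity is that the
    derivative of the product has integral 0 over the whole space. *)
Lemma integration_by_parts_C1 K phi D psi j : has_grad phi D -> C1c K psi ->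
  (\int[mu]_(z in K) (phi z * 'D_(dir R j) psi z) =
   - \int[mu]_(z in K) (D j z * psi z))%R.
Proof.
move=> hphi hpsi; have [M psiM] := C1c_bsupp hpsi.
have gpsi := C1_has_grad hpsi.1.
have [cphi dphi cD] := hphi; have [cpsi dpsi cE] := gpsi.
rewrite [LHS]Rintegral_mkcond [in RHS]Rintegral_mkcond.
rewrite (_ : (fun z => phi z * _) \_ K = fun z => phi z * 'D_(dir R j) psi z); last first.
  apply/funext => z; rewrite patchE; case: ifPn => // /negP; rewrite inE => Kz.
  by rewrite (C1c_supp_deriv _ hpsi)// mulr0.
rewrite (_ : (fun z => D j z * _) \_ K = fun z => D j z * psi z); last first.
  apply/funext => z; rewrite patchE; case: ifPn => // /negP; rewrite inE => Kz.
  by rewrite (C1c_supp hpsi)// mulr0.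
apply/eqP; rewrite -addr_eq0 -RintegralD//; last 2 first.
- apply: (integrable_bsupp_st (M:=M)); first by move=> z; exact: cvgM (cphi z) (cE j z).
  by move=> z Mz; rewrite (is_derive_bsupp psiM (dpsi j z) Mz) mulr0.
- apply: (integrable_bsupp_st (M:=M)); first by move=> z; exact: cvgM (cD j z) (cpsi z).
  by move=> z Mz; rewrite psiM// mulr0.
have [_ dW cW] := has_gradM hphi gpsi.
rewrite /Rintegral (_ : (fun x => _) = fun z => (phi z * 'D_(dir R j) psi z + psi z * D j z)%:E); last first.
  by apply/funext => z; rewrite [psi z * _]mulrC.
rewrite (integral_partial_st (dW j) (cW j) (M := M))//.
by move=> z Mz; rewrite psiM// mulr0.
Qed.

End C1_calculus.

(** * Bump functions supported in boxes *)

Section bumps.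
Variables (R : realType).

(** Test functions need only be C^1, so squared positive parts can serve as building blocks. At 0
    the difference quotient is [Num.max h 0]. *)
Lemma is_derive_pos2 (x : R) :
  is_derive x (1 : R) (fun y => Num.max y 0 ^+ 2) (2 * Num.max x 0).
Proof.
have cpos : continuous (fun y : R => Num.max y 0).
  by move=> y; apply: continuous_max; [exact: cvg_id|exact: cvg_cst].
have [x0|x0|->] := ltgtP x 0.
- have H : {near x, cst (0 : R) =1 (fun y => Num.max y 0 ^+ 2)}.
    near=> y; rewrite /= (@max_r _ _ y 0) ?expr0n//.
    by apply/ltW; near: y; exact: lt_nbhsl.
  rewrite mulr0.
  split; first exact: near_eq_derivable H (derivable_cst _ _ _).
  by rewrite -(near_eq_derive _ H) derive_cst.
- have H : {near x, (fun y => y ^+ 2) =1 (fun y => Num.max y 0 ^+ 2)}.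
    near=> y; rewrite /= (@max_l _ _ y 0) ?expr0n//.
    by apply/ltW; near: y; exact: lt_nbhsr.
  have D : is_derive x (1 : R) (fun y : R => y ^+ 2) (2 * x).
    by apply: is_derive_eq; rewrite /GRing.scale /=; ring.
  split; first by apply: near_eq_derivable H _; have [] := D.
  by rewrite -(near_eq_derive _ H); have [] := D.
- rewrite mulr0.
  have L : (fun h : R => h^-1 *: (((fun y : R => Num.max y 0 ^+ 2) \o shift 0) (h *: 1) - Num.max 0 0 ^+ 2)) @ 0^' --> (0 : R).
    apply: (@cvg_trans _ ((fun h : R => Num.max h 0) @ 0^')); last first.
      apply: cvg_within_filter; have := cpos 0; rewrite /continuous_at maxxx; exact.
    apply: near_eq_cvg; near=> h.
    have h0 : h != 0 by near: h; exact: nbhs_dnbhs_neq.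
    rewrite /= addr0 maxxx expr0n subr0 /GRing.scale /= mulr1.
    have [hp|hn] := leP h 0; first by rewrite expr0n mulr0.
    by rewrite expr2 mulrA mulVf// mul1r.
  split; first by apply/cvg_ex; exists 0; exact: L.
  exact: cvg_lim L.
Unshelve. all: by end_near. Qed.

Variable d : nat.
Local Notation pt := ('rV[R]_d * R)%type.
Implicit Types (a b : option 'I_d -> R) (z : pt).

Definition box_weight a b z : R := \prod_(j : option 'I_d)
  (Num.max (co j z - a j) 0 ^+ 2 * Num.max (b j - co j z) 0 ^+ 2).

(** A C^1 approximation of the indicator of the box: the weight is positive on the open box and zero
    elsewhere, so the values lie between 0 and 1, tend to 1 inside as n grows and vanish outside. *)
Definition bump a b (n : nat) z : R := 1 - expR (- n%:R * box_weight a b z).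

Lemma C1M (phi psi : pt -> R) : C1 phi -> C1 psi -> C1 (fun z => phi z * psi z).
Proof.
by move=> /C1_has_grad h1 /C1_has_grad h2; exact: has_gradC1 (has_gradM h1 h2).
Qed.

Lemma C1_prod (I : finType) (F : I -> pt -> R) :
  (forall i, C1 (F i)) -> C1 (fun z => \prod_i F i z).
Proof.
move=> h.
suff : forall s : seq I, C1 (fun z => \prod_(i <- s) F i z) by exact.
elim=> [|i s IH].
  have -> : (fun z => \prod_(i <- [::]) F i z) = (cst 1 : pt -> R).
    by apply/funext => z; rewrite big_nil.
  exact: has_gradC1 (has_grad_cst d 1).
rewrite (_ : (fun z => _) = fun z => F i z * \prod_(i <- s) F i z).
  exact: C1M.
by apply/funext => z; rewrite big_cons.
Qed.

Lemma C1_box_weight a b : C1 (box_weight a b).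
Proof.
have cpos : continuous (fun y : R => 2 * Num.max y 0).
  move=> y; apply: cvgM; first exact: cvg_cst.
  by apply: continuous_max; [exact: cvg_id|exact: cvg_cst].
apply: C1_prod => j; apply: C1M.
  exact: has_gradC1 (has_grad_comp (has_gradB (has_grad_co R j) (has_grad_cst _ (a j))) is_derive_pos2 cpos).
exact: has_gradC1 (has_grad_comp (has_gradB (has_grad_cst _ (b j)) (has_grad_co R j)) is_derive_pos2 cpos).
Qed.

Lemma box_weight_ge0 a b z : 0 <= box_weight a b z.
Proof. by apply: prodr_ge0 => j _; rewrite mulr_ge0 ?sqr_ge0. Qed.

Lemma box_weight_gt0 a b z : box a b z -> 0 < box_weight a b z.
Proof.
move=> zab; apply: prodr_gt0 => j _; have /andP[h1 h2] := zab j.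
by rewrite mulr_gt0// exprn_gt0// lt_max subr_gt0 ?h1 ?h2.
Qed.

Lemma box_weight_eq0 a b z : ~ box a b z -> box_weight a b z = 0.
Proof.
move=> /existsNP[j /negP]; rewrite negb_and -!leNgt => h.
rewrite /box_weight (bigD1 j)//=; case/orP: h => h.
  by rewrite (@max_r _ _ _ 0) ?subr_le0// expr0n/= !mul0r.
by rewrite (@max_r _ _ (b j - _) 0) ?subr_le0// expr0n/= mulr0 mul0r.
Qed.

Lemma bump_out a b n z : ~ box a b z -> bump a b n z = 0.
Proof. by move=> /box_weight_eq0 h; rewrite /bump h mulr0 expR0 subrr. Qed.

Lemma bump_bound a b n z : `|bump a b n z| <= 1.
Proof.
have h : - n%:R * box_weight a b z <= 0 by rewrite mulNr oppr_le0 mulr_ge0// box_weight_ge0.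
have e1 : expR (- n%:R * box_weight a b z) <= 1 by rewrite -[X in _ <= X]expR0 ler_expR.
by rewrite /bump ger0_norm ?subr_ge0// gerBl expR_ge0.
Qed.

Lemma bump_cvg a b z : box a b z -> bump a b n z @[n --> \oo] --> (1 : R).
Proof.
move=> /box_weight_gt0; set s := box_weight a b z => s0.
rewrite -[X in _ --> X]subr0; apply: cvgB; first exact: cvg_cst.
rewrite (_ : (fun n => _) = fun n => (expR (- s)) ^+ n); last first.
  by apply/funext => n; rewrite -expRM_natl mulNr mulrN.
apply: cvg_expr; rewrite ger0_norm ?expR_ge0// -expR0 ltr_expR; lra.
Qed.

Definition cbox a b : set pt := [set z | forall j, a j <= co j z <= b j].

Lemma compact_cbox a b : compact (cbox a b).
Proof.
rewrite (_ : cbox a b = [set x : 'rV[R]_d | forall i, `[a (Some i), b (Some i)]%classic (x ord0 i)] `*` `[a None, b None]%classic).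
  apply: compact_setX; last exact: segment_compact.
  by apply: (@rV_compact R d (fun i => `[a (Some i), b (Some i)]%classic)) => i; exact: segment_compact.
apply/seteqP; split => z /=.
  by move=> H; split; [move=> i; rewrite in_itv; exact: (H (Some i))|rewrite in_itv; exact: (H None)].
by move=> [H1 H2] [i|]; [have := H1 i; rewrite in_itv|move: H2; rewrite in_itv].
Qed.

Lemma closed_cbox a b : closed (cbox a b).
Proof. by apply: compact_closed; [exact: norm_hausdorff|exact: compact_cbox]. Qed.

Lemma bump_C1c K a b n : cbox a b `<=` K -> C1c K (bump a b n).
Proof.
move=> abK.
have sub : closure [set z | bump a b n z != 0] `<=` cbox a b.
  rewrite [X in _ `<=` X](closure_id (cbox a b)).1; last exact: closed_cbox.
  apply: closureS => z /= h j.
  have : box a b z by apply: contra_notP (elimN eqP h) => /bump_out ->.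
  by move=> /(_ j)/andP[/ltW -> /ltW ->].
split; last first.
  split; last exact: subset_trans sub abK.
  by apply: subclosed_compact (@compact_cbox a b) sub; exact: closed_closure.
have h1 := C1_has_grad (C1_box_weight a b).
have h2 := has_grad_comp (has_gradZ (- n%:R) h1) (@is_derive_expR R) (@continuous_expR R).
exact: has_gradC1 (has_gradB (has_grad_cst _ 1) h2).
Qed.

End bumps.

(** * The fundamental lemma of the calculus of variations *)

Section fundamental_lemma.
Variables (R : realType) (d : nat).
Local Notation mu := (@lebesgue_st R d).
Local Notation pt := ('rV[R]_d * measurableTypeR R)%type.

Definition boxes : set (set pt) :=
  [set B | exists a b : option 'I_d -> R, B = box a b].

Lemma box_setI (a b a' b' : option 'I_d -> R) : box a b `&` box a' b' =
  box (fun j => Num.max (a j) (a' j)) (fun j => Num.min (b j) (b' j)) :> set pt.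
Proof.
apply/seteqP; split => z.
  by move=> [z1 z2] j; have := z1 j; have := z2 j; rewrite gt_max lt_min => /andP[-> ->] /andP[-> ->].
by move=> H; split => j; have := H j; rewrite gt_max lt_min => /andP[/andP[? ?] /andP[? ?]]; apply/andP.
Qed.

Lemma boxes_setI : setI_closed boxes.
Proof. by move=> _ _ [a [b ->]] [a' [b' ->]]; rewrite box_setI; do 2 eexists. Qed.

(** Dynkin's argument wants a generating pi-system. The coordinates are measurable for the
    sigma-algebra generated by boxes, and they generate the product sigma-algebra. *)
Lemma measurable_boxesE : (@measurable _ pt) = <<s boxes >>.
Proof.
apply/seteqP; split; last first.
  apply: smallest_sub; first exact: sigma_algebra_measurable.
  by move=> _ [a [b ->]]; exact: measurable_box.
pose U : measurableType _ := g_sigma_algebraType boxes.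
have mco (j : option 'I_d) : measurable_fun [set: U] (fun z : U => co j (z : pt) : measurableTypeR R).
  apply: (measurability _ (RGenOpens.measurableE R)) => //=.
  move=> _ [_ [u [v ->] <-]]; rewrite setTI.
  (* A slab in the coordinate [j] is exhausted by boxes whose other sides are ]-n, n[. *)
  rewrite (_ : _ @^-1` _ = \bigcup_n (box (fun k => if k == j then u else - n%:R)
     (fun k => if k == j then v else n%:R))); last first.
    apply/seteqP; split => z /=.
      rewrite in_itv/= => zuv.
      exists (Num.truncn `|z|).+1 => // k; case: ifPn => [/eqP ->//|_].
      rewrite -ltr_norml; apply: le_lt_trans (norm_co_le _ _) _.
      exact: truncnS_gt.
    by move=> [n _ /(_ j)]; rewrite eqxx in_itv.
  apply: bigcupT_measurable => n; apply: sub_sigma_algebra.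
  by do 2 eexists.
have mid : measurable_fun [set: U] (fun z : U => (z : pt)).
  apply/measurable_fun_pairP; split; last exact: (mco None).
  apply/measurable_fun_rVP => i; exact: (mco (Some i)).
by move=> A mA; have := mid measurableT _ mA; rewrite setTI.
Qed.

(** The measurable sets over which [f] integrates to 0 form a Dynkin system containing the pi-system
    of boxes; the vanishing total integral gives closure under complements. *)
Lemma integral_boxes_ae0 (f : pt -> R) : mu.-integrable setT (EFin \o f) ->
  (\int[mu]_z (f z)%:E = 0)%E ->
  (forall a b, \int[mu]_(z in box a b) (f z)%:E = 0)%E ->
  ae_eq mu setT (EFin \o f) (cst 0%E).
Proof.
move=> fi fT fbox.
apply: integral_ae_eq => // E _ mE; rewrite integral0.
move: mE; rewrite measurable_boxesE.
apply: (@dynkin_induction _ _ boxes (fun S => \int[mu]_(z in S) (EFin \o f) z = 0)%E) => //.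
- exact: measurable_boxesE.
- exact: boxes_setI.
- by move=> _ [a [b ->]]; exact: fbox.
- move=> S mS S0.
  have := @integral_setU_EFin _ _ _ mu S (~` S) f mS (measurableC mS).
  rewrite setUv fT S0 add0e => <- //.
    by apply: measurable_funTS; apply/measurable_EFinP; exact: measurable_int fi.
  by rewrite disj_set2E setICr.
- move=> F mF tF F0; rewrite integral_bigcup//; last first.
    by apply: integrableS fi => //; exact: bigcupT_measurable.
  by rewrite eseries0.
Qed.

Implicit Types (K : set ('rV[R]_d * R)) (g : 'rV[R]_d * R -> R).

(** The bumps are admissible tests since the closed box lies in [K]. They converge to the indicator
    of the box and are bounded by 1, so dominated convergence passes the vanishing to the limit. *)
Lemma integral_box_tests0 K g a b : open K -> cbox a b `<=` K ->
  mu.-integrable (box a b) (EFin \o g) ->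
  (forall phi, C1c K phi -> (\int[mu]_(z in K) (g z * phi z))%R = 0) ->
  (\int[mu]_(z in box a b) (g z)%:E = 0)%E.
Proof.
move=> oK abK gi gtest.
have mB : measurable (box a b : set pt) by exact: measurable_box.
have mg : measurable_fun (box a b) (g : pt -> R) by apply/measurable_EFinP; exact: measurable_int gi.
have mbump n : measurable_fun setT (bump a b n : pt -> R).
  apply: continuous_measurable_st.
  by have [] := bump_C1c n abK; case.
have le1 n z : `|g z * bump a b n z| <= `|g z|.
  by rewrite normrM ler_piMr// bump_bound.
have gbi n : mu.-integrable (box a b) (EFin \o (fun z => g z * bump a b n z)).
  apply: (le_integrable mB _ _ gi); first by apply/measurable_EFinP; apply: measurable_funM => //; exact: measurable_funTS.
  by move=> z _ /=; rewrite lee_fin.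
have mgb n : measurable_fun (box a b) (fun z : pt => (g z * bump a b n z)%:E).
  exact: measurable_int (gbi n).
have cv : {ae mu, forall z, box a b z -> (g z * bump a b n z)%:E @[n --> \oo] --> (g z)%:E}.
  apply: aeW => z zB; apply: cvg_EFin; first by near=> n.
  rewrite -[X in _ --> X]mulr1; apply: cvgM; first exact: cvg_cst.
  exact: bump_cvg.
have dom : {ae mu, forall z, forall n, box a b z -> (`|(g z * bump a b n z)%:E| <= `|(g z)%:E|)%E}.
  by apply: aeW => z n _ /=; rewrite lee_fin.
have [_ _] := dominated_convergence mB mgb (measurable_int _ gi) cv (integrable_abse gi) dom.
rewrite (_ : [sequence _]_n = cst 0%E); last first.
  apply/funext => n /=.
  have := gtest _ (bump_C1c n abK).
  rewrite Rintegral_mkcond => H.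
  rewrite -[LHS]fineK; last exact: integrable_fin_num (gbi n).
  congr EFin; rewrite -[RHS]H.
  rewrite -[LHS]/(Rintegral mu (box a b) (fun z => g z * bump a b n z)) Rintegral_mkcond.
  congr (Rintegral _ _ _).
  apply/funext => z; rewrite !patchE; case: ifPn => [|/negP]; rewrite inE => zB.
    rewrite mem_set//; apply: abK => j; have /andP[/ltW -> /ltW ->] := zB j; by [].
  by case: ifPn => // _; rewrite bump_out// mulr0.
by move=> /cvg_lim <- //; rewrite lim_cst.
Unshelve. all: by end_near. Qed.

(** Only local integrability is at hand, so [g] is cut off to each box of a countable cover of [K],
    and each cut-off is treated as a function on the whole space. *)
Lemma ae0_tests K g : open K ->
  (forall a b, cbox a b `<=` K -> mu.-integrable (box a b) (EFin \o g)) ->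
  (forall phi, C1c K phi -> (\int[mu]_(z in K) (g z * phi z))%R = 0) ->
  {ae mu, forall z, K z -> g z = 0}.
Proof.
move=> oK gi gtest.
have [ab [abK KE]] := open_bigcup_box oK.
suff H n : {ae mu, forall z, box (ab n).1 (ab n).2 z -> g z = 0}.
  have := ae_foralln H; apply: filterS => z Hz Kz.
  by move: Kz; rewrite KE => -[n _ zn]; exact: (Hz n).
set a := (ab n).1; set b := (ab n).2.
have abnK : cbox a b `<=` K by move=> z; exact: abK.
have mB := @measurable_box R d a b.
have gE : EFin \o (g \_ (box a b)) = (EFin \o g) \_ (box a b) by rewrite restrict_EFin.
have := @integral_boxes_ae0 (g \_ (box a b)).
rewrite gE => H; have {H} : ae_eq mu setT ((EFin \o g) \_ (box a b)) (cst 0%E).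
  apply: H.
  - by apply/(integrable_mkcond _ mB).1; exact: gi.
  - rewrite (_ : (fun z => _) = (EFin \o g) \_ (box a b))// -integral_mkcond.
    exact: (integral_box_tests0 oK abnK (gi _ _ abnK) gtest).
  - move=> a' b'.
    (* The intersection of two boxes is a box, and its closed version stays in the first closed box,
       hence in [K]. *)
    pose a2 j := Num.max (a j) (a' j); pose b2 j := Num.min (b j) (b' j).
    have sub : cbox a2 b2 `<=` K.
      apply: subset_trans abnK => z zab j; have := zab j.
      by rewrite ge_max le_min => /andP[/andP[-> _] /andP[-> _]].
    rewrite (_ : (fun z => _) = (EFin \o g) \_ (box a b))// -integral_mkcondr setIC box_setI.
    exact: (integral_box_tests0 oK sub (gi _ _ sub) gtest).
apply: filterS => z /= /(_ I); rewrite patchE => + zB.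
by rewrite mem_set// => -[].
Qed.

End fundamental_lemma.

(** * L^2, H^1 and weak Laplacians *)

Section L2_theory.
Context (R : realType) dX (X : measurableType dX) (mu : {measure set X -> \bar R}).
Variable K : set X.
Hypothesis mK : measurable K.
Implicit Types u v w : X -> R.

Lemma L2M_integrable u v : L2 mu K u -> L2 mu K v ->
  mu.-integrable K (fun z => (u z * v z)%:E).
Proof.
move=> [mu_ iu] [mv iv].
apply: (le_integrable mK _ _ (integrableD mK iu iv)).
  by apply/measurable_EFinP; exact: measurable_funM.
move=> z _ /=; rewrite lee_fin.
rewrite [leRHS]ger0_norm ?addr_ge0 ?sqr_ge0// ler_norml.
by apply/andP; split; nra.
Qed.

Lemma L2Z c u : L2 mu K u -> L2 mu K (fun z => c * u z).
Proof.
move=> [mu_ iu]; split; first exact: measurable_funM.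
rewrite (_ : (fun z => _) = fun z => ((c ^+ 2)%:E * (u z ^+ 2)%:E)%E).
  exact: integrableZl.
by apply/funext => z; rewrite -EFinM; congr EFin; ring.
Qed.

Lemma L2D u v : L2 mu K u -> L2 mu K v -> L2 mu K (fun z => u z + v z).
Proof.
move=> Lu Lv; have := L2M_integrable Lu Lv => iuv.
case: Lu Lv => [mu_ iu] [mv iv]; split; first exact: measurable_funD.
rewrite (_ : (fun z => _) =
  ((fun z => (u z ^+ 2)%:E) \+ (fun z => (u z * v z)%:E)) \+
  ((fun z => (u z * v z)%:E) \+ (fun z => (v z ^+ 2)%:E)))%E.
  by do !apply: integrableD => //.
by apply/funext => z /=; rewrite -!EFinD; congr EFin; ring.
Qed.

Lemma L2B u v : L2 mu K u -> L2 mu K v -> L2 mu K (fun z => u z - v z).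
Proof.
move=> Lu Lv; rewrite (_ : (fun z => _) = fun z => u z + (-1) * v z).
  by apply: L2D => //; exact: L2Z.
by apply/funext => z; rewrite mulN1r.
Qed.

Lemma L2_0 : L2 mu K (cst 0).
Proof.
split; first exact: measurable_cst.
by rewrite (_ : (fun z => _) = cst 0%E); [exact: integrable0|apply/funext => z /=; rewrite expr0n].
Qed.

Lemma L2_sum (I : Type) (s : seq I) (F : I -> X -> R) :
  (forall i, L2 mu K (F i)) -> L2 mu K (fun z => \sum_(i <- s) F i z).
Proof.
move=> h; elim: s => [|i s IH].
  rewrite (_ : (fun z => _) = cst 0); first exact: L2_0.
  by apply/funext => z; rewrite big_nil.
rewrite (_ : (fun z => _) = fun z => F i z + \sum_(i <- s) F i z); first exact: L2D.
by apply/funext => z; rewrite big_cons.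
Qed.

Lemma L2S (A : set X) u : measurable A -> A `<=` K -> L2 mu K u -> L2 mu A u.
Proof.
move=> mA AK [mu_ iu]; split; first exact: measurable_funS mu_.
exact: integrableS iu.
Qed.

Lemma L2_integrable u : (mu K < +oo)%E -> L2 mu K u -> mu.-integrable K (EFin \o u).
Proof.
move=> Kfin Lu.
have L1 : L2 mu K (cst 1).
  split; first exact: measurable_cst.
  rewrite (_ : (fun z => _) = EFin \o cst 1); last by apply/funext => z /=; rewrite expr1n.
  apply: measurable_bounded_integrable => //; exists 1; split; first exact: num_real.
  by move=> y y1 z _ /=; rewrite normr1 ltW.
rewrite (_ : EFin \o u = fun z => (u z * cst 1 z)%:E); first exact: L2M_integrable.
by apply/funext => z /=; rewrite mulr1.
Qed.

Lemma L2_eq u v : (forall z, K z -> u z = v z) -> L2 mu K u -> L2 mu K v.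
Proof.
move=> uv [mu_ iu]; split.
  by apply: (eq_measurable_fun u) => // z /set_mem; exact: uv.
by apply: eq_integrable iu => // z /set_mem /uv ->.
Qed.

(** Real-valued, so that estimates end in ordinary arithmetic; bilinearity is established for L^2
    arguments. *)
Definition ip u v : R := (\int[mu]_(z in K) (u z * v z))%R.

Lemma ipC u v : ip u v = ip v u.
Proof. by apply: eq_Rintegral => z _; rewrite mulrC. Qed.

Lemma ipDl u v w : L2 mu K u -> L2 mu K v -> L2 mu K w ->
  ip (fun z => u z + v z) w = ip u w + ip v w.
Proof.
move=> Lu Lv Lw; rewrite /ip.
under eq_Rintegral do rewrite mulrDl.
by rewrite RintegralD//; exact: L2M_integrable.
Qed.

Lemma ipZl c u w : L2 mu K u -> L2 mu K w -> ip (fun z => c * u z) w = c * ip u w.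
Proof.
move=> Lu Lw; rewrite /ip; under eq_Rintegral do rewrite -mulrA.
by rewrite RintegralZl//; exact: L2M_integrable.
Qed.

Lemma ipBl u v w : L2 mu K u -> L2 mu K v -> L2 mu K w ->
  ip (fun z => u z - v z) w = ip u w - ip v w.
Proof.
move=> Lu Lv Lw; rewrite /ip.
under eq_Rintegral do rewrite mulrBl.
by rewrite RintegralB//; exact: L2M_integrable.
Qed.

Lemma ip_suml (I : Type) (s : seq I) (F : I -> X -> R) w :
  (forall i, L2 mu K (F i)) -> L2 mu K w ->
  ip (fun z => \sum_(i <- s) F i z) w = \sum_(i <- s) ip (F i) w.
Proof.
move=> LF Lw; elim: s => [|i s IH].
  rewrite big_nil /ip; under eq_Rintegral do rewrite big_nil mul0r.
  by rewrite Rintegral_cst// mul0r.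
rewrite big_cons -IH -ipDl//; last exact: L2_sum.
by congr ip; apply/funext => z; rewrite big_cons.
Qed.

Lemma ip_ge0 u : 0 <= ip u u.
Proof. by apply: Rintegral_ge0 => z _; rewrite -expr2 sqr_ge0. Qed.

Lemma eq_ip u u' v v' : {ae mu, forall z, K z -> u z = u' z} ->
  {ae mu, forall z, K z -> v z = v' z} ->
  L2 mu K u -> L2 mu K u' -> L2 mu K v -> L2 mu K v' ->
  ip u v = ip u' v'.
Proof.
move=> uu vv Lu Lu' Lv Lv'; congr fine; apply: ae_eq_integral => //.
- exact: measurable_int (L2M_integrable Lu Lv).
- exact: measurable_int (L2M_integrable Lu' Lv').
- by apply: filterS2 uu vv => z h1 h2 Kz; rewrite h1// h2.
Qed.

(** Expansion of 0 <= |2 s u - v|^2. The weight [s] decides which of the two factors is to be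
    absorbed. *)
Lemma ip_young s u v : 0 < s -> L2 mu K u -> L2 mu K v ->
  ip u v <= s * ip u u + (4 * s)^-1 * ip v v.
Proof.
move=> s0 Lu Lv.
have := ip_ge0 (fun z => (2 * s) * u z - v z).
have Lsu := L2Z (2 * s) Lu.
have Ld := L2B Lsu Lv.
rewrite ipBl// ipZl// [ip u (fun z => _ - _)]ipC [ip v (fun z => _ - _)]ipC !ipBl// !ipZl// [ip v u]ipC => H.
have -> : ip u v = (4 * s)^-1 * (4 * s * ip u v) by rewrite mulKf//; lra.
have -> : s * ip u u = (4 * s)^-1 * (4 * s * (s * ip u u)) by rewrite mulKf//; lra.
rewrite -mulrDr ler_pM2l ?invr_gt0; lra.
Qed.

Lemma ipE u : L2 mu K u -> (\int[mu]_(z in K) (u z ^+ 2)%:E)%E = (ip u u)%:E.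
Proof.
move=> [_ iu]; rewrite -[LHS]fineK; last exact: integrable_fin_num iu.
by congr EFin; apply: eq_Rintegral => z _; rewrite expr2.
Qed.

Lemma ipDZ c u v w : L2 mu K u -> L2 mu K v -> L2 mu K w ->
  ip (fun z => u z + c * v z) w = ip u w + c * ip v w.
Proof. by move=> Lu Lv Lw; rewrite -(ipZl c Lv Lw) -(ipDl Lu (L2Z c Lv) Lw). Qed.

(** The shape in which linearity of chosen representatives is used: it holds only almost everywhere,
    which is enough under an inner product. *)
Lemma ae_ipDZ c u' u v w : {ae mu, forall z, K z -> u' z = u z + c * v z} ->
  L2 mu K u' -> L2 mu K u -> L2 mu K v -> L2 mu K w -> ip u' w = ip u w + c * ip v w.
Proof.
move=> ae Lu' Lu Lv Lw; rewrite -(ipDZ c Lu Lv Lw); have Ls := L2D Lu (L2Z c Lv).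
by apply: (eq_ip ae _ Lu' Ls Lw Lw); exact: aeW.
Qed.

Lemma ip_sqDZ c u v : L2 mu K u -> L2 mu K v ->
  ip (fun z => u z + c * v z) (fun z => u z + c * v z) =
  ip u u + 2 * c * ip u v + c ^+ 2 * ip v v.
Proof.
move=> Lu Lv; have Luv := L2D Lu (L2Z c Lv).
have e w : L2 mu K w -> ip w (fun z => u z + c * v z) = ip u w + c * ip v w.
  by move=> Lw; rewrite ipC; exact: ipDZ.
rewrite (ipDZ c Lu Lv Luv) (e _ Lu) (e _ Lv) [ip v u]ipC; ring.
Qed.

Lemma ip_sqD c u v : L2 mu K u -> L2 mu K v ->
  ip (fun z => u z + c * v z) (fun z => u z + c * v z) <= 2 * ip u u + 2 * c ^+ 2 * ip v v.
Proof.
move=> Lu Lv; have := ip_ge0 (fun z => u z + - c * v z).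
rewrite !ip_sqDZ// sqrrN mulrN mulNr; lra.
Qed.

End L2_theory.

#[global] Instance st_ae_filter (R : realType) d :
  Filter (nbhs (almost_everywhere (@lebesgue_st R d))).
Proof. exact: ae_filter_ringOfSetsType. Qed.

(** * Weak first derivatives *)

Section weak_derivatives.
Variables (R : realType) (d : nat).
Local Notation mu := (@lebesgue_st R d).
Local Notation pt := ('rV[R]_d * R)%type.
Implicit Types (K : set pt) (u v g phi : pt -> R) (j : option 'I_d).

Lemma cube_lty c s (K : set pt) : measurable (K : set ('rV[R]_d * measurableTypeR R)) ->
  K `<=` cube c s -> (mu K < +oo)%E.
Proof.
move=> mK; wlog s0 : s / 0 <= s => [H Kc|Kc].
  apply: (H (Num.max s 0)); first by rewrite le_max lexx orbT.
  by move=> z /Kc cz j; rewrite le_max cz.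
apply: (@le_lt_trans _ _ (mu (cube c s))); last by rewrite lebesgue_st_cube// ltry.
by apply: le_measure; rewrite ?inE//; exact: measurable_cube_st.
Qed.

Lemma L2_continuous c s K phi : open K -> K `<=` cube c s -> continuous phi -> L2 mu K phi.
Proof.
move=> /open_measurable_st mK Kc cphi; split.
  by apply: measurable_funTS; exact: continuous_measurable_st.
apply: (integrable_continuous_st mK Kc (f := fun z => phi z ^+ 2)) => z.
exact: (continuous_comp (cphi z) (@exprn_continuous _ 2 _)).
Qed.

Lemma C1c_L2 K phi : open K -> C1c K phi -> L2 mu K phi.
Proof.
move=> /open_measurable_st mK phiK; have [M phiM] := C1c_bsupp phiK.
have cphi : continuous phi by have [[]] := phiK.
split; first by apply: measurable_funTS; exact: continuous_measurable_st.
apply: (@integrableS _ _ _ _ setT) => //.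
apply: (@integrable_bsupp_st _ _ (fun z => phi z ^+ 2) M).
  by move=> z; exact: (continuous_comp (cphi z) (@exprn_continuous _ 2 _)).
by move=> z /phiM ->; rewrite expr0n.
Qed.

Lemma C1c_deriv_L2 K phi j : open K -> C1c K phi -> L2 mu K (fun z => 'D_(dir R j) phi z).
Proof.
move=> /open_measurable_st mK phiK; have [M phiM] := C1c_bsupp phiK.
have [cphi dphi cD] := C1_has_grad phiK.1.
split; first by apply: measurable_funTS; exact: continuous_measurable_st (cD j).
apply: (@integrableS _ _ _ _ setT) => //.
apply: (@integrable_bsupp_st _ _ (fun z => 'D_(dir R j) phi z ^+ 2) M).
  by move=> z; exact: (continuous_comp (cD j z) (@exprn_continuous _ 2 _)).
by move=> z Mz; rewrite (is_derive_bsupp phiM (dphi j z) Mz) expr0n.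
Qed.

(** The fundamental lemma applied to [g - g']. Boxes with compact closure have finite measure, so
    L^2 functions are integrable on them. *)
Lemma L2_tests_unique K g g' : open K -> L2 mu K g -> L2 mu K g' ->
  (forall phi, C1c K phi ->
    (\int[mu]_(z in K) (g z * phi z))%R = (\int[mu]_(z in K) (g' z * phi z))%R) ->
  {ae mu, forall z, K z -> g z = g' z}.
Proof.
move=> oK Lg Lg' gg'; have mK := open_measurable_st oK.
have Ld := L2B mK Lg Lg'.
have : {ae mu, forall z, K z -> g z - g' z = 0}.
  apply: ae0_tests => // [a b abK|phi phiK].
    have sub : box a b `<=` K.
      by move=> z zab; apply: abK => j; have /andP[/ltW -> /ltW ->] := zab j.
    have mB := @measurable_box R d a b.
    apply: L2_integrable => //; last exact: L2S Ld.
    have [M BM] : bounded_set (cbox a b) := compact_bounded (@compact_cbox R d a b).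
    apply: (@cube_lty 0 (`|M| + 1)) => // z zab; apply: (@bounded_cube _ _ [set z]) => // _ ->.
    apply: BM.2; first by rewrite (le_lt_trans (ler_norm M))// ltrDl.
    by move=> j; have /andP[/ltW -> /ltW ->] := zab j.
  have Lphi := C1c_L2 oK phiK.
  have := ipBl mK Lg Lg' Lphi; rewrite /ip => ->.
  by rewrite gg'// subrr.
by move=> H; apply: filterS H => z h /h/eqP; rewrite subr_eq0 => /eqP.
Qed.

(** Every calculation rule for [wderiv] comes from here: exhibit some weak derivative, then compare
    it with the chosen one. *)
Lemma wderiv_unique K a u g g' : open K -> is_wderiv K a u g -> is_wderiv K a u g' ->
  {ae mu, forall z, K z -> g z = g' z}.
Proof.
move=> oK [Lg gP] [Lg' g'P]; apply: L2_tests_unique => // phi phiK.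
by apply: oppr_inj; rewrite -gP// -g'P.
Qed.

Lemma is_wderivD K j c u v g h : open K -> L2 mu K u -> L2 mu K v ->
  is_wderiv K (dir R j) u g -> is_wderiv K (dir R j) v h ->
  is_wderiv K (dir R j) (fun z => u z + c * v z) (fun z => g z + c * h z).
Proof.
move=> oK Lu Lv [Lg gP] [Lh hP]; have mK := open_measurable_st oK.
have Lgh := L2D mK Lg (L2Z mK c Lh).
split; first exact: Lgh.
move=> phi phiK; have Lphi := C1c_L2 oK phiK; have LDphi := C1c_deriv_L2 j oK phiK.
have E1 := ipDl mK Lu (L2Z mK c Lv) LDphi; rewrite /ip in E1; rewrite E1.
have E2 := ipDl mK Lg (L2Z mK c Lh) Lphi; rewrite /ip in E2; rewrite E2.
have E3 := ipZl mK c Lv LDphi; rewrite /ip in E3; rewrite E3.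
have E4 := ipZl mK c Lh Lphi; rewrite /ip in E4; rewrite E4.
rewrite gP// hP//; ring.
Qed.

Lemma C1cS K K' phi : K' `<=` K -> C1c K' phi -> C1c K phi.
Proof. by move=> KK [h1 [h2 h3]]; split => //; split => //; exact: subset_trans h3 KK. Qed.

Lemma Rintegral_supp K K' (f : pt -> R) : K' `<=` K -> (forall z, ~ K' z -> f z = 0) ->
  (\int[mu]_(z in K) f z = \int[mu]_(z in K') f z)%R.
Proof.
move=> KK f0; rewrite [LHS]Rintegral_mkcond [RHS]Rintegral_mkcond.
congr (Rintegral _ _ _); apply/funext => z; rewrite !patchE.
case: ifPn => [|/negP]; rewrite inE => Kz; case: ifPn => [|/negP]; rewrite inE => K'z => //.
  by rewrite f0.
by case: Kz; exact: KK.
Qed.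

(** Test functions on the smaller set are test functions on the larger one, and the integrands
    vanish in between. *)
Lemma is_wderivS K K' j u g : open K -> open K' -> K' `<=` K ->
  is_wderiv K (dir R j) u g -> is_wderiv K' (dir R j) u g.
Proof.
move=> oK oK' KK [Lg gP]; have Lg' := L2S (open_measurable_st oK) (open_measurable_st oK') KK Lg; split; first exact: Lg'.
move=> phi phiK'; rewrite -(Rintegral_supp KK); last first.
  by move=> z K'z; rewrite (C1c_supp_deriv _ phiK')// mulr0.
rewrite -[in RHS](Rintegral_supp KK); last first.
  by move=> z K'z; rewrite (C1c_supp phiK')// mulr0.
exact/gP/(C1cS KK).
Qed.

Lemma eq_is_wderiv K a u v g h : open K -> (forall z, K z -> u z = v z) -> (forall z, K z -> g z = h z) ->
  is_wderiv K a u g -> is_wderiv K a v h.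
Proof.
move=> oK uv gh [Lg gP]; have Lh := L2_eq (open_measurable_st oK) gh Lg; split; first exact: Lh.
move=> phi phiK.
have -> : (\int[mu]_(z in K) (v z * 'D_a phi z) = \int[mu]_(z in K) (u z * 'D_a phi z))%R.
  by apply: eq_Rintegral => z /set_mem /uv ->.
by rewrite gP//; congr (- _); apply: eq_Rintegral => z /set_mem /gh ->.
Qed.

Lemma has_grad_is_wderiv c s K phi D j : open K -> K `<=` cube c s -> has_grad phi D ->
  is_wderiv K (dir R j) phi (D j).
Proof.
move=> oK Kc hphi; split; first by apply: L2_continuous oK Kc _; case: hphi.
by move=> psi psiK; exact: integration_by_parts_C1.
Qed.

Definition wd K j u := wderiv K (dir R j) u.

Lemma H1_wd K j u : H1 K u -> is_wderiv K (dir R j) u (wd K j u).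
Proof.
move=> [_ [ux ut]]; rewrite /wd /wderiv.
have ex : exists g, [set g | is_wderiv K (dir R j) u g] g by case: j.
exact: (xgetPex (cst 0) ex).
Qed.

Lemma H1_wdL2 K j u : H1 K u -> L2 mu K (wd K j u).
Proof. by move=> /(H1_wd j)[]. Qed.

Lemma H1I K u : L2 mu K u -> (forall j, exists g, is_wderiv K (dir R j) u g) -> H1 K u.
Proof. by move=> Lu h; split => //; split; [move=> i; exact: (h (Some i))|exact: (h None)]. Qed.

Lemma H1D K c u v : open K -> H1 K u -> H1 K v -> H1 K (fun z => u z + c * v z).
Proof.
move=> oK Hu Hv; have mK := open_measurable_st oK.
apply: H1I; first by apply: L2D => //; [case: Hu|apply: L2Z => //; case: Hv].
move=> j; exists (fun z => wd K j u z + c * wd K j v z).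
by apply: is_wderivD => //; [case: Hu|case: Hv|exact: H1_wd|exact: H1_wd].
Qed.

Lemma H1B K u v : open K -> H1 K u -> H1 K v -> H1 K (u \- v).
Proof.
move=> oK Hu Hv; rewrite (_ : u \- v = fun z => u z + (-1) * v z); first exact: H1D.
by apply/funext => z /=; rewrite mulN1r.
Qed.

Lemma wdD K j c u v : open K -> H1 K u -> H1 K v ->
  {ae mu, forall z, K z -> wd K j (fun z => u z + c * v z) z = wd K j u z + c * wd K j v z}.
Proof.
move=> oK Hu Hv; apply: (wderiv_unique oK (H1_wd j (H1D c oK Hu Hv))).
by apply: is_wderivD => //; [case: Hu|case: Hv|exact: H1_wd|exact: H1_wd].
Qed.

Lemma wdB K j u v : open K -> H1 K u -> H1 K v ->
  {ae mu, forall z, K z -> wd K j (u \- v) z = wd K j u z - wd K j v z}.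
Proof.
move=> oK Hu Hv; have := wdD j (-1) oK Hu Hv.
rewrite (_ : (fun z => u z + -1 * v z) = u \- v); last first.
  by apply/funext => z /=; rewrite mulN1r.
by apply: filterS => z h Kz; rewrite h// mulN1r.
Qed.

Lemma H1S K K' u : open K -> open K' -> K' `<=` K -> H1 K u -> H1 K' u.
Proof.
move=> oK oK' KK Hu; apply: H1I.
  by have H := L2S (open_measurable_st oK) (open_measurable_st oK') KK Hu.1; exact: H.
by move=> j; exists (wd K j u); apply: (is_wderivS oK oK' KK); exact: H1_wd.
Qed.

(** Converts the derivatives inside [Lop (tess k)], taken on an element, into derivatives on the
    whole cylinder. *)
Lemma wdS K K' j u : open K -> open K' -> K' `<=` K -> H1 K u ->
  {ae mu, forall z, K' z -> wd K' j u z = wd K j u z}.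
Proof.
move=> oK oK' KK Hu; apply: (wderiv_unique oK' (H1_wd j (H1S oK oK' KK Hu))).
exact/(is_wderivS oK oK' KK)/H1_wd.
Qed.

Lemma has_grad_H1 c s K phi D : open K -> K `<=` cube c s -> has_grad phi D -> H1 K phi.
Proof.
move=> oK Kc hphi; apply: H1I; first by apply: L2_continuous oK Kc _; case: hphi.
by move=> j; exists (D j); exact: has_grad_is_wderiv oK Kc hphi.
Qed.

Lemma has_grad_wd c s K phi D j : open K -> K `<=` cube c s -> has_grad phi D ->
  {ae mu, forall z, K z -> wd K j phi z = D j z}.
Proof.
move=> oK Kc hphi; apply: (wderiv_unique oK (H1_wd j (has_grad_H1 oK Kc hphi))).
exact: has_grad_is_wderiv oK Kc hphi.
Qed.

Lemma eq_H1 K u v : open K -> (forall z, K z -> u z = v z) -> H1 K u -> H1 K v.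
Proof.
move=> oK uv Hu; apply: H1I.
  by have H := L2_eq (open_measurable_st oK) uv Hu.1; exact: H.
by move=> j; exists (wd K j u); apply: eq_is_wderiv (H1_wd j Hu).
Qed.

Lemma eq_wd K j u v : open K -> (forall z, K z -> u z = v z) -> H1 K u ->
  {ae mu, forall z, K z -> wd K j u z = wd K j v z}.
Proof.
move=> oK uv Hu; apply: (wderiv_unique oK (g := wd K j u) (u := v)).
  by apply: eq_is_wderiv (H1_wd j Hu).
exact/H1_wd/(eq_H1 oK uv).
Qed.

End weak_derivatives.

Section Rintegral_sums.
Context (R : realType) dX (X : measurableType dX) (mu : {measure set X -> \bar R}).
Variable K : set X.
Hypothesis mK : measurable K.

Lemma integrable_sumR (I : Type) (s : seq I) (F : I -> X -> R) :
  (forall i, mu.-integrable K (EFin \o F i)) ->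
  mu.-integrable K (EFin \o (fun z => \sum_(i <- s) F i z)).
Proof.
move=> iF; elim: s => [|i s IH].
  rewrite (_ : EFin \o _ = cst 0%E); first exact: integrable0.
  by apply/funext => z /=; rewrite big_nil.
apply: eq_integrable (integrableD mK (iF i) IH) => // z _ /=.
by rewrite big_cons EFinD.
Qed.

Lemma Rintegral_sum (I : Type) (s : seq I) (F : I -> X -> R) :
  (forall i, mu.-integrable K (EFin \o F i)) ->
  (\int[mu]_(z in K) (\sum_(i <- s) F i z) = \sum_(i <- s) \int[mu]_(z in K) F i z)%R.
Proof.
move=> iF; elim: s => [|i s IH].
  rewrite big_nil; under eq_Rintegral do rewrite big_nil.
  by rewrite Rintegral_cst// mul0r.
rewrite big_cons -IH -RintegralD//.
  by apply: eq_Rintegral => z _; rewrite big_cons.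
exact: integrable_sumR.
Qed.

Lemma Rintegral_sum_ip (I : Type) (s : seq I) (F G : I -> X -> R) :
  (forall i, L2 mu K (F i)) -> (forall i, L2 mu K (G i)) ->
  (\int[mu]_(z in K) (\sum_(i <- s) F i z * G i z) = \sum_(i <- s) ip mu K (F i) (G i))%R.
Proof.
by move=> LF LG; rewrite Rintegral_sum// => i; exact: L2M_integrable.
Qed.

End Rintegral_sums.

(** * Weak Laplacians *)

Section weak_laplacian.
Variables (R : realType) (d : nat).
Local Notation mu := (@lebesgue_st R d).
Local Notation pt := ('rV[R]_d * R)%type.
Implicit Types (K : set pt) (u v w g phi : pt -> R).

Lemma is_wlapE K u w : open K -> H1 K u -> is_wlap K u w <->
  L2 mu K w /\ forall phi, C1c K phi ->
   \sum_(i < d) ip mu K (wd K (Some i) u) (fun z => 'D_(dir_x R i) phi z) = - ip mu K w phi.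
Proof.
move=> oK Hu; have mK := open_measurable_st oK.
have E phi : C1c K phi ->
   (\int[mu]_(z in K) (\sum_(i < d) wdx K i u z * 'D_(dir_x R i) phi z) =
    \sum_(i < d) ip mu K (wd K (Some i) u) (fun z => 'D_(dir_x R i) phi z))%R.
  move=> phiK; rewrite (Rintegral_sum_ip mK)// => i; first exact: (H1_wdL2 (Some i) Hu).
  exact: (C1c_deriv_L2 (Some i) oK phiK).
split=> -[Lw h]; split => // phi phiK; first by rewrite -E// h.
by rewrite E// h.
Qed.

Lemma wlap_unique K u w w' : open K -> is_wlap K u w -> is_wlap K u w' ->
  {ae mu, forall z, K z -> w z = w' z}.
Proof.
move=> oK [Lw wP] [Lw' w'P]; apply: L2_tests_unique => // phi phiK.
by apply: oppr_inj; rewrite -wP// -w'P.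
Qed.

Lemma is_wlapD K c u v w w' : open K -> H1 K u -> H1 K v ->
  is_wlap K u w -> is_wlap K v w' ->
  is_wlap K (fun z => u z + c * v z) (fun z => w z + c * w' z).
Proof.
move=> oK Hu Hv /(is_wlapE _ oK Hu)[Lw wP] /(is_wlapE _ oK Hv)[Lw' w'P].
have mK := open_measurable_st oK.
apply/(is_wlapE _ oK (H1D c oK Hu Hv)); split.
  by have H := L2D mK Lw (L2Z mK c Lw'); exact: H.
move=> phi phiK; have Lphi := C1c_L2 oK phiK.
rewrite (ipDl mK Lw (L2Z mK c Lw') Lphi) (ipZl mK c Lw' Lphi).
rewrite opprD -mulrN -wP// -w'P// mulr_sumr -big_split /=.
apply: eq_bigr => i _.
have LD := C1c_deriv_L2 (Some i) oK phiK.
have Lu := H1_wdL2 (Some i) Hu; have Lv := H1_wdL2 (Some i) Hv.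
rewrite -(ipZl mK c Lv LD) -(ipDl mK Lu (L2Z mK c Lv) LD).
apply: eq_ip => //; first exact: (wdD (Some i) c oK Hu Hv).
- by apply: aeW.
- exact: H1_wdL2 (H1D c oK Hu Hv).
- by have H := L2D mK Lu (L2Z mK c Lv); exact: H.
Qed.

Lemma ipS K K' (f g : pt -> R) : K' `<=` K -> (forall z, ~ K' z -> g z = 0) ->
  ip mu K f g = ip mu K' f g.
Proof. by move=> KK g0; apply: Rintegral_supp => // z /g0 ->; rewrite mulr0. Qed.

Lemma is_wlapS K K' u w : open K -> open K' -> K' `<=` K -> H1 K u ->
  is_wlap K u w -> is_wlap K' u w.
Proof.
move=> oK oK' KK Hu /(is_wlapE _ oK Hu)[Lw wP].
have Hu' := H1S oK oK' KK Hu; apply/(is_wlapE _ oK' Hu').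
have mK := open_measurable_st oK; have mK' := open_measurable_st oK'.
split; first by have H := L2S mK mK' KK Lw; exact: H.
move=> phi phiK'; rewrite -(ipS _ KK); last by move=> z; exact: C1c_supp.
rewrite -wP; last exact: C1cS KK phiK'.
apply: eq_bigr => i _.
rewrite [RHS](ipS _ KK); last by move=> z; exact: (C1c_supp_deriv (Some i) phiK').
have LD := C1c_deriv_L2 (Some i) oK' phiK'.
have Lu := H1_wdL2 (Some i) Hu.
apply: eq_ip => //.
- exact: (wdS (Some i) oK oK' KK Hu).
- by apply: aeW.
- exact: H1_wdL2.
- by have H := L2S mK mK' KK Lu; exact: H.
Qed.

(** Integration by parts for each first partial derivative. It serves piecewise polynomials: on an
    element the weak Laplacian is the classical one of the polynomial [q]. *)
Lemma has_grad_is_wlap c s K u q D (E : 'I_d -> option 'I_d -> pt -> R) : open K -> K `<=` cube c s ->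
  (forall z, K z -> u z = q z) ->
  has_grad q D -> (forall i, has_grad (D (Some i)) (E i)) ->
  is_wlap K u (fun z => \sum_(i < d) E i (Some i) z).
Proof.
move=> oK Kc uq gq gD.
have mK := open_measurable_st oK.
have Hq := has_grad_H1 oK Kc gq.
have Hu : H1 K u by apply: (eq_H1 oK _ Hq) => z /uq.
have LE i : L2 mu K (E i (Some i)).
  by apply: L2_continuous oK Kc _; case: (gD i).
have LD i : L2 mu K (D (Some i)) by apply: L2_continuous oK Kc _; case: (gD i).
apply/(is_wlapE _ oK Hu); split.
  by have H := L2_sum mK (index_enum 'I_d) LE; exact: H.
move=> phi phiK.
have Lphi := C1c_L2 oK phiK.
rewrite (ip_suml mK _ LE Lphi) -sumrN; apply: eq_bigr => i _.
have [_ <-//] := has_grad_is_wderiv (Some i) oK Kc (gD i).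
have LDp := C1c_deriv_L2 (Some i) oK phiK.
apply: eq_ip => //.
- have qu z : K z -> q z = u z by move/uq.
  have := eq_wd (Some i) oK qu Hq; have := has_grad_wd (Some i) oK Kc gq.
  by apply: filterS2 => z h1 h2 Kz; rewrite -h2// h1.
- by apply: aeW.
- exact: H1_wdL2.
Qed.

Lemma wlapP K u : (exists w, is_wlap K u w) -> is_wlap K u (wlap K u).
Proof. by move=> h; exact: (xgetPex (cst 0) (h : exists w, [set w | is_wlap K u w] w)). Qed.

End weak_laplacian.

(** * Inverse inequality for polynomials *)

Section lagrange_bounds.
Variable R : realType.
Implicit Types (p : {poly R}).

(** The Lagrange basis polynomial of the node [y j], with each factor normalised separately so that
    bounds on the quotients (x - y k) / (y j - y k) multiply. *)
Definition lagr n (y : 'I_n -> R) (j : 'I_n) : {poly R} :=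
  \prod_(k < n | k != j) ((y j - y k)^-1 *: ('X - (y k)%:P)).

(** Both sides have degree less than n and agree at n distinct points. *)
Lemma lagrE n (y : 'I_n -> R) p : injective y -> (size p <= n)%N ->
  p = \sum_(j < n) p.[y j] *: lagr y j.
Proof.
move=> yI sp.
have lagr1 i j : (lagr y i).[y j] = (i == j)%:R.
  rewrite /lagr horner_prod; have [->|ij] := eqVneq i j.
    apply: big1 => k kj; rewrite hornerZ hornerXsubC mulVf// subr_eq0.
    by apply: contra kj => /eqP/yI ->.
  rewrite (bigD1 j) 1?eq_sym//= hornerZ hornerXsubC subrr mulr0 mul0r //.
have sl j : (size (lagr y j) <= n)%N.
  rewrite /lagr (eq_bigr (fun k => (y j - y k)^-1%:P * ('X - (y k)%:P))); last first.
    by move=> k _; rewrite mul_polyC.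
  rewrite big_split /= -rmorph_prod mul_polyC (leq_trans (size_scale_leq _ _))//.
  rewrite -big_filter size_prod_XsubC -[X in (_ <= X)%N](card_ord n) size_filter.
  rewrite -sum1_count (eq_bigl (mem (predC1 j)))// sum1_card cardC1 card_ord.
  by case: (n) j => [[]|].
apply/eqP; rewrite -subr_eq0; apply/eqP.
apply: (@roots_geq_poly_eq0 _ _ [seq y i | i <- enum 'I_n]).
- apply/allP => _ /mapP[i _ ->]; rewrite rootE hornerD hornerN horner_sum (bigD1 i)//=.
  rewrite hornerZ lagr1 eqxx mulr1 big1 ?addr0 ?subrr// => j ji.
  by rewrite hornerZ lagr1 (negbTE ji) mulr0.
- by rewrite map_inj_uniq// enum_uniq.
- rewrite size_map size_enum_ord (leq_trans (size_polyD _ _))// geq_max sp size_polyN.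
  apply: (leq_trans (size_sum _ _ _)); apply/bigmax_leqP => j _.
  by rewrite (leq_trans (size_scale_leq _ _)).
Qed.

(** Induction with the product rule. Since [B] is at least 1, factors skipped by [P] are absorbed
    into the power [size s]. *)
Lemma prod_linear_bound (I : Type) (s : seq I) (P : pred I) (a b : I -> R) (x B D : R) :
  1 <= B -> 0 <= D -> (forall k, P k -> `|a k * (x - b k)| <= B) -> (forall k, P k -> `|a k| <= D) ->
  let L := \prod_(k <- s | P k) (a k *: ('X - (b k)%:P)) in
  `|L.[x]| <= B ^+ size s /\ `|L^`().[x]| <= (size s)%:R * D * B ^+ size s.
Proof.
move=> B1 D0 hB hD; have B0 : 0 <= B by apply: le_trans B1.
elim: s => [|k s [IH1 IH2]] /=.
  by rewrite big_nil -[X in X^`()]polyC1 derivC !hornerE normr1 ?expr0 ?mul0r ?normr0 !lexx.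
rewrite big_cons; case: ifPn => Pk; last first.
  split; first by rewrite exprS (le_trans IH1)// ler_peMl// exprn_ge0.
  apply: (le_trans IH2); apply: ler_pM; rewrite ?mulr_ge0 ?exprn_ge0//.
    by rewrite ler_wpM2r// ler_nat.
  by rewrite exprS ler_peMl// exprn_ge0.
set L := \prod_(_ <- _ | _) _ in IH1 IH2 *.
have h1 := hB _ Pk; have h2 := hD _ Pk.
rewrite derivM derivZ derivXsubC !hornerE !normrM exprS; split.
  by rewrite -normrM ler_pM.
apply: le_trans (ler_normD _ _) _; rewrite !normrM.
have H1 : `|a k| * `|L.[x]| <= D * (B * B ^+ size s).
  apply: ler_pM => //; apply: (le_trans IH1); by rewrite ler_peMl// exprn_ge0.
have H2 : `|a k| * `|x - b k| * `|L^`().[x]| <= B * ((size s)%:R * D * B ^+ size s).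
  by rewrite -normrM; apply: ler_pM.
rewrite -[(size s).+1]add1n natrD; lra.
Qed.

Lemma sqr_sum_le n (a : 'I_n -> R) :
  (\sum_(j < n) a j) ^+ 2 <= n%:R * \sum_(j < n) a j ^+ 2.
Proof.
elim: n a => [|n IH] a; first by rewrite !big_ord0 expr0n mul0r.
case: n IH a => [|n] IH a; first by rewrite !big_ord1 mul1r.
rewrite big_ord_recr [in leRHS]big_ord_recr /=.
have := IH (fun j => a (widen_ord (leqnSn n.+1) j)).
set S := \sum_(i < n.+1) _; set Q := \sum_(i < n.+1) _; set b := a ord_max => SQ.
rewrite -[n.+2%:R]natr1.
have nR : (0 : R) < n.+1%:R by rewrite ltr0n.
(* The bound 2 b S <= (n+1) b^2 + Q with its denominator cleared: the square of (n+1) b - S is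
   nonnegative and S^2 <= (n+1) Q by induction. *)
have : n.+1%:R * (2 * b * S) <= n.+1%:R * (n.+1%:R * b ^+ 2 + Q).
  have := sqr_ge0 (n.+1%:R * b - S); nra.
rewrite ler_pM2l// => H; nra.
Qed.

(** [w] separates the nodes and [A] bounds their distance to [x], so each factor of a basis
    polynomial is at most A / w at [x]. Cauchy-Schwarz then bounds the interpolation formula by the
    sum of squares. *)
Lemma poly_nodes_bound n (y : 'I_n -> R) (p : {poly R}) (x w A : R) :
  0 < w -> w <= A -> (size p <= n)%N ->
  (forall j k, j != k -> w <= `|y j - y k|) -> (forall k, `|x - y k| <= A) ->
  p.[x] ^+ 2 <= n%:R * ((A / w) ^+ n) ^+ 2 * \sum_(j < n) p.[y j] ^+ 2 /\
  p^`().[x] ^+ 2 <= n%:R * (n%:R / w * (A / w) ^+ n) ^+ 2 * \sum_(j < n) p.[y j] ^+ 2.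
Proof.
move=> w0 wA sp yw xA; have A0 : 0 < A by apply: lt_le_trans wA.
have yI : injective y.
  move=> j k yjk; apply/eqP; apply: contraT => jk.
  by have := yw _ _ jk; rewrite yjk subrr normr0 leNgt w0.
have B1 : 1 <= A / w by rewrite ler_pdivlMr// mul1r.
have sz : size (index_enum 'I_n) = n by rewrite [index_enum _]unlock -enumT size_enum_ord.
have ell j : `|(lagr y j).[x]| <= (A / w) ^+ n /\
    `|(lagr y j)^`().[x]| <= n%:R / w * (A / w) ^+ n.
  have hD k : k != j -> `|(y j - y k)^-1| <= w^-1.
    move=> kj; have jk : j != k by rewrite eq_sym.
    have := yw _ _ jk => h; rewrite normfV lef_pV2 ?posrE//; exact: lt_le_trans h.
  have hB k : k != j -> `|(y j - y k)^-1 * (x - y k)| <= A / w.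
    by move=> kj; rewrite normrM mulrC; apply: ler_pM => //; exact: hD.
  have w1 : 0 <= w^-1 by rewrite invr_ge0 ltW.
  by have := prod_linear_bound (index_enum 'I_n) B1 w1 hB hD; rewrite sz.
have gen (b : 'I_n -> R) Bd : (forall j, `|b j| <= Bd) ->
    (\sum_(j < n) p.[y j] * b j) ^+ 2 <= n%:R * Bd ^+ 2 * \sum_(j < n) p.[y j] ^+ 2.
  move=> hb; apply: le_trans (sqr_sum_le _) _; rewrite -mulrA ler_wpM2l//.
  rewrite mulr_sumr; apply: ler_sum => j _; rewrite exprMn mulrC ler_wpM2r ?sqr_ge0//.
  have := hb j; rewrite ler_norml => /andP[h1 h2].
  have Bd0 : 0 <= Bd by apply: le_trans (hb j).
  nra.
rewrite [in X in X <= _ /\ _](lagrE yI sp) [in X in _ /\ X <= _](lagrE yI sp).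
split.
  rewrite horner_sum (eq_bigr (fun j => p.[y j] * (lagr y j).[x])); last by move=> j _; rewrite hornerZ.
  by apply: gen => j; have [] := ell j.
rewrite raddf_sum horner_sum (eq_bigr (fun j => p.[y j] * (lagr y j)^`().[x])); last first.
  by move=> j _; rewrite /= derivZ hornerZ.
by apply: gen => j; have [] := ell j.
Qed.

End lagrange_bounds.

Section poly_bounds.
Variable R : realType.
Local Notation leb := (@lebesgue_measure R).
Implicit Types (p : {poly R}).

(* Left ends of [n] subintervals of `[c - s, c + s] of length [node_ratio n * s],
   separated by gaps of the same length. *)
Definition node_ratio n : R := 2 / (2 * n%:R - 1).
Definition node n (c s : R) (j : 'I_n) : R := c - s + (2 * j)%:R * (node_ratio n * s).

Lemma node_ratio_gt0 n : (0 < n)%N -> 0 < node_ratio n <= 2.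
Proof.
move=> n0; have n1 : (1 : R) <= n%:R by rewrite ler1n.
rewrite /node_ratio; apply/andP; split; first by rewrite divr_gt0//; lra.
rewrite ler_pdivrMr; lra.
Qed.

Lemma node_sep n (c s : R) (y : 'I_n -> R) : (0 < n)%N -> 0 < s ->
  (forall j, node c s j <= y j <= node c s j + node_ratio n * s) ->
  (forall j k, j != k -> node_ratio n * s <= `|y j - y k|) /\
  (forall j, `|y j - c| <= s).
Proof.
move=> n0 s0 yj; have /andP[r0 r2] := node_ratio_gt0 n0.
have w0 : 0 < node_ratio n * s by rewrite mulr_gt0.
(* The n subintervals and the n - 1 gaps between them, all of equal length, fill exactly the length
   2 s. *)
have wE : (2 * n%:R - 1) * (node_ratio n * s) = 2 * s.
  have n1 : (1 : R) <= n%:R by rewrite ler1n.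
  rewrite /node_ratio; field; lra.
split; last first.
  move=> j; have /andP[h1 h2] := yj j; move: h1 h2; rewrite /node => h1 h2.
  have : (j.+1)%:R <= n%:R :> R by rewrite ler_nat.
  rewrite -natr1 => jn; have j0 : (0 : R) <= j%:R by [].
  move: h1 h2; rewrite natrM => h1 h2.
  rewrite ler_norml; apply/andP; split; nra.
have main (j k : 'I_n) : (j < k)%N -> node_ratio n * s <= y k - y j.
  move=> jk; have /andP[h1 h2] := yj j; have /andP[h3 h4] := yj k.
  have : (j.+1)%:R <= k%:R :> R by rewrite ler_nat.
  rewrite -natr1 => jk'; move: h1 h2 h3 h4; rewrite /node !natrM; nra.
move=> j k; rewrite neq_ltn => /orP[/main h|/main h]; last exact: le_trans h (ler_norm _).
by rewrite distrC; apply: le_trans h (ler_norm _).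
Qed.

(** The point is where the square of [p] is minimal on the closed interval, by the extreme value
    theorem. *)
Lemma poly_small_point p (a w : R) : 0 < w ->
  exists2 y, a <= y <= a + w &
    ((w * p.[y] ^+ 2)%:E <= \int[leb]_(t in `[a, (a + w)%R]) (p.[t] ^+ 2)%:E)%E.
Proof.
move=> w0; have cp2 : continuous (fun x => p.[x] ^+ 2).
  by move=> x; exact: (continuous_comp (@continuous_horner _ p x) (@exprn_continuous _ 2 _)).
have [y yI ymin] : exists2 y, y \in `[a, a + w] &
    forall t, t \in `[a, a + w] -> p.[y] ^+ 2 <= p.[t] ^+ 2.
  by apply: EVT_min; [rewrite lerDl ltW|exact: continuous_subspaceT].
exists y; first by move: yI; rewrite in_itv.
have -> : (w * p.[y] ^+ 2)%:E = (\int[leb]_(t in `[a, (a + w)%R]) (p.[y] ^+ 2)%:E)%E.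
  rewrite integral_cst//= lebesgue_measure_itv/= lte_fin ltrDl w0 -EFinB -EFinM.
  by congr EFin; ring.
apply: ge0_le_integral => //.
- by move=> t _; rewrite lee_fin sqr_ge0.
- by apply/measurable_EFinP; apply: measurable_funTS; exact: continuous_measurable_fun.

Qed.

Lemma poly_L2_bound n (m : R) : (0 < n)%N -> 1 <= m ->
  exists2 C : R, 0 < C & forall (c s : R) p (x : R), 0 < s -> (size p <= n)%N ->
  `|x - c| <= m * s ->
  ((p.[x] ^+ 2)%:E <=
    (C / s)%:E * \int[leb]_(t in `[(c - s)%R, (c + s)%R]) (p.[t] ^+ 2)%:E)%E.
Proof.
move=> n0 m1; have /andP[r0 r2] := node_ratio_gt0 n0.
have nR : (0 : R) < n%:R by rewrite ltr0n.
(* The ratio A / w, where A = (m + 1) s bounds the distance from [x] to a node through the centre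
   [c] and w is the node separation. The scale [s] cancels, so the constant is scale-free. *)
pose B := (m + 1) / node_ratio n.
have B0 : 0 < B by rewrite divr_gt0//; lra.
exists (n%:R ^+ 2 * (B ^+ n) ^+ 2 / node_ratio n).
  by rewrite divr_gt0// mulr_gt0// !exprn_gt0.
move=> c s p x s0 sp xc; set w := node_ratio n * s.
have w0 : 0 < w by rewrite mulr_gt0.
have /choice[y hy] (j : 'I_n) : exists y, node c s j <= y <= node c s j + w /\
    ((w * p.[y] ^+ 2)%:E <= \int[leb]_(t in `[node c s j, (node c s j + w)%R]) (p.[t] ^+ 2)%:E)%E.
  by have [y h1 h2] := poly_small_point p (node c s j) w0; exists y.
have [sep yc] := node_sep n0 s0 (fun j => (hy j).1).
have wA : w <= (m + 1) * s by rewrite /w; nra.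
have xA k : `|x - y k| <= (m + 1) * s.
  have := yc k => h; rewrite (_ : x - y k = (x - c) - (y k - c)); last by ring.
  by apply: le_trans (ler_normB _ _) _; nra.
have [+ _] := @poly_nodes_bound R n y p x w ((m + 1) * s) w0 wA sp sep xA.
have -> : (m + 1) * s / w = B by rewrite /B /w; field; rewrite !gt_eqF.
set Q := \sum_(j < n) _ => pQ.
(* Each local integral is bounded by the one over the whole interval, at the cost of a factor n. *)
have wQ : ((w * Q)%:E <= n%:R%:E * \int[leb]_(t in `[(c - s)%R, (c + s)%R]) (p.[t] ^+ 2)%:E)%E.
  rewrite /Q mulr_sumr -sumEFin.
  have -> : n%:R%:E = (\sum_(j < n) 1%E :> \bar R)%E.
    by rewrite sumEFin sumr_const card_ord.
  rewrite ge0_sume_distrl//; apply: lee_sum => j _; rewrite mul1e.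
  apply: le_trans (hy j).2 _; apply: ge0_subset_integral => //.
  - apply/measurable_EFinP; apply: measurable_funTS; apply: continuous_measurable_fun => t.
    exact: (continuous_comp (@continuous_horner _ p t) (@exprn_continuous _ 2 _)).
  - by move=> t _; rewrite lee_fin sqr_ge0.
  - have h1 : forall j : 'I_n, `|node c s j - c| <= s.
      by apply: (@node_sep n c s _ n0 s0 _).2 => k; rewrite lexx lerDl ltW.
    have h2 : forall j : 'I_n, `|node c s j + w - c| <= s.
      by apply: (@node_sep n c s (fun j => node c s j + w) n0 s0 _).2 => k; rewrite lexx lerDl ltW.
    have := h1 j; have := h2 j; rewrite !ler_norml => /andP[_ h3] /andP[h4 _] t /=.
    by rewrite !in_itv/= => /andP[h5 h6]; apply/andP; split; lra.
apply: (@le_trans _ _ ((n%:R * (B ^+ n) ^+ 2 / w)%:E * (w * Q)%:E)%E).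
  rewrite -EFinM lee_fin (le_trans pQ)// le_eqVlt; apply/orP; left; apply/eqP; field.
  by rewrite gt_eqF.
rewrite (_ : n%:R ^+ 2 * (B ^+ n) ^+ 2 / node_ratio n / s = n%:R * (B ^+ n) ^+ 2 / w * n%:R); last first.
  by rewrite /w; field; rewrite !gt_eqF.
rewrite [X in (_ <= X * _)%E]EFinM -muleA; apply: lee_wpmul2l => //.
by rewrite lee_fin ltW// divr_gt0// mulr_gt0// !exprn_gt0.
Qed.

(** Here the square of [p] is bounded pointwise, so the left ends serve as nodes. Differentiating a
    basis polynomial costs a factor 1 / w, hence s^-2 after squaring. *)
Lemma poly_deriv_bound n (m : R) : (0 < n)%N -> 1 <= m ->
  exists2 C : R, 0 < C & forall (c s M : R) p (x : R), 0 < s -> (size p <= n)%N ->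
  `|x - c| <= m * s -> (forall y, `|y - c| <= s -> p.[y] ^+ 2 <= M) ->
  p^`().[x] ^+ 2 <= C / s ^+ 2 * M.
Proof.
move=> n0 m1; have /andP[r0 r2] := node_ratio_gt0 n0.
have nR : (0 : R) < n%:R by rewrite ltr0n.
pose B := (m + 1) / node_ratio n.
have B0 : 0 < B by rewrite divr_gt0//; lra.
exists (n%:R ^+ 4 * (B ^+ n) ^+ 2 / node_ratio n ^+ 2).
  by apply: divr_gt0; [apply: mulr_gt0; do !apply: exprn_gt0|apply: exprn_gt0].
move=> c s M p x s0 sp xc pM; set w := node_ratio n * s.
have w0 : 0 < w by rewrite mulr_gt0.
have [sep yc] : (forall j k : 'I_n, j != k -> w <= `|node c s j - node c s k|) /\
    (forall j : 'I_n, `|node c s j - c| <= s).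
  by apply: (@node_sep n c s) => // k; rewrite lexx lerDl ltW.
have wA : w <= (m + 1) * s by rewrite /w; nra.
have xA (k : 'I_n) : `|x - node c s k| <= (m + 1) * s.
  have := yc k => h; rewrite (_ : x - node c s k = (x - c) - (node c s k - c)); last by ring.
  by apply: le_trans (ler_normB _ _) _; nra.
have [_] := @poly_nodes_bound R n (node c s) p x w ((m + 1) * s) w0 wA sp sep xA.
have -> : (m + 1) * s / w = B by rewrite /B /w; field; rewrite !gt_eqF.
move=> /le_trans; apply.
apply: (@le_trans _ _ (n%:R * (n%:R / w * B ^+ n) ^+ 2 * (n%:R * M))).
  apply: ler_wpM2l; first by rewrite mulr_ge0 ?sqr_ge0.
  have -> : n%:R * M = \sum_(j < n) M by rewrite sumr_const card_ord mulr_natl.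
  by apply: ler_sum => j _; exact: pM.
rewrite le_eqVlt; apply/orP; left; apply/eqP; rewrite /w; field.
by rewrite !gt_eqF.
Qed.

End poly_bounds.

(** At fixed [x0] the value is bounded by an integral in y, whose integrand is in turn bounded by an
    integral in t; Tonelli merges the two. The product is general because it is used both for
    splitting off a coordinate and for splitting space from time. *)
Lemma iterated_bound d1 d2 (X : measurableType d1) (Y : measurableType d2) (R : realType)
    (m1 : {sigma_finite_measure set X -> \bar R}) (m2 : {sigma_finite_measure set Y -> \bar R})
    (F : X * Y -> R) (I : set X) (J : set Y) (a b : R) x0 y0 :
  measurable_fun setT F -> (forall z, 0 <= F z) -> measurable I -> measurable J ->
  0 <= a -> 0 <= b ->
  (forall y, J y -> ((F (x0, y))%:E <= a%:E * \int[m1]_(t in I) (F (t, y))%:E)%E) ->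
  ((F (x0, y0))%:E <= b%:E * \int[m2]_(y in J) (F (x0, y))%:E)%E ->
  ((F (x0, y0))%:E <= (b * a)%:E * \int[m1 \x m2]_(z in I `*` J) (F z)%:E)%E.
Proof.
move=> mF F0 mI mJ a0 b0 h1 h2.
have mF' (A : set (X * Y)) : measurable A -> measurable_fun setT ((EFin \o F) \_ A).
  move=> mA; apply/(measurable_restrictT _ mA).
  by apply: measurable_funTS; exact/measurable_EFinP.
have F0' (A : set (X * Y)) z : (0 <= ((EFin \o F) \_ A) z)%E.
  by rewrite patchE; case: ifPn => // _; rewrite lee_fin.
have inner y : J y -> fubini_G m1 ((EFin \o F) \_ (I `*` setT)) y = (\int[m1]_(t in I) (F (t, y))%:E)%E.
  move=> _; rewrite /fubini_G [RHS]integral_mkcond; apply: eq_integral => t _.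
  rewrite !patchE; case: ifPn => [|/negP]; rewrite inE => tI.
    by rewrite mem_set//; case: tI.
  by case: ifPn => // /set_mem It; case: tI.
have mG : measurable_fun setT (fubini_G m1 ((EFin \o F) \_ (I `*` setT))).
  by apply: measurable_fun_fubini_tonelli_G => //; apply: mF'; exact: measurableX.
have -> : (\int[m1 \x m2]_(z in I `*` J) (F z)%:E =
           \int[m2]_(y in J) \int[m1]_(t in I) (F (t, y))%:E)%E.
  rewrite integral_mkcond fubini_tonelli2; [|by apply: mF'; exact: measurableX|by []].
  rewrite [RHS]integral_mkcond; apply: eq_integral => y _.
  rewrite patchE; case: ifPn => [|/negP]; rewrite inE => yJ.
    rewrite /fubini_G [RHS]integral_mkcond; apply: eq_integral => t _.
    rewrite !patchE; case: ifPn => [|/negP]; rewrite inE => tI.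
      by rewrite mem_set//; case: tI.
    by case: ifPn => // /set_mem It; case: tI.
  rewrite /fubini_G integral0_eq// => t _; rewrite patchE ifN//.
  by apply/negP; rewrite inE => -[].
apply: (le_trans h2); rewrite EFinM -muleA; apply: lee_wpmul2l; first by rewrite lee_fin.
rewrite -ge0_integralZl//; last 2 first.
- apply: (eq_measurable_fun (fubini_G m1 ((EFin \o F) \_ (I `*` setT)))).
    by move=> y /set_mem /inner.
  exact: measurable_funTS.
- by move=> y _; apply: integral_ge0 => t _; rewrite lee_fin.
apply: ge0_le_integral => //.
- by move=> y _; rewrite lee_fin.
- apply/measurable_EFinP; apply: measurable_funTS.
  exact: (measurableT_comp mF (pair1_measurable x0)).
- apply: measurable_funeM.
  apply: (eq_measurable_fun (fubini_G m1 ((EFin \o F) \_ (I `*` setT)))).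
    by move=> y /set_mem /inner.
  exact: measurable_funTS.
Qed.

(** Degree less than n along every line in the direction [v]. The integral bounds use only this,
    which passes to slices unchanged. *)
Definition poly_along (R : realType) (V : lmodType R) n (g : V -> R) (v : V) : Prop :=
  forall z, exists2 p : {poly R}, (size p <= n)%N & forall h, g (h *: v + z) = p.[h].

Section multivariate_bounds.
Variables (R : realType) (n : nat) (m C : R).
Local Notation leb := (@lebesgue_measure R).
Hypothesis C0 : 0 < C.
Hypothesis HC : forall (c s : R) (p : {poly R}) (x : R), 0 < s -> (size p <= n)%N ->
  `|x - c| <= m * s ->
  ((p.[x] ^+ 2)%:E <=
    (C / s)%:E * \int[leb]_(t in `[(c - s)%R, (c + s)%R]) (p.[t] ^+ 2)%:E)%E.

Lemma rV_L2_bound k (g : 'rV[R]_k -> R) (c x : 'rV[R]_k) (s : R) :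
  continuous g -> (forall i, poly_along n g (delta_mx ord0 i)) -> 0 < s ->
  (forall i, `|x ord0 i - c ord0 i| <= m * s) ->
  ((g x ^+ 2)%:E <= ((C / s) ^+ k)%:E * \int[lebesgue_rV R k]_(y in
     [set y | forall i, `|y ord0 i - c ord0 i| <= s]%R) (g y ^+ 2)%:E)%E.
Proof.
move=> + + s0; have Cs : 0 <= C / s by rewrite divr_ge0// ltW.
elim: k g c x => [|k IH] g c x cg pg xc.
  have xs0 (y : 'rV[R]_0) : y = 0 by apply/rowP => -[].
  have mc := @measurable_cube R 0 c s.
  have mg2 : measurable_fun [set y : 'rV[R]_0 | forall i, `|y ord0 i - c ord0 i| <= s]
     (fun y => (g y ^+ 2)%:E).
    by apply: (eq_measurable_fun (cst (g 0 ^+ 2)%:E)) => // y _; rewrite (xs0 y).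
  rewrite expr0 mul1e (@integral_dirac _ _ _ _ _ mc _ mg2).
  by rewrite diracE mem_set ?mul1e ?(xs0 x)// => -[].
pose c' : 'rV[R]_k := \row_i c ord0 (lift ord0 i).
pose x' : 'rV[R]_k := \row_i x ord0 (lift ord0 i).
have xE : x = consp (x ord0 ord0, x').
  by apply/rowP => i; case: (unliftP ord0 i) => [l|] ->; rewrite ?conspS ?consp0 ?mxE.
pose F (z : measurableTypeR R * 'rV[R]_k) := g (consp z) ^+ 2.
have mg2 : measurable_fun setT (fun y => g y ^+ 2).
  apply: continuous_measurable_rV => y.
  exact: (continuous_comp (cg y) (@exprn_continuous _ 2 _)).
have mF : measurable_fun setT F by exact: (measurableT_comp mg2 (@measurable_consp R k)).
have mcube := @measurable_cube R k.+1 c s.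
have mcube' := @measurable_cube R k c' s.
pose I := `[c ord0 ord0 - s, c ord0 ord0 + s]%classic.
have mI : measurable (I : set (measurableTypeR R)) by exact: measurable_itv.
have -> : (\int[lebesgue_rV R k.+1]_(y in [set y | forall i, (`|y ord0 i - c ord0 i| <= s)%R])
     (g y ^+ 2)%:E = \int[leb \x lebesgue_rV R k]_(z in
        I `*` [set y : 'rV[R]_k | forall i, (`|y ord0 i - c' ord0 i| <= s)%R]) (F z)%:E)%E.
  rewrite integral_mkcond [RHS]integral_mkcond ge0_integral_rVS; last 2 first.
  - apply/(measurable_restrictT _ mcube); apply: measurable_funTS; exact/measurable_EFinP.
  - by move=> y; rewrite patchE; case: ifPn => // _; rewrite lee_fin sqr_ge0.
  rewrite fubini_tonelli1; last 2 first.
  - apply/(measurable_restrictT _ (measurableX mI mcube')); apply: measurable_funTS; exact/measurable_EFinP.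
  - by move=> y; rewrite patchE; case: ifPn => // _; rewrite lee_fin sqr_ge0.
  apply: eq_integral => t _; apply: eq_integral => y _; rewrite !patchE /F.
  have E : (consp (t, y) \in [set y : 'rV[R]_k.+1 | forall i, (`|y ord0 i - c ord0 i| <= s)%R]) =
     ((t, y) \in I `*` [set y : 'rV[R]_k | forall i, (`|y ord0 i - c' ord0 i| <= s)%R]).
    apply/idP/idP; rewrite !inE /=.
      move=> H; split; first by have := H ord0; rewrite consp0 /I /= in_itv/= ler_norml; lra.
      by move=> i; have := H (lift ord0 i); rewrite conspS mxE.
    move=> [h1 h2] i; case: (unliftP ord0 i) => [l|] ->; rewrite ?conspS ?consp0 /=.
      by have := h2 l; rewrite mxE.
    by move: h1; rewrite /I /= in_itv/= ler_norml; lra.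
  by rewrite E.
rewrite [(C / s) ^+ k.+1]exprSr [in X in (X <= _)%E]xE.
have H := @iterated_bound _ _ _ _ _ leb (lebesgue_rV R k) F I
  [set y : 'rV[R]_k | forall i, `|y ord0 i - c' ord0 i| <= s] (C / s) ((C / s) ^+ k) (x ord0 ord0) x' mF.
apply: H => //.
- by move=> z; exact: sqr_ge0.
- exact: exprn_ge0.
- move=> y _; have [p sp pE] := pg ord0 (consp (0, y)).
  have gE t : g (consp (t, y)) = p.[t].
    by rewrite -pE -consp_dir0; congr (g (consp (_, _))); rewrite addr0 /GRing.scale/= mulr1.
  rewrite /F gE; apply: (le_trans (HC (c := c ord0 ord0) s0 sp _)); first exact: xc.
  by rewrite le_eqVlt; apply/orP; left; apply/eqP; congr (_ * _)%E; apply: eq_integral => t _; rewrite gE.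
- apply: (IH (fun y => g (consp (x ord0 ord0, y)))).
  + move=> y; apply: (@continuous_comp _ _ _ (fun y => consp (x ord0 ord0, y)) g); last exact: cg.
    apply: (@continuous_comp _ _ _ (fun y => (x ord0 ord0, y)) (@consp R k)); last exact: continuous_consp.
    exact: continuous_pairr.
  + move=> i y; have [p sp pE] := pg (lift ord0 i) (consp (x ord0 ord0, y)).
    by exists p => // h; rewrite -pE -consp_dirS.
  + by move=> i; rewrite !mxE; exact: xc.
Qed.

Local Notation mu := (@lebesgue_st R _).

Lemma st_L2_bound k (g : 'rV[R]_k * R -> R) (c z : 'rV[R]_k * R) (s : R) :
  continuous g -> (forall j, poly_along n g (dir R j)) -> 0 < s ->
  cube c (m * s) z ->
  ((g z ^+ 2)%:E <= ((C / s) ^+ k.+1)%:E * \int[mu]_(y in cube c s) (g y ^+ 2)%:E)%E.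
Proof.
move=> cg pg s0 zc; have Cs : 0 <= C / s by rewrite divr_ge0// ltW.
pose F (y : 'rV[R]_k * measurableTypeR R) := g y ^+ 2.
have mF : measurable_fun setT F.
  apply: continuous_measurable_st => y.
  exact: (continuous_comp (cg y) (@exprn_continuous _ 2 _)).
rewrite cubeE [(C / s) ^+ k.+1]exprS; case: z zc => x t zc.
apply: (@iterated_bound _ _ _ _ _ (lebesgue_rV R k) leb F _ _ ((C / s) ^+ k) (C / s) x t) => //.
- by move=> y; exact: sqr_ge0.
- exact: measurable_cube.
- exact: exprn_ge0.
- move=> u _; apply: (rV_L2_bound (g := fun y => g (y, u))) => //.
  + move=> y; apply: (@continuous_comp _ _ _ (fun y => (y, u)) g); last exact: cg.
    exact: continuous_pairl.
  + move=> i y; have [p sp pE] := pg (Some i) (y, u).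
    exists p => // h; rewrite -pE; congr g; congr pair.
    by rewrite /= scaler0 add0r.
  + by move=> i; exact: (zc (Some i)).
- have [p sp pE] := pg None (x, 0).
  have gE v : g (x, v) = p.[v].
    by rewrite -pE; congr g; congr pair; rewrite /= ?scaler0 ?add0r// addr0 /GRing.scale/= mulr1.
  rewrite /F gE; apply: (le_trans (HC (c := c.2) s0 sp _)); first exact: (zc None).
  by rewrite le_eqVlt; apply/orP; left; apply/eqP; congr (_ * _)%E; apply: eq_integral => v _; rewrite gE.
Qed.

End multivariate_bounds.

Section space_time_polynomials.
Variables (R : realType) (d : nat).
Local Notation mu := (@lebesgue_st R d).
Local Notation pt := ('rV[R]_d * R)%type.
Implicit Types (a : option 'I_d -> nat) (q : pt -> R).

Definition monomial a (z : pt) : R := \prod_j co j z ^+ a j.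

(** The degree is bounded in each variable separately instead of in total: this is what restriction
    to coordinate lines sees, and it is stable under partial derivatives with the same [r]. *)
Definition is_mpoly r q := exists (I : finType) (cf : I -> R) (a : I -> option 'I_d -> nat),
  (forall i j, (a i j <= r)%N) /\ forall z, q z = \sum_i cf i * monomial (a i) z.

Lemma monomial_line a (h : R) j z : monomial a (h *: dir R j + z) =
  (h + co j z) ^+ a j * \prod_(k | k != j) co k z ^+ a k.
Proof.
rewrite /monomial (bigD1 j)//= co_line eqxx mulr1; congr (_ * _).
by apply: eq_bigr => k /negbTE kj; rewrite co_line kj mulr0 add0r.
Qed.

Lemma continuous_monomial a : continuous (monomial a).
Proof.
suff [] : C1 (monomial a) by [].
apply: C1_prod => j; elim: (a j) => [|n IH].
  exact: has_gradC1 (has_grad_cst d 1).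
rewrite (_ : (fun z => _) = fun z => co j z * co j z ^+ n); last first.
  by apply/funext => z; rewrite exprS.
by apply: C1M => //; exact: has_gradC1 (has_grad_co R j).
Qed.

Lemma has_grad_monomial a : has_grad (monomial a)
  (fun j z => (a j)%:R * monomial (fun k => if k == j then (a j).-1 else a k) z).
Proof.
split; first exact: continuous_monomial.
  move=> j z.
  set c := \prod_(k | k != j) co k z ^+ a k.
  have E : monomial (fun k => if k == j then (a j).-1 else a k) z = co j z ^+ (a j).-1 * c.
    rewrite /monomial (bigD1 j)//= eqxx; congr (_ * _).
    by apply: eq_bigr => k /negbTE ->.
  apply: (@is_derive_line R pt R _ (fun h : R => (h + co j z) ^+ a j * c) z (dir R j) 0 1).
    by move=> h; rewrite monomial_line addr0 /GRing.scale /= mulr1.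
  pose p := ('X + (co j z)%:P) ^+ a j * c%:P.
  rewrite (_ : (fun h : R => _) = (fun h => p.[h])); last first.
    by apply/funext => h; rewrite /p !hornerE.
  have -> : (a j)%:R * monomial (fun k => if k == j then (a j).-1 else a k) z = p^`().[0].
    rewrite E /p derivM derivC mulr0 addr0 deriv_exp derivD derivX derivC addr0 mul1r.
    rewrite hornerM hornerMn horner_exp hornerD hornerX !hornerC add0r.
    by rewrite -[X in _ = X * _]mulr_natl mulrA.
  exact: is_derive_poly.
move=> j z; apply: cvgM; first exact: cvg_cst.
exact: continuous_monomial.
Qed.

Lemma is_mpoly_grad r q : is_mpoly r q ->
  exists2 D, has_grad q D & forall j, is_mpoly r (D j).
Proof.
move=> [I [cf [a [ar qE]]]].
exists (fun j z => \sum_i cf i * ((a i j)%:R * monomial (fun k => if k == j then (a i j).-1 else a i k) z)).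
  have H : has_grad (fun z => \sum_i cf i * monomial (a i) z)
     (fun j z => \sum_i cf i * ((a i j)%:R * monomial (fun k => if k == j then (a i j).-1 else a i k) z)).
    by apply: has_grad_sum => i; apply: has_gradZ; exact: has_grad_monomial.
  by apply: has_grad_ext H _ _ => // z; rewrite qE.
move=> j; exists I, (fun i => cf i * (a i j)%:R), (fun i k => if k == j then (a i j).-1 else a i k).
split; last by move=> z; apply: eq_bigr => i _; rewrite mulrA.
by move=> i k; case: ifPn => // _; rewrite (leq_trans (leq_pred _)).
Qed.

Lemma is_mpoly_along r q j : is_mpoly r q -> poly_along r.+1 q (dir R j).
Proof.
move=> [I [cf [a [ar qE]]]] z.
exists (\sum_i (cf i * \prod_(k | k != j) co k z ^+ a i k) *: ('X + (co j z)%:P) ^+ a i j).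
  apply: (leq_trans (size_sum _ _ _)); apply/bigmax_leqP => i _.
  rewrite (leq_trans (size_scale_leq _ _))// (leq_trans (size_poly_exp_leq _ _))//.
  by rewrite size_XaddC mul1n ltnS.
move=> h; rewrite qE horner_sum; apply: eq_bigr => i _.
by rewrite monomial_line hornerZ horner_exp hornerD hornerX hornerC; ring.
Qed.

Lemma prod_option (F : option 'I_d -> R) :
  \prod_j F j = F None * \prod_i F (Some i).
Proof.
rewrite (bigD1 None)//=; congr (_ * _).
rewrite (reindex_omap Some id); last by case.
by apply: eq_bigl => i; rewrite /= eqxx.
Qed.

Lemma poly_deg_le_mpoly r q : poly_deg_le r q -> is_mpoly r q.
Proof.
move=> [c qE].
exists ({ffun 'I_d -> 'I_r.+1} * 'I_r.+1)%type,
  (fun p : {ffun 'I_d -> 'I_r.+1} * 'I_r.+1 => if (\sum_i p.1 i + p.2 <= r)%N then c p.1 p.2 else 0),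
  (fun (p : {ffun 'I_d -> 'I_r.+1} * 'I_r.+1) j => if j is Some i then nat_of_ord (p.1 i) else nat_of_ord p.2); split.
  by move=> p [i|]; rewrite -ltnS.
move=> z; rewrite qE pair_big_dep /= [LHS]big_mkcond /=; apply: eq_bigr => -[e k] _ /=.
case: ifPn => _; last by rewrite mul0r.
by rewrite -mulrA; congr (_ * _); rewrite /monomial prod_option /= mulrC.
Qed.

(** The L^2 norm on the inner cube controls q on the outer cube, which controls the derivative at
    the points of K along coordinate lines; this constant bound is integrated over K. The volume (2
    m s)^(d+1) cancels (C1 / s)^(d+1), leaving s^-2. *)
Lemma inverse_estimate r (m : R) : 1 <= m -> exists2 C : R, 0 < C &
  forall (K : set pt) (c : pt) (s : R) q D,
    is_mpoly r q -> has_grad q D -> open K -> 0 < s -> cube c s `<=` K -> K `<=` cube c (m * s) ->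
    forall j, ip mu K (D j) (D j) <= C / s ^+ 2 * ip mu K q q.
Proof.
move=> m1; have r0 : (0 < r.+1)%N by [].
have [C1 C10 HC1] := poly_L2_bound r0 m1.
have [C2 C20 HC2] := poly_deriv_bound r0 m1.
exists (C2 * C1 ^+ d.+1 * (2 * m) ^+ d.+1).
  by rewrite !mulr_gt0// exprn_gt0//; lra.
move=> K c s q D qp qD oK s0 cK Kc j.
have mK := open_measurable_st oK.
have cq : continuous q by case: qD.
have cD : continuous (D j) by case: qD.
have Lq : L2 mu K q by exact: L2_continuous oK Kc cq.
have LD : L2 mu K (D j) by exact: L2_continuous oK Kc cD.
have ms0 : 0 <= m * s by rewrite mulr_ge0//; lra.
set Q := ip mu K q q.
have qz z : cube c (m * s) z -> q z ^+ 2 <= (C1 / s) ^+ d.+1 * Q.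
  move=> zc; rewrite -lee_fin.
  apply: (le_trans (st_L2_bound C10 HC1 cq _ s0 zc)) => [k|]; first exact: is_mpoly_along.
  rewrite EFinM -(ipE mK Lq); apply: lee_wpmul2l.
    by rewrite lee_fin exprn_ge0// divr_ge0// ltW.
  apply: ge0_subset_integral => //; first exact: measurable_cube_st.
  - exact: measurable_int Lq.2.
  - by move=> y _; rewrite lee_fin sqr_ge0.
have Dz z : K z -> D j z ^+ 2 <= C2 / s ^+ 2 * ((C1 / s) ^+ d.+1 * Q).
  move=> Kz; have zc := Kc _ Kz.
  have [p sp pE] := is_mpoly_along j qp z.
  (* Re-centred so that the variable is the j-th coordinate itself instead of the displacement from
     [z]. *)
  pose p' := p \Po ('X - (co j z)%:P).
  have qE t : q ((t - co j z) *: dir R j + z) = p'.[t].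
    by rewrite pE horner_comp !hornerE.
  have -> : D j z = p'^`().[co j z].
    have [_ dq _] := qD.
    have h1 : is_derive (co j z) (1 : R) (fun t => p'.[t]) (D j z).
      apply: (is_derive_line _ (dq j z)) => h; rewrite -qE; congr q.
      by rewrite /GRing.scale /= mulr1 addrK.
    have h2 := @is_derive_poly R p' (co j z).
    by case: h1 => _ <-; case: h2 => _ <-.
  apply: (HC2 (co j c) s _ p' (co j z)) => //.
  - by rewrite size_comp_poly2// size_XsubC.
  (* Moving only the j-th coordinate to within [s] of the centre stays in the outer cube, because m
     is at least 1. *)
  - move=> y yc; rewrite -qE; apply: qz => k; rewrite co_line.
    have [->|kj] := eqVneq k j; last by rewrite mulr0 add0r.
    rewrite mulr1 subrK; apply: (le_trans yc); nra.
have Q0 : 0 <= Q by exact: ip_ge0.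
have cst0 : 0 <= C2 / s ^+ 2 * ((C1 / s) ^+ d.+1 * Q).
  by rewrite mulr_ge0 ?divr_ge0 ?mulr_ge0 ?exprn_ge0 ?divr_ge0//; exact: ltW.
rewrite -lee_fin -(ipE mK LD).
have H : (\int[mu]_(z in K) (D j z ^+ 2)%:E <=
    \int[mu]_(z in K) (C2 / s ^+ 2 * ((C1 / s) ^+ d.+1 * Q))%:E)%E.
  apply: ge0_le_integral => //.
  - by move=> z _; rewrite lee_fin sqr_ge0.
  - exact: measurable_int LD.2.
apply: (le_trans H); rewrite integral_cst//.
apply: (@le_trans _ _ ((C2 / s ^+ 2 * ((C1 / s) ^+ d.+1 * Q))%:E * mu (cube c (m * s)))%E).
  apply: lee_wpmul2l; first by rewrite lee_fin.
  by apply: le_measure; rewrite ?inE//; exact: measurable_cube_st.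
rewrite lebesgue_st_cube// -EFinM lee_fin le_eqVlt; apply/orP; left; apply/eqP.
rewrite !exprMn !exprVn; field.
by rewrite expf_neq0 ?gt_eqF.
Qed.

End space_time_polynomials.

(** * The trace at the final time and the energy identity *)

Section C1_energy.
Variables (R : realType) (d : nat) (OmS : set 'rV[R]_d) (T M : R).
Hypotheses (oOmS : open OmS) (OmSM : forall x, OmS x -> `|x| <= M) (T0 : 0 < T).
Local Notation mu := (@lebesgue_st R d).
Local Notation leb := (@lebesgue_measure R).
Local Notation lrV := (lebesgue_rV R d).
Local Notation pt := ('rV[R]_d * R)%type.
Local Notation Om := (cyl OmS T).
Implicit Types (W phi : pt -> R).

Lemma open_cyl : open Om.
Proof.
rewrite /cyl (_ : _ `*` _ = fst @^-1` OmS `&` snd @^-1` `]0, T[%classic)//.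
apply: openI; apply: open_comp => //; try exact: itv_open; move=> z _.
  exact: cvg_fst.
exact: cvg_snd.
Qed.

Lemma cyl_cube : Om `<=` cube 0 (Num.max M T).
Proof.
apply: bounded_cube => -[x t] [/OmSM xM] /=; rewrite in_itv/= => /andP[t0 tT].
rewrite /Num.norm /= ge_max; apply/andP; split; rewrite le_max.
  by rewrite xM.
by rewrite ger0_norm ?(ltW tT) ?orbT// ltW.
Qed.

Let mOm := open_measurable_st open_cyl.
Let mOmS := open_measurable_rV oOmS.

Lemma FTC_oo (g dg : R -> R) : (forall t : R, is_derive t (1 : R) g (dg t)) ->
  continuous dg -> (\int[leb]_(t in `]0%R, T[) (dg t)%:E = (g T - g 0)%:E)%E.
Proof.
move=> dgg cdg.
have cg : continuous g.
  by move=> t; apply/differentiable_continuous/derivable1_diffP; have [] := dgg t.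
have mdg (A : set R) : measurable_fun A (EFin \o dg : measurableTypeR R -> \bar R).
  by apply/measurable_EFinP; apply: measurable_funTS; exact: continuous_measurable_fun.
rewrite integral_itv_bndo_bndc; last exact: mdg.
rewrite integral_itv_obnd_cbnd; last exact: mdg.
rewrite (@continuous_FTC2 _ _ g)//; last 3 first.
- exact: continuous_subspaceT.
- split=> [x _| |]; first by have [] := dgg x.
    by apply: cvg_at_right_filter; exact: cg.
  by apply: cvg_at_left_filter; exact: cg.
- by move=> x _; rewrite derive1E; have [] := dgg x.
Qed.

Lemma slice_t W D x : has_grad W D -> forall t : R,
  is_derive t (1 : R) (fun t => W (x, t)) (D None (x, t)).
Proof.
move=> [_ dW _] t; apply: (is_derive_line _ (dW None (x, t))) => h.
by congr W; congr pair; rewrite /= scaler0 add0r.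
Qed.

Lemma integral_time W D : has_grad W D ->
  (\int[mu]_(z in Om) (D None z)%:E = \int[lrV]_(x in OmS) (W (x, T) - W (x, 0))%:E)%E.
Proof.
move=> gW; have [cW dW cD] := gW.
have iD := integrable_continuous_st mOm cyl_cube (cD None).
have iD' := (integrable_mkcond _ mOm).1 iD.
rewrite integral_mkcond -(integral12_prod_meas1 iD') [RHS]integral_mkcond.
apply: eq_integral => x _; rewrite /fubini_F patchE; case: ifPn => [|/negP]; rewrite inE => xO.
  rewrite -(FTC_oo (slice_t x gW)); last first.
    move=> t; apply: (@continuous_comp _ _ _ (fun t => (x, t)) (D None)); last exact: cD.
    exact: continuous_pairr.
  rewrite [RHS]integral_mkcond; apply: eq_integral => t _; rewrite !patchE.
  case: ifPn => [|/negP]; rewrite inE => xt; first by rewrite mem_set//; case: xt.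
  by case: ifPn => // /set_mem tT; case: xt.
rewrite integral0_eq// => t _; rewrite patchE ifN//.
by apply/negP; rewrite inE => -[].
Qed.

(* [W] extended by 0 outside [OmS] in space stays C^1 for each fixed time, so its
   partial derivatives integrate to 0. *)
Lemma integral_space0 W D (i : 'I_d) : has_grad W D -> vanishes_near (bdryE OmS T) W ->
  (\int[mu]_(z in Om) (D (Some i) z)%:E = 0)%E.
Proof.
move=> gW [U [oU bU WU]]; have [cW dW cD] := gW.
have DU z j : U z -> D j z = 0.
  move=> Uz; have [_ <-] := dW j z; rewrite (@near_eq_derive _ _ _ W (cst 0)) ?derive_cst//.
  have : nbhs z U by exact: open_nbhs_nbhs.
  by apply: filterS => y /WU.
have iD := integrable_continuous_st mOm cyl_cube (cD (Some i)).
have iD' := (integrable_mkcond _ mOm).1 iD.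
rewrite integral_mkcond -(integral21_prod_meas1 iD') integral0_eq// => t _.
rewrite /fubini_G.
have [tT|tT] := boolP (t \in `]0, T[); last first.
  by rewrite integral0_eq// => x _; rewrite patchE ifN//; apply/negP; rewrite inE => -[_]; exact/negP.
pose V := (fun x => W (x, t)) \_ OmS.
pose DV := (fun x => D (Some i) (x, t)) \_ OmS.
(* Every point has a neighbourhood inside [OmS] or one on which the extension vanishes. At a
   boundary point the latter holds because (x, t) lies in [bdryE] and W vanishes near it; at an
   exterior point by definition of the extension. *)
have cases (x : 'rV[R]_d) : (\forall y \near x, OmS y) \/
    (\forall y \near x, V y = 0 /\ DV y = 0).
  have [xO|xO] := pselect (OmS x); first by left; exact: open_nbhs_nbhs.
  right; have [xc|xc] := pselect (closure OmS x).
    have Uxt : U (x, t) by apply: bU; apply: subset_closure; left; split.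
    have : \forall y \near x, U (y, t).
      apply: (@continuous_pairl _ _ t x U); exact: open_nbhs_nbhs.
    apply: filterS => y Uy; rewrite /V /DV !patchE; case: ifPn => // _.
    by rewrite WU// DU.
  have : nbhs x (~` closure OmS).
    by apply: open_nbhs_nbhs; split => //; apply: closed_openC; exact: closed_closure.
  apply: filterS => y yc; rewrite /V /DV !patchE; case: ifPn => // /set_mem yO.
  by exfalso; apply: yc; exact: subset_closure.
have dV (x : 'rV[R]_d) : is_derive x (delta_mx ord0 i) V (DV x).
  have [xO|x0] := cases x.
    have H : {near x, (fun y => W (y, t)) =1 V}.
      by apply: filterS xO => y yO; rewrite /V patchE mem_set.
    have -> : DV x = D (Some i) (x, t) by rewrite /DV patchE mem_set//; exact: nbhs_singleton xO.
    have dl : is_derive x (delta_mx ord0 i) (fun y => W (y, t)) (D (Some i) (x, t)).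
      apply: (is_derive_line _ (dW (Some i) (x, t))) => h.
      by congr W; congr pair; rewrite /= scaler0 add0r.
    split; first by apply: near_eq_derivable H _; have [] := dl.
    by rewrite -(near_eq_derive _ H); have [] := dl.
  have H : {near x, cst 0 =1 V} by apply: filterS x0 => y [->].
  have -> : DV x = 0 by case: (nbhs_singleton x0).
  split; first exact: near_eq_derivable H (derivable_cst _ _ _).
  by rewrite -(near_eq_derive _ H) derive_cst.
have cDV : continuous DV.
  move=> x; rewrite /continuous_at; have [xO|x0] := cases x.
    have -> : DV x = D (Some i) (x, t) by rewrite /DV patchE mem_set//; exact: nbhs_singleton xO.
    apply: (@cvg_trans _ ((fun y => D (Some i) (y, t)) @ x)); last first.
      apply: (@continuous_comp _ _ _ (fun y => (y, t)) (D (Some i))); last exact: cD.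
      exact: continuous_pairl.
    have H : {near x, (fun y => D (Some i) (y, t)) =1 DV}.
      by apply: filterS xO => y yO; rewrite /DV patchE mem_set.
    exact: (near_eq_cvg H).
  have -> : DV x = 0 by case: (nbhs_singleton x0).
  by move=> A /nbhs_singleton A0; apply: filterS x0 => y [_ DVy]; rewrite /= DVy.
rewrite -(integral_partial_rV dV cDV (M := M)).
  apply: eq_integral => x _; rewrite /DV !patchE.
  case: ifPn => [|/negP]; rewrite inE => xt; first by rewrite mem_set//; case: xt.
  by case: ifPn => // /set_mem xO; case: xt.
move=> x Mx; rewrite /V patchE ifN//; apply/negP; rewrite inE => /OmSM.
by rewrite leNgt Mx.
Qed.

(** Twice phi D_j phi is the derivative of phi^2. In space it integrates to 0, and beta is constant;
    in time only the value at T survives because phi vanishes at t = 0. *)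
Lemma C1_energy_identity phi D (beta : 'rV[R]_d) : has_grad phi D -> vanishes_near (bdryE OmS T) phi ->
  2 * ip mu Om phi (fun z => \sum_(i < d) beta ord0 i * D (Some i) z + D None z) =
  ip lrV OmS (fun x => phi (x, T)) (fun x => phi (x, T)).
Proof.
move=> gphi vphi; have gW := has_gradM gphi gphi.
have vW : vanishes_near (bdryE OmS T) (fun z => phi z * phi z).
  by have [U [oU bU phiU]] := vphi; exists U; split => // z /phiU ->; rewrite mul0r.
have [cphi dphi cD] := gphi.
have Lphi := L2_continuous open_cyl cyl_cube cphi.
have LD j := L2_continuous open_cyl cyl_cube (cD j).
have space i : ip mu Om (D (Some i)) phi = 0.
  have H := integral_space0 i gW vW.
  have E : (\int[mu]_(z in Om) (phi z * D (Some i) z + phi z * D (Some i) z))%R = 0.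
    by rewrite /Rintegral H.
  move: E; rewrite RintegralD//; try exact: L2M_integrable.
  by rewrite -/(ip mu Om phi (D (Some i))) ipC; lra.
have time : 2 * ip mu Om (D None) phi = ip lrV OmS (fun x => phi (x, T)) (fun x => phi (x, T)).
  have H := integral_time gW.
  have E : (\int[mu]_(z in Om) (phi z * D None z + phi z * D None z))%R =
     ip lrV OmS (fun x => phi (x, T)) (fun x => phi (x, T)).
    rewrite /Rintegral H /ip /Rintegral; congr fine; apply: eq_integral => x /set_mem xO.
    congr EFin.
    have -> : phi (x, 0) = 0.
      have [U [_ bU phiU]] := vphi; apply: phiU; apply: bU; apply: subset_closure.
      by right.
    by rewrite mul0r subr0.
  by rewrite -E RintegralD//; try exact: L2M_integrable; rewrite -/(ip mu Om phi (D None)) ipC mulr2n mulrDl mul1r.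
have LS : L2 mu Om (fun z => \sum_(i < d) beta ord0 i * D (Some i) z).
  by apply: L2_sum => // i; exact: L2Z.
rewrite ipC ipDl// ip_suml//; last by move=> i; exact: L2Z.
rewrite big1 ?add0r ?time// => i _.
by rewrite ipZl// space mulr0.
Qed.

End C1_energy.

(** * Convergence of L^2 inner products *)

Section L2_convergence.
Context (R : realType) dX (X : measurableType dX) (mu : {measure set X -> \bar R}).
Variable K : set X.
Hypothesis mK : measurable K.
Implicit Types u v f g : X -> R.

Lemma ip_CS u v : L2 mu K u -> L2 mu K v -> ip mu K u v ^+ 2 <= ip mu K u u * ip mu K v v.
Proof.
move=> Lu Lv; set A := ip mu K u u; set B := ip mu K v v; set c := ip mu K u v.
have A0 : 0 <= A by exact: ip_ge0. have B0 : 0 <= B by exact: ip_ge0.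
have key x y : 0 <= x ^+ 2 * A - 2 * x * y * c + y ^+ 2 * B.
  have := ip_ge0 mu K (fun z => x * u z - y * v z).
  have Lxu := L2Z mK x Lu; have Lyv := L2Z mK y Lv; have Ld := L2B mK Lxu Lyv.
  rewrite ipBl// !ipZl// [ip mu K u (fun z => _ - _)]ipC [ip mu K v (fun z => _ - _)]ipC.
  by rewrite !ipBl// !ipZl// [ip mu K v u]ipC -/A -/B -/c; nra.
(* When A = 0, the instance x = B + 1, y = c reads - (B + 2) c^2 >= 0 and forces c = 0. Otherwise x
   = c, y = A gives A (A B - c^2) >= 0. *)
have [A00|Apos] := eqVneq A 0.
  have h1 := key (B + 1) c; have h2 := key (c * (B + 1)) 1; rewrite A00 in h1 h2 *.
  by nra.
have := key c A => h; have : 0 < A by rewrite lt0r Apos A0.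
nra.
Qed.

Lemma ip_cvg0 (f g : nat -> X -> R) Bd : (forall n, L2 mu K (f n)) -> (forall n, L2 mu K (g n)) ->
  (forall n, ip mu K (g n) (g n) <= Bd) ->
  ip mu K (f n) (f n) @[n --> \oo] --> (0 : R) ->
  ip mu K (f n) (g n) @[n --> \oo] --> (0 : R).
Proof.
move=> Lf Lg gB f0.
have B0 : 0 <= Bd by apply: le_trans (gB 0%N); exact: ip_ge0.
have sq0 : Num.sqrt (ip mu K (f n) (f n)) * Num.sqrt Bd @[n --> \oo] --> (0 : R).
  rewrite -(mul0r (Num.sqrt Bd)); apply: cvgM; last exact: cvg_cst.
  rewrite -[X in _ --> X]sqrtr0.
  exact: (continuous_cvg _ (@sqrt_continuous R 0) f0).
have hb n : - (Num.sqrt (ip mu K (f n) (f n)) * Num.sqrt Bd) <= ip mu K (f n) (g n) <=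
    Num.sqrt (ip mu K (f n) (f n)) * Num.sqrt Bd.
  rewrite -ler_norml -sqrtrM ?ip_ge0// -sqrtr_sqr ler_wsqrtr//.
  by apply: (le_trans (ip_CS (Lf n) (Lg n))); rewrite ler_wpM2l ?ip_ge0.
apply: (squeeze_cvgr _ _ sq0); first by apply: nearW => n; exact: hb.
by rewrite -oppr0; exact: cvgN.
Qed.

Lemma ip_cvg (f g : nat -> X -> R) u v : (forall n, L2 mu K (f n)) -> (forall n, L2 mu K (g n)) ->
  L2 mu K u -> L2 mu K v ->
  ip mu K (fun z => f n z - u z) (fun z => f n z - u z) @[n --> \oo] --> (0 : R) ->
  ip mu K (fun z => g n z - v z) (fun z => g n z - v z) @[n --> \oo] --> (0 : R) ->
  ip mu K (f n) (g n) @[n --> \oo] --> ip mu K u v.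
Proof.
move=> Lf Lg Lu Lv fu gv.
have Lfu n := L2B mK (Lf n) Lu. have Lgv n := L2B mK (Lg n) Lv.
have E n : ip mu K (f n) (g n) = ip mu K (fun z => f n z - u z) v
   + ip mu K (fun z => g n z - v z) u
   + ip mu K (fun z => g n z - v z) (fun z => f n z - u z) + ip mu K u v.
  rewrite [ip mu K (fun z => g n z - v z) (fun z => _ - _)]ipC.
  rewrite !ipBl// ![ip mu K _ (fun z => g n z - v z)]ipC !ipBl// [ip mu K (g n) u]ipC [ip mu K (g n) (f n)]ipC [ip mu K v (f n)]ipC [ip mu K v u]ipC.
  ring.
rewrite (funext E) -[X in _ --> X]add0r; apply: cvgD; last exact: cvg_cst.
have c1 : ip mu K (fun z => f n z - u z) v @[n --> \oo] --> (0 : R).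
  exact: (@ip_cvg0 (fun n z => f n z - u z) (fun=> v) (ip mu K v v)).
have c2 : ip mu K (fun z => g n z - v z) u @[n --> \oo] --> (0 : R).
  exact: (@ip_cvg0 (fun n z => g n z - v z) (fun=> u) (ip mu K u u)).
have c3 : ip mu K (fun z => g n z - v z) (fun z => f n z - u z) @[n --> \oo] --> (0 : R).
  have h : ip mu K (fun z => g n z - v z) (fun z => g n z - v z) +
        ip mu K (fun z => f n z - u z) (fun z => f n z - u z) @[n --> \oo] --> (0 : R).
    by rewrite -[X in _ --> X]addr0; exact: cvgD.
  have bd n : - (ip mu K (fun z => g n z - v z) (fun z => g n z - v z) +
        ip mu K (fun z => f n z - u z) (fun z => f n z - u z)) <=
      ip mu K (fun z => g n z - v z) (fun z => f n z - u z) <=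
      ip mu K (fun z => g n z - v z) (fun z => g n z - v z) +
        ip mu K (fun z => f n z - u z) (fun z => f n z - u z).
    have := ip_CS (Lgv n) (Lfu n).
    have := ip_ge0 mu K (fun z => g n z - v z); have := ip_ge0 mu K (fun z => f n z - u z).
    set a := ip _ _ _ _; set b := ip _ _ _ _; set c := ip _ _ _ _ => a0 b0 cab.
    by rewrite -ler_norml -(ler_pXn2r (isT : (0 < 2)%N)) ?nnegrE ?addr_ge0// real_normK ?num_real//; nra.
  apply: (squeeze_cvgr _ _ h); first by apply: nearW => n; exact: bd.
  by rewrite -oppr0; exact: cvgN.
have := cvgD (cvgD c1 c2) c3; rewrite !addr0; exact.
Qed.

End L2_convergence.

(** * Integration in time as a map from L^2 of the cylinder to L^2 of the domain *)

Section trace_at_final_time.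
Variables (R : realType) (d : nat) (OmS : set 'rV[R]_d) (T M : R).
Hypotheses (oOmS : open OmS) (OmSM : forall x, OmS x -> `|x| <= M) (T0 : 0 < T).
Local Notation mu := (@lebesgue_st R d).
Local Notation leb := (@lebesgue_measure R).
Local Notation lrV := (lebesgue_rV R d).
Local Notation pt := ('rV[R]_d * R)%type.
Local Notation Om := (cyl OmS T).
Implicit Types (k l : pt -> R).

Let oOm : open Om := open_cyl oOmS.
Let mOm := open_measurable_st oOm.
Let mOmS := open_measurable_rV oOmS.
Let Omc : Om `<=` cube 0 (Num.max M T) := cyl_cube OmSM.
Let Omfin : (mu Om < +oo)%E := cube_lty mOm Omc.

(** There is no division by T: applied to a kernel that is already a time derivative, the integral
    returns a final value. *)
Definition time_avg k (x : 'rV[R]_d) : R := (\int[leb]_t (k \_ Om) (x, t))%R.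

Let patch_integrable k : L2 mu Om k -> mu.-integrable setT (EFin \o (k \_ Om)).
Proof.
move=> Lk; have := L2_integrable mOm Omfin Lk => /(integrable_mkcond _ mOm).
by rewrite restrict_EFin.
Qed.

Lemma measurable_time_avg k : L2 mu Om k -> measurable_fun setT (time_avg k).
Proof.
move=> Lk; apply: measurableT_comp; first exact: fine_measurable.
exact: (measurable_fubini_F (patch_integrable Lk)).
Qed.

(** Cauchy-Schwarz in time against the constant 1, whose squared norm on ]0, T[ is the factor T,
    followed by Tonelli. *)
Lemma time_avg_sq k : L2 mu Om k ->
  (\int[lrV]_(x in OmS) (time_avg k x ^+ 2)%:E <= T%:E * (ip mu Om k k)%:E)%E.
Proof.
move=> Lk.
pose k2 (z : 'rV[R]_d * measurableTypeR R) : \bar R := ((k \_ Om) z ^+ 2)%:E.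
have mk : measurable_fun setT (k \_ Om : 'rV[R]_d * measurableTypeR R -> _).
  by apply/(measurable_restrictT _ mOm); case: Lk.
have mk2 : measurable_fun setT k2 by apply/measurable_EFinP; exact: measurable_funX.
have k20 z : (0 <= k2 z)%E by rewrite lee_fin sqr_ge0.
have -> : (ip mu Om k k)%:E = (\int[lrV]_x fubini_F leb k2 x)%E.
  rewrite -(ipE mOm Lk) -(fubini_tonelli1 _ mk2 k20) integral_mkcond.
  apply: eq_integral => z _; rewrite /k2 !patchE; case: ifPn => // _.
  by rewrite expr0n.
have mF := measurable_fun_fubini_tonelli_F (m2 := leb) _ mk2 k20.
have F0 x : (0 <= fubini_F leb k2 x)%E by exact: integral_ge0.
have mta := measurable_time_avg Lk.
rewrite -ge0_integralZl//; last by rewrite lee_fin ltW.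
apply: (@le_trans _ _ (\int[lrV]_x (time_avg k x ^+ 2)%:E)%E).
  apply: ge0_subset_integral => //.
  - by apply/measurable_EFinP; exact: measurable_funX.
  - by move=> x _; rewrite lee_fin sqr_ge0.
apply: ge0_le_integral => //.
- by move=> x _; rewrite lee_fin sqr_ge0.
- by apply/measurable_EFinP; exact: measurable_funX.
- exact: measurable_funeM.
move=> x _.
have mI : measurable (`]0, T[%classic : set (measurableTypeR R)) by exact: measurable_itv.
pose f t := (k \_ Om) (x, t).
have f0 t : ~ `]0, T[%classic t -> f t = 0.
  by move=> tT; rewrite /f patchE ifN//; apply/negP; rewrite inE => -[].
have mf : measurable_fun setT f by exact: (measurableT_comp mk (pair1_measurable x)).
have E1 : time_avg k x = (\int[leb]_(t in `]0, T[) f t)%R.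
  rewrite [RHS]Rintegral_mkcond; apply: eq_Rintegral => t _; rewrite [RHS]patchE.
  by case: ifPn => // /negP; rewrite inE => /f0.
have E2 : fubini_F leb k2 x = (\int[leb]_(t in `]0%R, T[) (f t ^+ 2)%:E)%E.
  rewrite /fubini_F [RHS]integral_mkcond; apply: eq_integral => t _; rewrite [RHS]patchE.
  by case: ifPn => // /negP; rewrite inE => /f0 h; rewrite /k2 -/(f t) h expr0n.
(* A slice need not be square integrable; the right-hand side is then infinite. *)
rewrite E2; have [fin|inf] := eqVneq (\int[leb]_(t in `]0%R, T[) (f t ^+ 2)%:E)%E +oo%E.
  by rewrite fin gt0_muley ?leey// lte_fin.
have Lf : L2 leb `]0, T[%classic f.
  split; first exact: measurable_funTS.
  apply/integrableP; split; first by apply/measurable_EFinP; apply: measurable_funX; exact: measurable_funTS.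
  under eq_integral => t _ do rewrite gee0_abs ?lee_fin ?sqr_ge0//.
  by rewrite ltey.
have IT : leb `]0, T[%classic = T%:E by rewrite lebesgue_measure_itv/= lte_fin T0 sube0.
have L1 : L2 leb `]0, T[%classic (cst 1).
  split; first exact: measurable_cst.
  rewrite (_ : (fun z => _) = EFin \o cst 1); last by apply/funext => z /=; rewrite expr1n.
  apply: measurable_bounded_integrable => //; first by rewrite /= IT ltry.
  exists 1; split; first exact: num_real.
  by move=> y y1 z _ /=; rewrite normr1 ltW.
have := ip_CS mI Lf L1.
have -> : ip leb `]0, T[%classic (cst 1) (cst 1) = T.
  rewrite /ip; under eq_Rintegral do rewrite mulr1.
  by rewrite (Rintegral_cst leb mI) mul1r /= IT.
have -> : ip leb `]0, T[%classic f (cst 1) = time_avg k x.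
  by rewrite E1; apply: eq_Rintegral => t _; rewrite mulr1.
by rewrite (ipE mI Lf) -EFinM lee_fin mulrC.
Qed.

(** Only almost every slice is integrable, hence the restriction to almost every x. *)
Lemma time_avgB k l : L2 mu Om k -> L2 mu Om l ->
  {ae lrV, forall x, OmS x -> time_avg (fun z => k z - l z) x = time_avg k x - time_avg l x}.
Proof.
move=> Lk Ll; have ik := ae_integrable1 (patch_integrable Lk).
have il := ae_integrable1 (patch_integrable Ll).
have F : Filter (nbhs (almost_everywhere lrV)) by exact: ae_filter_ringOfSetsType.
apply: filterS2 ik il => x ik il _.
rewrite /time_avg -RintegralB//; apply: eq_Rintegral => t _; rewrite !patchE.
by case: ifPn => // _; rewrite subr0.
Qed.

Lemma time_avg_L2 k : L2 mu Om k -> L2 lrV OmS (time_avg k).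
Proof.
move=> Lk; have mta := measurable_time_avg Lk.
split; first exact: measurable_funTS.
apply/integrableP; split; first by apply/measurable_EFinP; apply: measurable_funX; exact: measurable_funTS.
under eq_integral => t _ do rewrite gee0_abs ?lee_fin ?sqr_ge0//.
by apply: le_lt_trans (time_avg_sq Lk) _; rewrite -EFinM ltry.
Qed.

End trace_at_final_time.

Lemma term_le_sum (R : realType) n (F : 'I_n -> R) i : (forall k, 0 <= F k) ->
  F i <= \sum_(k < n) F k.
Proof. by move=> F0; rewrite (bigD1 i)//= lerDl sumr_ge0. Qed.

Lemma L2_bounded_mul (R : realType) dX (X : measurableType dX)
    (mu : {measure set X -> \bar R}) (K : set X) (b u : X -> R) :
  measurable K -> measurable_fun K b -> (forall z, K z -> `|b z| <= 1) ->
  L2 mu K u -> L2 mu K (fun z => b z * u z).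
Proof.
move=> mK mb b1 [mu_ iu]; split; first exact: measurable_funM.
apply: (le_integrable mK _ _ iu).
  by apply/measurable_EFinP; apply: measurable_funX; exact: measurable_funM.
move=> z Kz /=; rewrite lee_fin !ger0_norm ?sqr_ge0// exprMn.
by rewrite ler_piMl ?sqr_ge0// -(real_normK (num_real _)) expr_le1// b1.
Qed.

Section final_trace.
Variables (R : realType) (d : nat) (OmS : set 'rV[R]_d) (T M : R).
Hypotheses (oOmS : open OmS) (OmSM : forall x, OmS x -> `|x| <= M) (T0 : 0 < T).
Local Notation mu := (@lebesgue_st R d).
Local Notation lrV := (lebesgue_rV R d).
Local Notation pt := ('rV[R]_d * R)%type.
Local Notation Om := (cyl OmS T).
Implicit Types (u v w : pt -> R).

Let oOm : open Om := open_cyl oOmS.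
Let mOm := open_measurable_st oOm.
Let mOmS := open_measurable_rV oOmS.
Let Omc : Om `<=` cube 0 (Num.max M T) := cyl_cube OmSM.
Let Omfin : (mu Om < +oo)%E := cube_lty mOm Omc.

(* (t/T) w_t + w/T is the time derivative of (t/T) w. *)
Definition final_kernel (Dt u : pt -> R) : pt -> R :=
  fun z => T^-1 * z.2 * Dt z + T^-1 * u z.

Definition final_trace w : 'rV[R]_d -> R :=
  time_avg OmS T (final_kernel (wd Om None w) w).

Lemma weight01 t : t \in `]0, T[ -> 0 <= T^-1 * t <= 1.
Proof.
rewrite in_itv/= => /andP[t0 tT].
apply/andP; split; last by rewrite ler_pdivrMl// mulr1 ltW.
by apply: mulr_ge0; rewrite ?invr_ge0; exact: ltW.
Qed.

Lemma weight_L2 v : L2 mu Om v -> L2 mu Om (fun z => T^-1 * z.2 * v z).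
Proof.
move=> Lv; apply: (L2_bounded_mul mOm _ _ Lv).
  by apply: measurable_funM => //; apply: measurable_funTS; exact: measurable_snd.
by move=> -[x t] [_] /weight01 /andP[t0 t1] /=; rewrite ger0_norm.
Qed.

Lemma weight_ip v : L2 mu Om v ->
  ip mu Om (fun z => T^-1 * z.2 * v z) (fun z => T^-1 * z.2 * v z) <= ip mu Om v v.
Proof.
move=> Lv; have Lw := weight_L2 Lv.
apply: le_Rintegral => //; [exact: L2M_integrable|exact: L2M_integrable|].
move=> -[x t] [_] /weight01 /=; set y := T^-1 * t => /andP[y0 y1].
by rewrite mulrACA -[v _ * v _]expr2 ler_piMl ?sqr_ge0//; nra.
Qed.

Lemma final_kernel_L2 Dt u : L2 mu Om Dt -> L2 mu Om u -> L2 mu Om (final_kernel Dt u).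
Proof. by move=> LD Lu; apply: L2D => //; [exact: weight_L2|exact: L2Z]. Qed.

Lemma final_kernel_ip Dt u : L2 mu Om Dt -> L2 mu Om u ->
  ip mu Om (final_kernel Dt u) (final_kernel Dt u) <=
  2 * ip mu Om Dt Dt + 2 / T ^+ 2 * ip mu Om u u.
Proof.
move=> LD Lu; have Lw := weight_L2 LD; have Ls := L2Z mOm T^-1 Lu.
have h1 := weight_ip LD.
have h2 : ip mu Om (fun z => T^-1 * u z) (fun z => T^-1 * u z) = T^-1 ^+ 2 * ip mu Om u u.
  by rewrite ipZl// ipC ipZl// mulrA.
have h3 : 2 / T ^+ 2 * ip mu Om u u = 2 * (T^-1 ^+ 2 * ip mu Om u u).
  by rewrite exprVn mulrA.
have Lk := final_kernel_L2 LD Lu.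
rewrite h3 -h2 /final_kernel ipDl// ![ip mu Om _ (fun z => _ + _)]ipC !ipDl//.
rewrite [ip mu Om (fun z => T^-1 * u z) (fun z => _ * _ * _)]ipC.
have /(_ 2^-1) := ip_young mOm _ Lw Ls; rewrite invr_gt0 => /(_ ltac:(by [])).
have -> : (4 * 2^-1)^-1 = 2^-1 :> R by field.
move: h1; set a := ip _ _ _ _; set b := ip _ _ _ _; set c := ip _ _ _ _; set e := ip _ _ _ _.
lra.
Qed.

(** The fundamental theorem of calculus for (t/T) psi: the weight is 1 at T and 0 at 0. *)
Lemma final_trace_C1 psi D x : has_grad psi D -> OmS x ->
  time_avg OmS T (final_kernel (D None) psi) x = psi (x, T).
Proof.
move=> gpsi xO.
have gW := has_gradM (has_gradZ T^-1 (has_grad_co R None)) gpsi.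
have [_ _ cW] := gW.
have cs (f : pt -> R) : continuous f -> continuous (fun t : R => f (x, t)).
  move=> cf t; apply: (@continuous_comp _ _ _ (fun t => (x, t)) f); last exact: cf.
  exact: continuous_pairr.
have := FTC_oo T0 (slice_t x gW) (cs _ (cW None)).
rewrite /= mulVf ?gt_eqF// mulr0 mul0r subr0 mul1r => H.
transitivity (fine (psi (x, T))%:E) => //; rewrite -H /time_avg /Rintegral; congr fine.
rewrite [RHS]integral_mkcond; apply: eq_integral => t _; rewrite !patchE.
case: ifPn => [|/negP]; rewrite inE => xt.
  rewrite mem_set; last by case: xt.
  by rewrite /final_kernel /=; congr EFin; ring.
by case: ifPn => // /set_mem tT; case: xt.
Qed.

(** The real value of [H1_sqnorm] on H^1 functions, so that limits can be taken among real
    numbers. *)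
Definition esq w : R := ip mu Om w w + \sum_(i < d) ip mu Om (wd Om (Some i) w) (wd Om (Some i) w)
  + ip mu Om (wd Om None w) (wd Om None w).

Lemma H1_sqnormE w : H1 Om w -> H1_sqnorm Om w = (esq w)%:E.
Proof.
move=> Hw; have Lw := Hw.1; have LD j := H1_wdL2 j Hw.
have iw := Lw.2; have iD j := (LD j).2.
have iS : mu.-integrable Om (EFin \o (fun z => \sum_(i < d) wd Om (Some i) w z ^+ 2)).
  by apply: integrable_sumR => // i; exact: iD.
pose f1 z := w z ^+ 2; pose f2 z := \sum_(i < d) wd Om (Some i) w z ^+ 2.
pose f3 z := wd Om None w z ^+ 2.
have i12 : mu.-integrable Om (EFin \o (fun z => f1 z + f2 z)).
  by have := integrableD mOm iw iS; exact.
have i123 : mu.-integrable Om (EFin \o (fun z => f1 z + f2 z + f3 z)).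
  by have := integrableD mOm i12 (iD None); exact.
have E : esq w = (\int[mu]_(z in Om) (f1 z + f2 z + f3 z))%R.
  have E1 : (\int[mu]_(z in Om) (f1 z + f2 z + f3 z) =
      \int[mu]_(z in Om) (f1 z + f2 z) + \int[mu]_(z in Om) f3 z)%R.
    exact: (RintegralD mOm i12 (iD None)).
  have E2 : (\int[mu]_(z in Om) (f1 z + f2 z) =
      \int[mu]_(z in Om) f1 z + \int[mu]_(z in Om) f2 z)%R.
    exact: (RintegralD mOm iw iS).
  have E3 : (\int[mu]_(z in Om) f2 z =
      \sum_(i < d) \int[mu]_(z in Om) (wd Om (Some i) w z ^+ 2))%R.
    exact: (Rintegral_sum mOm _ (fun i => iD (Some i))).
  by rewrite E1 E2 E3 /esq /ip; congr (_ + _ + _).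
by rewrite E /Rintegral fineK//; exact: integrable_fin_num i123.
Qed.

Lemma esq_ge w : 0 <= esq w /\ ip mu Om w w <= esq w /\
  forall j, ip mu Om (wd Om j w) (wd Om j w) <= esq w.
Proof.
have h0 := ip_ge0 mu Om w; have hj j := ip_ge0 mu Om (wd Om j w).
have hs : 0 <= \sum_(i < d) ip mu Om (wd Om (Some i) w) (wd Om (Some i) w).
  by apply: sumr_ge0 => i _; exact: hj.
have ht := hj None.
rewrite /esq; split; first by rewrite !addr_ge0.
split; first by rewrite -addrA lerDl addr_ge0.
case=> [i|]; last by rewrite lerDr addr_ge0.
have h := term_le_sum i (fun i => hj (Some i)).
apply: (le_trans h).
by rewrite addrAC lerDr addr_ge0.
Qed.

(** The kernel is linear, so the difference of final values is the time integral of the kernel of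
    [psi \- w]. The factor T of [time_avg_sq] times the coefficients 2 and 2 / T^2 of
    [final_kernel_ip] gives the constant. *)
Lemma trace_estimate w psi : H1 Om w -> C1 psi ->
  H1 Om (psi \- w) /\
  (\int[lrV]_(x in OmS) ((psi (x, T) - final_trace w x) ^+ 2)%:E <=
  ((2 * T + 2 / T) * esq (psi \- w))%:E)%E.
Proof.
move=> Hw /C1_has_grad gpsi; set D := (fun j z => _) in gpsi.
have Hpsi := has_grad_H1 oOm Omc gpsi.
have Hd := H1B oOm Hpsi Hw; split => //.
have Lk := final_kernel_L2 (H1_wdL2 None Hw) Hw.1.
have [cpsi _ cD] := gpsi.
have Lpsi := L2_continuous oOm Omc cpsi; have LD := L2_continuous oOm Omc (cD None).
have Ll := final_kernel_L2 LD Lpsi.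
have Lkl := L2B mOm Ll Lk.
have F : Filter (nbhs (almost_everywhere lrV)) by exact: ae_filter_ringOfSetsType.
have -> : (\int[lrV]_(x in OmS) ((psi (x, T) - final_trace w x) ^+ 2)%:E =
   \int[lrV]_(x in OmS) (time_avg OmS T (fun z => final_kernel (D None) psi z - final_kernel (wd Om None w) w z) x ^+ 2)%:E)%E.
  have m1 := measurable_time_avg oOmS OmSM Ll; have m2 := measurable_time_avg oOmS OmSM Lk.
  have m3 := measurable_time_avg oOmS OmSM Lkl.
  transitivity (\int[lrV]_(x in OmS) ((time_avg OmS T (final_kernel (D None) psi) x - final_trace w x) ^+ 2)%:E)%E.
    by apply: eq_integral => x /set_mem xO; rewrite (final_trace_C1 gpsi xO).
  apply: ae_eq_integral => //.
  - apply/measurable_EFinP; apply: measurable_funX; apply: measurable_funB; exact: measurable_funTS.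
  - apply/measurable_EFinP; apply: measurable_funX; exact: measurable_funTS.
  - have := time_avgB oOmS OmSM Ll Lk.
    by apply: filterS => x h xO; rewrite /= h.
apply: (le_trans (time_avg_sq oOmS OmSM T0 Lkl)); rewrite -EFinM lee_fin.
have L1 := H1_wdL2 None Hd; have L0 := Hd.1.
have -> : ip mu Om (fun z => final_kernel (D None) psi z - final_kernel (wd Om None w) w z)
    (fun z => final_kernel (D None) psi z - final_kernel (wd Om None w) w z) =
  ip mu Om (final_kernel (wd Om None (psi \- w)) (psi \- w)) (final_kernel (wd Om None (psi \- w)) (psi \- w)).
  have ae : {ae mu, forall z, Om z -> final_kernel (D None) psi z - final_kernel (wd Om None w) w z =
      final_kernel (wd Om None (psi \- w)) (psi \- w) z}.
    have := wdB None oOm Hpsi Hw; have := has_grad_wd None oOm Omc gpsi.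
    apply: filterS2 => z h1 h2 Oz; rewrite /final_kernel h2// h1//=; ring.
  have Lf := final_kernel_L2 L1 L0.
  by apply: eq_ip.
have [e0 [e1 e2]] := esq_ge (psi \- w); have {}e2 := e2 None.
have h := final_kernel_ip L1 L0.
have t2 : 0 <= 2 / T ^+ 2 by rewrite divr_ge0 ?exprn_ge0 ?ltW.
have -> : (2 * T + 2 / T) * esq (psi \- w) = T * (2 * esq (psi \- w) + 2 / T ^+ 2 * esq (psi \- w)).
  by field; rewrite gt_eqF.
by rewrite ler_pM2l// (le_trans h)// lerD ?ler_wpM2l.
Qed.

End final_trace.

Lemma le_comb3 (R : realDomainType) (k l a b c a1 b1 c1 a2 b2 c2 : R) :
  a <= k * a1 + l * a2 -> b <= k * b1 + l * b2 -> c <= k * c1 + l * c2 ->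
  a + b + c <= k * (a1 + b1 + c1) + l * (a2 + b2 + c2).
Proof. by move=> h1 h2 h3; rewrite !mulrDr; lra. Qed.

Lemma cvg0_comb (R : realType) (k l : R) (f g : nat -> R) :
  f @ \oo --> (0 : R) -> g @ \oo --> (0 : R) -> k * f n + l * g n @[n --> \oo] --> (0 : R).
Proof.
move=> cf cg; have h : k * f n + l * g n @[n --> \oo] --> k * 0 + l * 0.
  by apply: cvgD; apply: cvgM => //; exact: cvg_cst.
by rewrite !mulr0 addr0 in h.
Qed.

Lemma cvg_sumR (R : realType) (I : Type) (s : seq I) (f : nat -> I -> R) (l : I -> R) :
  (forall i, f n i @[n --> \oo] --> l i) ->
  \sum_(i <- s) f n i @[n --> \oo] --> \sum_(i <- s) l i.
Proof.
move=> h; elim: s => [|i s IH].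
  by rewrite big_nil; under eq_fun do rewrite big_nil; exact: cvg_cst.
by rewrite big_cons; under eq_fun do rewrite big_cons; exact: cvgD.
Qed.

(** * The space H^1_E and the square of the trace *)

Section H1E_theory.
Variables (R : realType) (d : nat) (OmS : set 'rV[R]_d) (T M : R).
Hypotheses (oOmS : open OmS) (OmSM : forall x, OmS x -> `|x| <= M) (T0 : 0 < T).
Local Notation mu := (@lebesgue_st R d).
Local Notation lrV := (lebesgue_rV R d).
Local Notation pt := ('rV[R]_d * R)%type.
Local Notation Om := (cyl OmS T).
Local Notation en := (esq OmS T).
Implicit Types (u v w : pt -> R) (g : 'rV[R]_d -> R).

Let oOm : open Om := open_cyl oOmS.
Let mOm := open_measurable_st oOm.
Let mOmS := open_measurable_rV oOmS.
Let Omc : Om `<=` cube 0 (Num.max M T) := cyl_cube OmSM.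

Lemma esqD u v c : H1 Om u -> H1 Om v ->
  en (fun z => u z + c * v z) <= 2 * en u + 2 * c ^+ 2 * en v.
Proof.
move=> Hu Hv; have Huv := H1D c oOm Hu Hv.
have hj j : ip mu Om (wd Om j (fun z => u z + c * v z)) (wd Om j (fun z => u z + c * v z)) <=
    2 * ip mu Om (wd Om j u) (wd Om j u) + 2 * c ^+ 2 * ip mu Om (wd Om j v) (wd Om j v).
  have Lu := H1_wdL2 j Hu; have Lv := H1_wdL2 j Hv.
  apply: le_trans (ip_sqD mOm c Lu Lv); rewrite le_eqVlt; apply/orP; left; apply/eqP.
  have L := L2D mOm Lu (L2Z mOm c Lv).
  have ae := wdD j c oOm Hu Hv.
  by apply: eq_ip => //; exact: H1_wdL2.
have h0 := ip_sqD mOm c Hu.1 Hv.1.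
have hs : \sum_(i < d) ip mu Om (wd Om (Some i) (fun z => u z + c * v z)) (wd Om (Some i) (fun z => u z + c * v z)) <=
    2 * \sum_(i < d) ip mu Om (wd Om (Some i) u) (wd Om (Some i) u) +
    2 * c ^+ 2 * \sum_(i < d) ip mu Om (wd Om (Some i) v) (wd Om (Some i) v).
  by rewrite !mulr_sumr -big_split; apply: ler_sum => i _; exact: hj.
exact: (le_comb3 h0 hs (hj None)).
Qed.

Definition H1E_approx w (phi : nat -> pt -> R) :=
  [/\ forall n, C1 (phi n), forall n, vanishes_near (bdryE OmS T) (phi n),
      forall n, H1 Om (phi n \- w) & en (phi n \- w) @[n --> \oo] --> (0 : R)].

Lemma C1_H1 phi : C1 phi -> H1 Om phi.
Proof. by move=> /C1_has_grad h; exact: has_grad_H1 oOm Omc h. Qed.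

Lemma esq_cvg w (phi : nat -> pt -> R) : H1 Om w -> (forall n, C1 (phi n)) ->
  H1_sqnorm Om (phi n \- w) @[n --> \oo] --> 0%E -> en (phi n \- w) @[n --> \oo] --> (0 : R).
Proof.
move=> Hw C1phi cv.
rewrite (_ : (fun n => _) = fine \o (fun n => H1_sqnorm Om (phi n \- w))); first exact: fine_cvg.
apply/funext => n /=; have Hd := H1B oOm (C1_H1 (C1phi n)) Hw.
by rewrite (H1_sqnormE oOmS Hd).
Qed.

Lemma H1EP w : H1E OmS T w <-> H1 Om w /\ exists phi, H1E_approx w phi.
Proof.
split=> -[Hw [phi]].
  move=> [C1v cv]; split => //; exists phi.
  have Hd n : H1 Om (phi n \- w) by apply: H1B => //; apply: C1_H1; exact: (C1v n).1.
  split => //; [by move=> n; case: (C1v n)|by move=> n; case: (C1v n)|].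
  by apply: esq_cvg => // n; case: (C1v n).
move=> [C1phi vphi Hd cv]; split => //; exists phi; split; first by move=> n; split.
rewrite (_ : (fun n => _) = EFin \o (fun n => en (phi n \- w))).
  by apply: cvg_EFin => //; near=> n.
by apply/funext => n; rewrite (H1_sqnormE oOmS (Hd n)).
Unshelve. all: by end_near. Qed.

Lemma vanishes_nearD (A : set pt) u v c : vanishes_near A u -> vanishes_near A v ->
  vanishes_near A (fun z => u z + c * v z).
Proof.
move=> [U [oU AU uU]] [V [oV AV vV]]; exists (U `&` V); split; first exact: openI.
  by move=> z Az; split; [exact: AU|exact: AV].
by move=> z [/uU -> /vV ->]; rewrite mulr0 addr0.
Qed.

Lemma H1ED u v c : H1E OmS T u -> H1E OmS T v -> H1E OmS T (fun z => u z + c * v z).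
Proof.
move=> /H1EP[Hu [phi [C1phi vphi Hp cp]]] /H1EP[Hv [psi [C1psi vpsi Hq cq]]].
apply/H1EP; split; first exact: H1D.
exists (fun n z => phi n z + c * psi n z).
have C1s n : C1 (fun z => phi n z + c * psi n z).
  have h1 := C1_has_grad (C1phi n); have h2 := C1_has_grad (C1psi n).
  exact: has_gradC1 (has_gradD h1 (has_gradZ c h2)).
have dE n : (fun z => phi n z + c * psi n z) \- (fun z => u z + c * v z) =
   (fun z => (phi n \- u) z + c * (psi n \- v) z).
  by apply/funext => z /=; ring.
split.
- exact: C1s.
- by move=> n; exact: vanishes_nearD.
- by move=> n; rewrite dE; exact: (H1D c oOm (Hp n) (Hq n)).
have ub : 2 * en (phi n \- u) + 2 * c ^+ 2 * en (psi n \- v) @[n --> \oo] --> (0 : R).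
  exact: cvg0_comb.
apply: (squeeze_cvgr _ (cvg_cst (0 : R)) ub); apply: nearW => n.
by rewrite dE esqD//= andbT; have [] := esq_ge OmS T (fun z => (phi n \- u) z + c * (psi n \- v) z).
Qed.

Lemma H1EB u v : H1E OmS T u -> H1E OmS T v -> H1E OmS T (u \- v).
Proof.
move=> hu hv; rewrite (_ : u \- v = fun z => u z + (-1) * v z); first exact: H1ED.
by apply/funext => z /=; rewrite mulN1r.
Qed.

Definition final_sq g (psi : pt -> R) : R :=
  ip lrV OmS (fun x => psi (x, T) - g x) (fun x => psi (x, T) - g x).

(** On [OmS] the final value agrees with the time integral of an L^2 kernel. *)
Lemma C1_final_L2 psi : C1 psi -> L2 lrV OmS (fun x => psi (x, T)).
Proof.
move=> C1psi; have h := C1_has_grad C1psi.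
have Lk : L2 mu Om (final_kernel T (fun z => 'D_(dir R None) psi z) psi).
  have [cpsi _ cD] := h.
  by apply: final_kernel_L2 => //; [exact: L2_continuous oOm Omc (cD None)|exact: L2_continuous oOm Omc cpsi].
apply: (L2_eq mOmS _ (time_avg_L2 oOmS OmSM T0 Lk)) => x xO.
by have := final_trace_C1 T0 h xO; exact.
Qed.

Lemma final_trace_L2 w : H1 Om w -> L2 lrV OmS (final_trace OmS T w).
Proof.
move=> Hw; have Lk := final_kernel_L2 oOmS T0 (H1_wdL2 None Hw) Hw.1.
exact: (time_avg_L2 oOmS OmSM T0 Lk).
Qed.

Lemma final_trace_cvg w (phi : nat -> pt -> R) : H1 Om w -> (forall n, C1 (phi n)) ->
  en (phi n \- w) @[n --> \oo] --> (0 : R) ->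
  final_sq (final_trace OmS T w) (phi n) @[n --> \oo] --> (0 : R).
Proof.
move=> Hw C1phi cv.
have ub : (2 * T + 2 / T) * en (phi n \- w) @[n --> \oo] --> (0 : R).
  by rewrite -(mulr0 (2 * T + 2 / T)); apply: cvgM => //; exact: cvg_cst.
apply: (squeeze_cvgr _ (cvg_cst (0 : R)) ub); apply: nearW => n; rewrite ip_ge0 /=.
have [_ h] := trace_estimate oOmS OmSM T0 Hw (C1phi n).
rewrite -lee_fin -ipE//.
by apply: L2B => //; [exact: C1_final_L2|exact: final_trace_L2].
Qed.

Lemma wd_cvg j w phi : H1 Om w -> H1E_approx w phi ->
  ip mu Om (fun z => wd Om j (phi n) z - wd Om j w z) (fun z => wd Om j (phi n) z - wd Om j w z)
    @[n --> \oo] --> (0 : R).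
Proof.
move=> Hw [C1phi _ Hp cv]; apply: (squeeze_cvgr _ (cvg_cst (0 : R)) cv); apply: nearW => n.
rewrite ip_ge0 /=; have [_ [_ h]] := esq_ge OmS T (phi n \- w); apply: le_trans (h j).
have Hn := C1_H1 (C1phi n); have L := L2B mOm (H1_wdL2 j Hn) (H1_wdL2 j Hw).
have L' := H1_wdL2 j (Hp n).
rewrite le_eqVlt; apply/orP; left; apply/eqP; apply: eq_ip => //.
  by have := wdB j oOm Hn Hw; apply: filterS => z h' Oz; rewrite h'.
by have := wdB j oOm Hn Hw; apply: filterS => z h' Oz; rewrite h'.
Qed.

Lemma strm_L2 (beta : 'rV[R]_d) K v : open K -> H1 K v -> L2 mu K (strm beta K v).
Proof.
move=> oK Hv; have mK := open_measurable_st oK.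
apply: L2D => //; last by have := H1_wdL2 None Hv; exact.
by apply: L2_sum => // i; apply: L2Z => //; have := H1_wdL2 (Some i) Hv; exact.
Qed.

Lemma ip_strm (beta : 'rV[R]_d) K u v : open K -> L2 mu K u -> H1 K v ->
  ip mu K u (strm beta K v) =
  \sum_(i < d) beta ord0 i * ip mu K u (wd K (Some i) v) + ip mu K u (wd K None v).
Proof.
move=> oK Lu Hv; have mK := open_measurable_st oK.
have LD j := H1_wdL2 j Hv.
have Lb i : L2 mu K (fun z => beta ord0 i * wd K (Some i) v z) by exact: L2Z.
have Ls := L2_sum mK (index_enum 'I_d) Lb.
have e1 : ip mu K u (strm beta K v) = ip mu K (fun z => \sum_(i < d) beta ord0 i * wd K (Some i) v z) u + ip mu K (wd K None v) u.
  by rewrite ipC -ipDl.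
rewrite e1 [ip mu K (wd _ _ _) u]ipC; congr (_ + _).
apply: etrans (ip_suml mK (index_enum 'I_d) Lb Lu) _; apply: eq_bigr => i _.
by apply: etrans (ipZl mK (beta ord0 i) (LD (Some i)) Lu) _; rewrite ipC.
Qed.

Lemma energy_cvg (beta : 'rV[R]_d) w phi : H1 Om w -> H1E_approx w phi ->
  2 * ip mu Om (phi n) (strm beta Om (phi n)) @[n --> \oo] --> 2 * ip mu Om w (strm beta Om w).
Proof.
move=> Hw ap; have [C1phi _ Hp cv] := ap; have Hn n := C1_H1 (C1phi n).
apply: cvgM; first exact: cvg_cst.
have cj j : ip mu Om (phi n) (wd Om j (phi n)) @[n --> \oo] --> ip mu Om w (wd Om j w).
  apply: ip_cvg => //; [by move=> n; have := (Hn n).1; exact|by move=> n; exact: H1_wdL2|exact: Hw.1|exact: H1_wdL2| |exact: wd_cvg].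
  apply: (squeeze_cvgr _ (cvg_cst (0 : R)) cv); apply: nearW => n.
  by rewrite ip_ge0 /=; have [_ []] := esq_ge OmS T (phi n \- w).
rewrite (ip_strm beta oOm Hw.1 Hw).
rewrite (_ : (fun n => ip _ _ _ _) = fun n => \sum_(i < d) beta ord0 i * ip mu Om (phi n) (wd Om (Some i) (phi n)) + ip mu Om (phi n) (wd Om None (phi n))).
  apply: cvgD; last exact: cj.
  by apply: cvg_sumR => i; apply: cvgM; [exact: cvg_cst|exact: cj].
by apply/funext => n; rewrite (ip_strm beta oOm (Hn n).1 (Hn n)).
Qed.

Lemma C1_energy (beta : 'rV[R]_d) phi : C1 phi -> vanishes_near (bdryE OmS T) phi ->
  2 * ip mu Om phi (strm beta Om phi) = ip lrV OmS (fun x => phi (x, T)) (fun x => phi (x, T)).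
Proof.
move=> C1phi vphi; have h := C1_has_grad C1phi.
rewrite -(C1_energy_identity oOmS OmSM T0 beta h vphi); congr (2 * _).
have Hp := C1_H1 C1phi; have LD j := H1_wdL2 j Hp; rewrite (ip_strm beta oOm Hp.1 Hp).
have [_ _ cD] := h; have LE j := L2_continuous oOm Omc (cD j).
have E j : ip mu Om phi (wd Om j phi) = ip mu Om phi ('D_(dir R j) phi).
  by have ae := has_grad_wd j oOm Omc h; have L := Hp.1; apply: eq_ip => //; exact: aeW.
have Lb i : L2 mu Om (fun z => beta ord0 i * 'D_(dir R (Some i)) phi z) by apply: L2Z => //; exact: (LE (Some i)).
have Ls := L2_sum mOm (index_enum 'I_d) Lb.
rewrite [RHS]ipC; apply: etrans (esym (ipDl mOm Ls (LE None) Hp.1)).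
apply: (f_equal2 (fun a b : R => a + b)); last by apply: etrans (E None) _; exact: ipC.
apply/esym; apply: etrans (ip_suml mOm (index_enum 'I_d) Lb Hp.1) _; apply: eq_bigr => i _.
by apply: etrans (ipZl mOm (beta ord0 i) (LE (Some i)) Hp.1) _; congr (_ * _); apply: etrans (ipC _ _ _ _) (esym (E (Some i))).
Qed.

Lemma final_cvg w phi g : (forall n, C1 (phi n)) -> L2 lrV OmS g ->
  final_sq g (phi n) @[n --> \oo] --> (0 : R) ->
  ip lrV OmS (fun x => phi n (x, T)) (fun x => phi n (x, T)) @[n --> \oo] --> ip lrV OmS g g.
Proof.
move=> C1phi Lg cv; apply: (ip_cvg mOmS) => //; by move=> n; exact: C1_final_L2.
Qed.

(** [traceT] is some function with the limiting property, along an approximating sequence of its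
    own. Its norm agrees with that of [final_trace], whose formula involves no sequence; this allows
    the C^1 energy identity to be passed to the limit along another sequence, one that vanishes near
    [bdryE]. *)
Lemma traceT_sq (beta : 'rV[R]_d) w : H1E OmS T w ->
  (\int[lrV]_(x in OmS) (traceT OmS T w x ^+ 2)%:E)%E = (2 * ip mu Om w (strm beta Om w))%:E.
Proof.
move=> hw; have [Hw [phi ap]] := (H1EP w).1 hw.
have Lft := final_trace_L2 Hw.
have ft_cvg psi : (forall n, C1 (psi n)) -> H1_sqnorm Om (psi n \- w) @[n --> \oo] --> 0%E ->
    ip lrV OmS (fun x => psi n (x, T)) (fun x => psi n (x, T)) @[n --> \oo] -->
    ip lrV OmS (final_trace OmS T w) (final_trace OmS T w).
  move=> C1psi cv; apply: final_cvg => //; apply: final_trace_cvg => //; exact: esq_cvg.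
have fsE g psi : C1 psi -> L2 lrV OmS g ->
    (\int[lrV]_(x in OmS) ((psi (x, T) - g x) ^+ 2)%:E)%E = (final_sq g psi)%:E.
  by move=> C1psi Lg; rewrite ipE//; apply: L2B => //; exact: C1_final_L2.
have /(xgetPex (cst 0)) : exists g, is_traceT OmS T w g.
  exists (final_trace OmS T w); split => //.
  case: hw => _ [psi [C1psi cv]]; exists psi; split => //; first by move=> n; have [] := C1psi n.
  rewrite (_ : (fun n => _) = EFin \o (fun n => final_sq (final_trace OmS T w) (psi n))); last first.
    by apply/funext => n; rewrite fsE//; have [] := C1psi n.
  apply: cvg_EFin; first exact: nearW.
  have C1psi' n : C1 (psi n) by have [] := C1psi n.
  by apply: final_trace_cvg => //; exact: esq_cvg.
rewrite -/(traceT OmS T w) /= => -[Lt [psi [C1psi cv ct]]].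
rewrite ipE//; congr EFin.
(* Two limits of the same norms, along the sequence that belongs to the chosen trace. *)
transitivity (ip lrV OmS (final_trace OmS T w) (final_trace OmS T w)).
  apply: (cvg_unique _ _ (ft_cvg _ C1psi cv)) => //.
  apply: final_cvg => //.
  rewrite (_ : (fun n => _) = fine \o (fun n => (\int[lrV]_(x in OmS) ((psi n (x, T) - traceT OmS T w x) ^+ 2)%:E)%E)).
    exact: fine_cvg.
  by apply/funext => n /=; rewrite fsE.
(* From here the sequence is the one vanishing near [bdryE], the only one to which the energy
   identity applies. *)
have [C1phi vphi Hp cp] := ap.
have ec := energy_cvg (beta := beta) Hw ap; apply/esym.
apply: (cvg_unique _ ec) => //.
rewrite (_ : (fun n => _) = fun n => ip lrV OmS (fun x => phi n (x, T)) (fun x => phi n (x, T))).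
  by apply: final_cvg => //; apply: final_trace_cvg.
by apply/funext => n; rewrite C1_energy.
Qed.

End H1E_theory.

(** * Tessellations and the discrete problem *)

Section edist_cube.
Variables (R : realType) (d : nat).
Local Notation pt := ('rV[R]_d * R)%type.
(* mathcomp-analysis also defines an [edist]. *)
Local Notation edist := (@Defs.edist R d).
Implicit Types (z w c : pt) (K : set pt).

Lemma co_le_edist j z w : `|co j z - co j w| <= edist z w.
Proof.
rewrite -sqrtr_sqr; apply: ler_wsqrtr; case: j => [i|] /=.
  apply: (@le_trans _ _ (\sum_(i < d) (z.1 ord0 i - w.1 ord0 i) ^+ 2)); last by rewrite lerDl sqr_ge0.
  by apply: (term_le_sum (F := fun i => (z.1 ord0 i - w.1 ord0 i) ^+ 2)) => k; exact: sqr_ge0.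
by rewrite lerDr; apply: sumr_ge0 => i _; exact: sqr_ge0.
Qed.

Lemma edist_le s z w : (forall j, `|co j z - co j w| <= s) -> edist z w <= d.+1%:R * s.
Proof.
move=> h; have s0 : 0 <= s := le_trans (normr_ge0 _) (h None).
have sq j : (co j z - co j w) ^+ 2 <= s ^+ 2.
  by rewrite -(real_normK (num_real _)) ler_sqr ?nnegrE.
have e : \sum_(i < d) (z.1 ord0 i - w.1 ord0 i) ^+ 2 + (z.2 - w.2) ^+ 2 <= (d.+1%:R * s) ^+ 2.
  apply: (@le_trans _ _ (d.+1%:R * s ^+ 2)).
    rewrite -natr1 mulrDl mul1r; apply: lerD; last exact: (sq None).
    rewrite mulr_natl -[X in _ *+ X]card_ord -sumr_const.
    by apply: ler_sum => i _; exact: (sq (Some i)).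
  rewrite exprMn; apply: ler_wpM2r; first exact: sqr_ge0.
  by rewrite -natrX ler_nat -[leqLHS]muln1 leq_mul.
by rewrite -[leRHS]ger0_norm ?mulr_ge0// -sqrtr_sqr; exact: ler_wsqrtr.
Qed.

Lemma edist_bound K B : K `<=` cube 0 B -> forall z w, K z -> K w -> edist z w <= d.+1%:R * (2 * B).
Proof.
move=> KB z w /KB zB /KB wB; apply: edist_le => j.
have := zB j; have := wB j.
have -> : co j (0 : pt) = 0 by case: j => [i|] //=; rewrite mxE.
by rewrite !subr0 => h1 h2; apply: (le_trans (ler_normB _ _)); lra.
Qed.

Lemma edist_le_diam K B : K `<=` cube 0 B -> forall z w, K z -> K w -> edist z w <= diam K.
Proof.
move=> KB z w Kz Kw; apply: ub_le_sup; last by exists z => //; exists w.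
by exists (d.+1%:R * (2 * B)) => _ [a Ka [b Kb <-]]; exact: edist_bound Ka Kb.
Qed.

Lemma diam_bound K B : K `<=` cube 0 B -> K !=set0 -> diam K <= d.+1%:R * (2 * B).
Proof.
move=> KB [z Kz]; apply: ge_sup; first by exists (edist z z); exists z => //; exists z.
by move=> _ [a Ka [b Kb <-]]; exact: edist_bound Ka Kb.
Qed.

(** Provides the two concentric cubes of the inverse inequality. The lower bound on the side in
    terms of h lets s^-2 become h^-2, and the maximum with 1 meets the requirement 1 <= m there. *)
Lemma shape_regular_cube K B kappa h c : 0 < kappa -> 0 < h -> K `<=` cube 0 B ->
  [set z | edist c z < diam K / kappa] `<=` K -> h <= kappa * diam K ->
  exists2 s, h / (kappa ^+ 2 * d.+2%:R) <= s &
    cube c s `<=` K /\ K `<=` cube c (Num.max 1 (kappa * d.+2%:R) * s).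
Proof.
move=> k0 h0 KB cK hK.
have D0 : 0 < diam K by move: (lt_le_trans h0 hK); rewrite pmulr_rgt0.
have d0 : 0 < d.+2%:R :> R by rewrite ltr0n.
(* Euclidean distances in the cube are at most d + 1 times its half-side; dividing by d + 2 makes
   them strictly smaller than diam K / kappa, as the open ball demands. *)
exists (diam K / (kappa * d.+2%:R)).
  rewrite ler_pdivrMr ?mulr_gt0 ?exprn_gt0//.
  have -> : diam K / (kappa * d.+2%:R) * (kappa ^+ 2 * d.+2%:R) = kappa * diam K.
    by field; rewrite !gt_eqF.
  exact: hK.
have Kc : K c.
  apply: cK => /=; apply: (@le_lt_trans _ _ 0); last by rewrite divr_gt0.
  rewrite /edist (_ : _ + _ = 0) ?sqrtr0//.
  by rewrite big1 => [|i _]; rewrite subrr expr0n ?addr0.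
split=> z zc.
  apply: cK => /=.
  have /(edist_le (z := c)) h1 : forall j, `|co j c - co j z| <= diam K / (kappa * d.+2%:R).
    by move=> j; rewrite distrC; exact: zc.
  apply: (le_lt_trans h1).
  have -> : diam K / kappa = d.+2%:R * (diam K / (kappa * d.+2%:R)).
    by field; rewrite !gt_eqF.
  by rewrite ltr_pM2r ?ltr_nat// divr_gt0// mulr_gt0.
move=> j; apply: (le_trans (co_le_edist j z c)); apply: (le_trans (edist_le_diam KB zc Kc)).
apply: (@le_trans _ _ ((kappa * d.+2%:R) * (diam K / (kappa * d.+2%:R)))).
  by rewrite mulrC divfK// gt_eqF// mulr_gt0.
by rewrite ler_wpM2r ?le_max ?lexx ?orbT// divr_ge0 ?mulr_ge0 ?ltW.
Qed.

End edist_cube.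

Section tessellation_theory.
Variables (R : realType) (d : nat) (Om : set ('rV[R]_d * R)) (N : nat).
Variable (tess : 'I_N -> set ('rV[R]_d * R)).
Hypotheses (oOm : open Om) (tes : tessellation Om tess).
Local Notation mu := (@lebesgue_st R d).
Local Notation pt := ('rV[R]_d * R)%type.
Implicit Types (u v w : pt -> R).

Let mOm := open_measurable_st oOm.

Lemma tess_open k : open (tess k). Proof. by case: tes => /(_ k)[]. Qed.
Lemma tess_neq0 k : tess k !=set0. Proof. by case: tes => /(_ k)[]. Qed.
Lemma tess_sub k : tess k `<=` Om. Proof. by case: tes => /(_ k)[]. Qed.

Let mtess k := open_measurable_st (@tess_open k).

(** Only the sets [closure (tess k)] minus [tess k] are known to be negligible. Since the closures
    cover [Om], whatever the elements miss lies in the union of these sets. *)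
Lemma Rintegral_tess (g : pt -> R) : mu.-integrable Om (EFin \o g) ->
  (\int[mu]_(z in Om) g z = \sum_(k < N) \int[mu]_(z in tess k) g z)%R.
Proof.
move=> ig; have [tO tN tI tC] := tes.
pose U : set ('rV[R]_d * measurableTypeR R) := \big[setU/set0]_(k <- index_enum 'I_N) tess k.
have mU : measurable U by apply: bigsetU_measurable => k _; exact: mtess.
have UE z : U z <-> exists k, tess k z.
  rewrite /U -bigcup_seq; split => [[k _ h]|[k h]]; first by exists k.
  by exists k => //=; exact: mem_index_enum.
have UO : U `<=` Om by move=> z /UE[k]; exact: tess_sub.
have nN : mu.-negligible (Om `\` U).
  have : mu.-negligible (\big[setU/set0]_(k <- index_enum 'I_N) (closure (tess k) `\` tess k)).
    apply: big_ind => [|A B|k _]; [exact: negligible_set0|exact: negligibleU|exact: tN].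
  apply: negligibleS => z [Oz nU].
  have : closure Om z by exact: subset_closure.
  rewrite tC -bigcup_seq => -[k _ kz]; exists k => /=; first exact: mem_index_enum.
  by split => // tz; apply: nU; apply/UE; exists k.
have mN : measurable (Om `\` U : set ('rV[R]_d * measurableTypeR R)) by exact: measurableD.
have iU := integrableS mOm mU UO ig.
have E : (\int[mu]_(z in Om) (g z)%:E = \sum_(k < N) \int[mu]_(z in tess k) (g z)%:E)%E.
  have e0 : (\int[mu]_(z in Om) (g z)%:E = \int[mu]_(z in U) (g z)%:E)%E.
    have N0 := (measure_negligible mN nN).
    apply: etrans (negligible_integral mN mOm ig N0) _.
    by rewrite setDD setIidr.
  rewrite e0 integral_bigsetU_EFin//.
  - exact: index_enum_uniq.
  - by apply: sub_trivIset tI.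
  - exact: measurable_int iU.
rewrite /Rintegral E sum_fine// => k _.
apply: integrable_fin_num; first exact: mtess.
exact: (integrableS mOm (mtess k) (@tess_sub k) ig).
Qed.

Lemma ip_tess u v : L2 mu Om u -> L2 mu Om v -> ip mu Om u v = \sum_(k < N) ip mu (tess k) u v.
Proof. by move=> Lu Lv; rewrite /ip Rintegral_tess//; have := L2M_integrable mOm Lu Lv; exact. Qed.

Lemma tess_L2 k u : L2 mu Om u -> L2 mu (tess k) u.
Proof. by move=> Lu; have H := L2S mOm (mtess k) (@tess_sub k) Lu; exact: H. Qed.

(** An element must exist for quasi-uniformity to bound h. *)
Lemma tess_inhabited : Om !=set0 -> exists k : 'I_N, True.
Proof.
move=> [z Oz]; have [_ _ _ tC] := tes.
have : closure Om z by exact: subset_closure.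
by rewrite tC => -[k _ _]; exists k.
Qed.

End tessellation_theory.

Lemma Rintegral_comb3 (R : realType) dX (X : measurableType dX) (mu : {measure set X -> \bar R})
    (K : set X) (f g h : X -> R) (a b : R) : measurable K ->
  mu.-integrable K (EFin \o f) -> mu.-integrable K (EFin \o g) -> mu.-integrable K (EFin \o h) ->
  (\int[mu]_(z in K) (f z + a * g z + b * h z) =
   \int[mu]_(z in K) f z + a * \int[mu]_(z in K) g z + b * \int[mu]_(z in K) h z)%R.
Proof.
move=> mK iF iG iH.
have iZ c k : mu.-integrable K (EFin \o k) -> mu.-integrable K (EFin \o (fun z => c * k z)).
  by move=> ik; have := integrableZl mK c ik; exact.
have iaG := iZ a _ iG; have ibH := iZ b _ iH.
have iFG : mu.-integrable K (EFin \o (fun z => f z + a * g z)).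
  by have := integrableD mK iF iaG; exact.
apply: etrans (RintegralD mK iFG ibH) _; congr (_ + _); last by rewrite RintegralZl.
by apply: etrans (RintegralD mK iF iaG) _; congr (_ + _); rewrite RintegralZl.
Qed.

Lemma sum_comb (R : comNzRingType) n (b x y : 'I_n -> R) (a e c : R) :
  \sum_i b i * (x i + c * y i) + (a + c * e) = (\sum_i b i * x i + a) + c * (\sum_i b i * y i + e).
Proof.
rewrite mulrDr mulr_sumr addrACA -big_split/=; congr (_ + _).
by apply: eq_bigr => i _; rewrite mulrDr [c * (_ * _)]mulrCA.
Qed.

(** * The bilinear forms in terms of inner products *)

Section broken_forms.
Variables (R : realType) (d : nat) (OmS : set 'rV[R]_d) (T alpha gamma : R) (beta : 'rV[R]_d).
Variables (N : nat) (tess : 'I_N -> set ('rV[R]_d * R)).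
Hypothesis oOmS : open OmS.
Hypothesis tes : tessellation (cyl OmS T) tess.
Local Notation mu := (@lebesgue_st R d).
Local Notation pt := ('rV[R]_d * R)%type.
Local Notation Om := (cyl OmS T).
Local Notation S := (strm beta Om).
Implicit Types (u v w f : pt -> R).

Let oOm : open Om := open_cyl oOmS.
Let mOm := open_measurable_st oOm.
Let oK k : open (tess k) := @tess_open _ _ _ _ _ tes k.
Let mK k := open_measurable_st (@oK k).
Let KO k : tess k `<=` Om := @tess_sub _ _ _ _ _ tes k.
Let LK k f : L2 mu Om f -> L2 mu (tess k) f := @tess_L2 _ _ _ _ _ oOm tes k f.

Definition gradip u v : R := \sum_(i < d) ip mu Om (wd Om (Some i) u) (wd Om (Some i) v).

(** The class on which [Bh] is linear in its first argument; it contains the exact solution, the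
    discrete functions and their differences. *)
Definition pw_lap w := H1 Om w /\ forall k, exists l, is_wlap (tess k) w l.

Definition lapip u f : R := \sum_(k < N) ip mu (tess k) (wlap (tess k) u) f.

Definition lapsq u : R := \sum_(k < N) ip mu (tess k) (wlap (tess k) u) (wlap (tess k) u).

Lemma wlap_L2 w k : pw_lap w -> L2 mu (tess k) (wlap (tess k) w).
Proof. by move=> [_ /(_ k)/wlapP[]]. Qed.

Lemma ae_strm K (a b : option 'I_d -> pt -> R) :
  (forall j, {ae mu, forall z, K z -> a j z = b j z}) ->
  {ae mu, forall z, K z -> \sum_(i < d) beta ord0 i * a (Some i) z + a None z =
                           \sum_(i < d) beta ord0 i * b (Some i) z + b None z}.
Proof.
move=> h; have := filter_forall (f := fun j z => K z -> a j z = b j z) (st_ae_filter R d) h.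
apply: filterS => z hz Kz; rewrite hz//; congr (_ + _).
by apply: eq_bigr => i _; rewrite hz.
Qed.

Lemma strm_tess k w : H1 Om w ->
  {ae mu, forall z, tess k z -> strm beta (tess k) w z = S w z}.
Proof.
by move=> Hw; have := ae_strm (fun j => wdS j oOm (@oK k) (@KO k) Hw); exact.
Qed.

Lemma ae_strmD u v c : H1 Om u -> H1 Om v ->
  {ae mu, forall z, Om z -> S (fun z => u z + c * v z) z = S u z + c * S v z}.
Proof.
move=> Hu Hv; have := ae_strm (fun j => wdD j c oOm Hu Hv).
apply: filterS => z h Oz; apply: etrans (h Oz) _.
exact: (sum_comb (fun i => beta ord0 i) (fun i => wd Om (Some i) u z)
  (fun i => wd Om (Some i) v z) (wd Om None u z) (wd Om None v z) c).
Qed.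

Lemma pw_lapD u v c : pw_lap u -> pw_lap v -> pw_lap (fun z => u z + c * v z).
Proof.
move=> [Hu wu] [Hv wv]; split; first exact: H1D.
move=> k; have [l ul] := wu k; have [l' vl] := wv k.
exists (fun z => l z + c * l' z); apply: is_wlapD => //; exact: H1S oOm _ (@KO k) _.
Qed.

Lemma ae_wlapD u v c k : pw_lap u -> pw_lap v ->
  {ae mu, forall z, tess k z ->
     wlap (tess k) (fun z => u z + c * v z) z = wlap (tess k) u z + c * wlap (tess k) v z}.
Proof.
move=> wu wv; have wuv := pw_lapD c wu wv.
apply: (wlap_unique (@oK k) (wlapP (wuv.2 k))); apply: is_wlapD => //.
- exact: H1S oOm _ (@KO k) wu.1.
- exact: H1S oOm _ (@KO k) wv.1.
- exact: wlapP (wu.2 k).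
- exact: wlapP (wv.2 k).
Qed.

Lemma lapipD u v c f : pw_lap u -> pw_lap v -> L2 mu Om f ->
  lapip (fun z => u z + c * v z) f = lapip u f + c * lapip v f.
Proof.
move=> wu wv Lf; rewrite /lapip mulr_sumr -big_split/=; apply: eq_bigr => k _.
exact: (ae_ipDZ (mK k) (ae_wlapD c k wu wv) (wlap_L2 k (pw_lapD c wu wv))
  (wlap_L2 k wu) (wlap_L2 k wv) (LK k Lf)).
Qed.

Lemma strm_ipD u v c f : H1 Om u -> H1 Om v -> L2 mu Om f ->
  ip mu Om (S (fun z => u z + c * v z)) f = ip mu Om (S u) f + c * ip mu Om (S v) f.
Proof.
move=> Hu Hv; have L w : H1 Om w -> L2 mu Om (S w) by exact: strm_L2.
exact: (ae_ipDZ mOm (ae_strmD c Hu Hv) (L _ (H1D c oOm Hu Hv)) (L _ Hu) (L _ Hv)).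
Qed.

Lemma wd_ipD j u v c f : H1 Om u -> H1 Om v -> L2 mu Om f ->
  ip mu Om (wd Om j (fun z => u z + c * v z)) f = ip mu Om (wd Om j u) f + c * ip mu Om (wd Om j v) f.
Proof.
move=> Hu Hv; exact: (ae_ipDZ mOm (wdD j c oOm Hu Hv) (H1_wdL2 j (H1D c oOm Hu Hv))
  (H1_wdL2 j Hu) (H1_wdL2 j Hv)).
Qed.

Lemma gradipD u v c w : H1 Om u -> H1 Om v -> H1 Om w ->
  gradip (fun z => u z + c * v z) w = gradip u w + c * gradip v w.
Proof.
move=> Hu Hv Hw; rewrite /gradip mulr_sumr -big_split/=; apply: eq_bigr => i _.
exact: (wd_ipD (Some i) c Hu Hv (H1_wdL2 (Some i) Hw)).
Qed.

Lemma gradipC u v : gradip u v = gradip v u.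
Proof. by apply: eq_bigr => i _; exact: ipC. Qed.

Lemma gradip_ge0 u : 0 <= gradip u u.
Proof. by apply: sumr_ge0 => i _; exact: ip_ge0. Qed.

Lemma lapsq_ge0 u : 0 <= lapsq u.
Proof. by apply: sumr_ge0 => i _; exact: ip_ge0. Qed.

Lemma BformE u v : H1 Om u -> H1 Om v ->
  Bform OmS T alpha gamma beta u v =
  ip mu Om (S u) v + alpha * gradip u v + gamma * ip mu Om u v.
Proof.
move=> Hu Hv; have Lu := Hu.1; have Lv := Hv.1; have LSu := strm_L2 beta oOm Hu.
have LDu j := H1_wdL2 j Hu; have LDv j := H1_wdL2 j Hv.
have i1 := L2M_integrable mOm LSu Lv; have i3 := L2M_integrable mOm Lu Lv.
have iD i := L2M_integrable mOm (LDu (Some i)) (LDv (Some i)).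
have i2 := integrable_sumR mOm (index_enum 'I_d) iD.
have e := Rintegral_comb3 alpha gamma mOm i1 i2 i3.
have e2 : gradip u v = (\int[mu]_(z in Om) (\sum_(i < d) wd Om (Some i) u z * wd Om (Some i) v z))%R.
  apply/esym; apply: etrans (Rintegral_sum mOm (index_enum 'I_d) iD) _; exact: eq_bigr.
rewrite e2; apply: etrans e; apply: eq_Rintegral => z _.
have r (a b x p q : R) : a * x + p + b * x + q = (b + a) * x + p + q by ring.
exact: r.
Qed.

Lemma tess_term k c u v : pw_lap u -> H1 Om v ->
  (\int[mu]_(z in tess k) (Lop alpha gamma beta (tess k) u z * (c * strm beta (tess k) v z)))%R =
  c * (ip mu (tess k) (S u) (S v) - alpha * ip mu (tess k) (wlap (tess k) u) (S v)
       + gamma * ip mu (tess k) u (S v)).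
Proof.
move=> wu Hv; have Hu := wu.1.
have Hu' := H1S oOm (@oK k) (@KO k) Hu; have Hv' := H1S oOm (@oK k) (@KO k) Hv.
have Lu := LK k Hu.1; have LSu := LK k (strm_L2 beta oOm Hu); have LSv := LK k (strm_L2 beta oOm Hv).
have LSu' := strm_L2 beta (@oK k) Hu'; have LSv' := strm_L2 beta (@oK k) Hv'.
have Ll := wlap_L2 k wu.
have Lal := L2Z (mK k) (- alpha) Ll; have Lgu := L2Z (mK k) gamma Lu.
have LLop' : L2 mu (tess k) (fun z => strm beta (tess k) u z + (- alpha) * wlap (tess k) u z + gamma * u z).
  by apply: L2D => //; apply: L2D.
have LLop : L2 mu (tess k) (Lop alpha gamma beta (tess k) u).
  apply: L2_eq LLop' => // z _; rewrite /Lop /strm.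
  have r (a b x y : R) : a + b - alpha * x + gamma * y = b - alpha * x + a + gamma * y by ring.
  by rewrite mulNr; exact: r.
have L1 : L2 mu (tess k) (fun z => S u z + (- alpha) * wlap (tess k) u z) by exact: L2D.
have LR : L2 mu (tess k) (fun z => S u z + (- alpha) * wlap (tess k) u z + gamma * u z) by exact: L2D.
have aeu := strm_tess k Hu.
have aev := strm_tess k Hv.
have e1 : ip mu (tess k) (Lop alpha gamma beta (tess k) u) (fun z => c * strm beta (tess k) v z) =
   ip mu (tess k) (fun z => S u z + (- alpha) * wlap (tess k) u z + gamma * u z) (fun z => c * S v z).
  apply: eq_ip => //; [|by apply: filterS aev => z h Kz; rewrite h|exact: L2Z|exact: L2Z].
  apply: filterS aeu => z h Kz; rewrite -h// /Lop.
  have r (a b x y : R) : b - alpha * x + a + gamma * y = a + b - alpha * x + gamma * y by ring.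
  by rewrite mulNr; exact: r.
apply: etrans e1 _; rewrite ipC; apply: etrans (ipZl (mK k) c LSv LR) _; congr (_ * _).
rewrite ipC; apply: etrans (ipDl (mK k) L1 Lgu LSv) _; congr (_ + _); last exact: (ipZl (mK k) gamma Lu LSv).
by apply: etrans (ipDl (mK k) LSu Lal LSv) _; rewrite -mulNr; congr (_ + _); exact: (ipZl (mK k) (- alpha) Ll LSv).
Qed.

(** First derivatives on the elements agree almost everywhere with those on the cylinder, so their
    element sums recombine; the Laplacian alone remains broken. *)
Lemma BhE p theta h u v : pw_lap u -> H1 Om v ->
  Bh OmS T alpha gamma beta p theta h tess u v =
  ip mu Om (S u) v + alpha * gradip u v + gamma * ip mu Om u v +
  theta * h ^+ p * nu beta *
    (ip mu Om (S u) (S v) - alpha * lapip u (S v) + gamma * ip mu Om u (S v)).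
Proof.
move=> wu Hv; have Hu := wu.1.
rewrite /Bh BformE//; congr (_ + _).
have LSu := strm_L2 beta oOm Hu; have LSv := strm_L2 beta oOm Hv.
rewrite (ip_tess oOm tes LSu LSv) (ip_tess oOm tes Hu.1 LSv) /lapip.
rewrite mulr_sumr -sumrN [gamma * _]mulr_sumr -!big_split/= mulr_sumr; apply: eq_bigr => k _.
exact: tess_term.
Qed.

Lemma BhD p theta h c u w v : pw_lap u -> pw_lap w -> H1 Om v ->
  Bh OmS T alpha gamma beta p theta h tess (fun z => u z + c * w z) v =
  Bh OmS T alpha gamma beta p theta h tess u v + c * Bh OmS T alpha gamma beta p theta h tess w v.
Proof.
move=> wu ww Hv; have LSv := strm_L2 beta oOm Hv.
rewrite (BhE p theta h (pw_lapD c wu ww) Hv) (BhE p theta h wu Hv) (BhE p theta h ww Hv).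
rewrite (strm_ipD c wu.1 ww.1 Hv.1) (strm_ipD c wu.1 ww.1 LSv).
rewrite (gradipD c wu.1 ww.1 Hv) (ipDZ mOm c wu.1.1 ww.1.1 Hv.1) (ipDZ mOm c wu.1.1 ww.1.1 LSv).
rewrite (lapipD c wu ww LSv).
have r (A A' G G' I I' B B' L L' J J' t : R) :
  A + c * A' + alpha * (G + c * G') + gamma * (I + c * I') +
  t * (B + c * B' - alpha * (L + c * L') + gamma * (J + c * J')) =
  A + alpha * G + gamma * I + t * (B - alpha * L + gamma * J) +
  c * (A' + alpha * G' + gamma * I' + t * (B' - alpha * L' + gamma * J')) by ring.
exact: r.
Qed.

End broken_forms.

(** * Finite element functions and their Laplacians *)

Section finite_element_space.
Variables (R : realType) (d : nat) (OmS : set 'rV[R]_d) (T M : R).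
Variables (r N : nat) (tess : 'I_N -> set ('rV[R]_d * R)).
Hypotheses (oOmS : open OmS) (OmSM : forall x, OmS x -> `|x| <= M).
Hypothesis tes : tessellation (cyl OmS T) tess.
Local Notation mu := (@lebesgue_st R d).
Local Notation pt := ('rV[R]_d * R)%type.
Local Notation Om := (cyl OmS T).
Implicit Types (u v w f : pt -> R).

Let oOm : open Om := open_cyl oOmS.
Let Omc : Om `<=` cube 0 (Num.max M T) := cyl_cube OmSM.
Let oK k : open (tess k) := @tess_open _ _ _ _ _ tes k.
Let mK k := open_measurable_st (@oK k).
Let KO k : tess k `<=` Om := @tess_sub _ _ _ _ _ tes k.
Let LK k f : L2 mu Om f -> L2 mu (tess k) f := @tess_L2 _ _ _ _ _ oOm tes k f.
Let Kc k : tess k `<=` cube 0 (Num.max M T) := subset_trans (@KO k) Omc.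

Lemma is_mpoly_hess q : is_mpoly r q -> exists (D : option 'I_d -> pt -> R) E,
  [/\ has_grad q D, forall j, is_mpoly r (D j), forall i : 'I_d, has_grad (D (Some i)) (E i) &
   forall i j, is_mpoly r (E i j)].
Proof.
move=> /is_mpoly_grad[D gD pD].
have /choice[E hE] : forall i : 'I_d, exists E, has_grad (D (Some i)) E /\ forall j, is_mpoly r (E j).
  by move=> i; have [E gE pE] := is_mpoly_grad (pD (Some i)); exists E.
by exists D, E; split => // i; have [] := hE i.
Qed.

(** Elementwise, the Laplacian is that of a polynomial; nothing is claimed across faces, where the
    gradient may jump. *)
Lemma Vh_pw_lap v : Vh OmS T r tess v -> pw_lap OmS T tess v.
Proof.
move=> [[Hv _] _ vp]; split => // k; have [q /poly_deg_le_mpoly pq vq] := vp k.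
have [D [E [gq _ gD _]]] := is_mpoly_hess pq.
by eexists; exact: has_grad_is_wlap (@oK k) (@Kc k) vq gq gD.
Qed.

Lemma VhB u v : Vh OmS T r tess u -> Vh OmS T r tess v -> Vh OmS T r tess (u \- v).
Proof.
move=> [Hu cu pu] [Hv cv pv]; split; first exact: (H1EB oOmS OmSM Hu Hv).
  by move=> z; apply: cvgB; [exact: cu|exact: cv].
move=> k; have [q [c qE] uq] := pu k; have [q' [c' q'E] vq] := pv k.
exists (fun z => q z - q' z); last by move=> z kz /=; rewrite uq// vq.
exists (fun a j => c a j - c' a j) => z; rewrite qE q'E -sumrB; apply: eq_bigr => a _.
by rewrite -sumrB; apply: eq_bigr => j _; rewrite !mulrBl.
Qed.

(** The inverse inequality is applied to each partial derivative of v, a polynomial again. The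
    factor d is Cauchy-Schwarz for the sum of d second derivatives. *)
Lemma lap_inverse_elt C m c s k v :
  (forall (K : set pt) (c : pt) (s : R) q D,
    is_mpoly r q -> has_grad q D -> open K -> 0 < s -> cube c s `<=` K -> K `<=` cube c (m * s) ->
    forall j, ip mu K (D j) (D j) <= C / s ^+ 2 * ip mu K q q) ->
  0 < s -> cube c s `<=` tess k -> tess k `<=` cube c (m * s) -> Vh OmS T r tess v ->
  ip mu (tess k) (wlap (tess k) v) (wlap (tess k) v) <=
  d%:R * (C / s ^+ 2) * \sum_(i < d) ip mu (tess k) (wd Om (Some i) v) (wd Om (Some i) v).
Proof.
move=> HC s0 cK Kcs vV; have wv := Vh_pw_lap vV; have Hv := wv.1.
case: vV => _ _ vp; have [q /poly_deg_le_mpoly pq vq] := vp k.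
have [D [E [gq pD gD pE]]] := is_mpoly_hess pq.
have LD j : L2 mu (tess k) (D j) by have [_ _ cD] := gq; exact: L2_continuous (@oK k) (@Kc k) (cD j).
have LE i j : L2 mu (tess k) (E i j) by have [_ _ cD] := gD i; exact: L2_continuous (@oK k) (@Kc k) (cD j).
have wl := has_grad_is_wlap (@oK k) (@Kc k) vq gq gD.
have ae := wlap_unique (@oK k) (wlapP (wv.2 k)) wl.
have Ls := L2_sum (mK k) (index_enum 'I_d) (fun i => LE i (Some i)).
have Ll := wlap_L2 k wv.
have e1 := eq_ip (mK k) ae ae Ll Ls Ll Ls; rewrite e1.
have le1 : ip mu (tess k) (fun z => \sum_(i < d) E i (Some i) z) (fun z => \sum_(i < d) E i (Some i) z) <=
    d%:R * \sum_(i < d) ip mu (tess k) (E i (Some i)) (E i (Some i)).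
  have iE i := L2M_integrable (mK k) (LE i (Some i)) (LE i (Some i)).
  have eS := Rintegral_sum (mK k) (index_enum 'I_d) iE.
  rewrite -eS; have iS := integrable_sumR (mK k) (index_enum 'I_d) iE.
  rewrite -(RintegralZl d%:R (mK k) iS); apply: le_Rintegral => //.
  - by have := L2M_integrable (mK k) Ls Ls; exact.
  - by have := integrableZl (mK k) d%:R iS; exact.
  - move=> z _; have := sqr_sum_le (fun i => E i (Some i) z); rewrite expr2 => h.
    by apply: le_trans h _; rewrite ler_wpM2l//; apply: ler_sum => i _; rewrite expr2.
apply: (le_trans le1); rewrite -mulrA ler_wpM2l// mulr_sumr; apply: ler_sum => i _.
have := HC (tess k) c s (D (Some i)) (E i) (pD (Some i)) (gD i) (@oK k) s0 cK Kcs (Some i).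
have vq' z : tess k z -> q z = v z by move/vq.
have Hq := has_grad_H1 (@oK k) (@Kc k) gq.
have ae2 : {ae mu, forall z, tess k z -> D (Some i) z = wd Om (Some i) v z}.
  have a1 := has_grad_wd (Some i) (@oK k) (@Kc k) gq.
  have a2 := eq_wd (Some i) (@oK k) vq' Hq.
  have a3 := wdS (Some i) oOm (@oK k) (@KO k) Hv.
  by apply: filterS3 a1 a2 a3 => z h1 h2 h3 Kz; rewrite -h1// h2// h3.
have Lw := LK k (H1_wdL2 (Some i) Hv).
by rewrite (eq_ip (mK k) ae2 ae2 (LD (Some i)) Lw (LD (Some i)) Lw).
Qed.

End finite_element_space.

Lemma integral_EFinE (R : realType) dX (X : measurableType dX) (mu : {measure set X -> \bar R})
    (K : set X) (f : X -> R) : measurable K -> mu.-integrable K (EFin \o f) ->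
  (\int[mu]_(z in K) (f z)%:E)%E = (\int[mu]_(z in K) f z)%R%:E.
Proof. by move=> mK iF; rewrite /Rintegral fineK//; exact: integrable_fin_num iF. Qed.

Lemma lap_inverse (R : realType) (d r : nat) (kappa : R) : 0 < kappa ->
  exists2 C : R, 0 < C & forall (OmS : set 'rV[R]_d) (T M h : R) N
    (tess : 'I_N -> set ('rV[R]_d * R)) v,
    open OmS -> (forall x, OmS x -> `|x| <= M) -> 0 < T -> tessellation (cyl OmS T) tess ->
    shape_regular kappa tess -> quasiuniform kappa h tess -> 0 < h -> Vh OmS T r tess v ->
    lapsq tess v <= C / h ^+ 2 * gradip OmS T v v.
Proof.
move=> k0; set A := kappa ^+ 2 * d.+2%:R; set m := Num.max 1 (kappa * d.+2%:R).
have A0 : 0 < A by rewrite mulr_gt0 ?exprn_gt0 ?ltr0n.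
have m1 : 1 <= m by rewrite le_max lexx.
have [C C0 HC] := @inverse_estimate R d r m m1.
(* [d.+1] in place of [d] keeps the constant positive in dimension 0; [A ^+ 2] comes from h / A <=
   s. *)
exists (d.+1%:R * C * A ^+ 2); first by rewrite !mulr_gt0 ?exprn_gt0 ?ltr0n.
move=> OmS T M h N tess v oOmS OmSM T0 tes sr qu h0 vV.
have oOm : open (cyl OmS T) := open_cyl oOmS.
have Hv := (Vh_pw_lap OmSM tes vV).1.
have -> : gradip OmS T v v = \sum_(k < N) \sum_(i < d) ip (@lebesgue_st R d) (tess k)
    (wd (cyl OmS T) (Some i) v) (wd (cyl OmS T) (Some i) v).
  rewrite /gradip exchange_big/=; apply: eq_bigr => i _.
  by rewrite (ip_tess oOm tes (H1_wdL2 (Some i) Hv) (H1_wdL2 (Some i) Hv)).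
rewrite /lapsq mulr_sumr; apply: ler_sum => k _.
have [c ck] := sr k; have /andP[_ hk] := qu k.
have Kc : tess k `<=` cube 0 (Num.max M T).
  exact: subset_trans (@tess_sub _ _ _ _ _ tes k) (cyl_cube OmSM).
have [s hs [cs cm]] := shape_regular_cube k0 h0 Kc ck hk.
have hA : 0 < h / A by rewrite divr_gt0.
have s0 : 0 < s by exact: lt_le_trans hA hs.
apply: le_trans (lap_inverse_elt oOmS OmSM tes HC s0 cs cm vV) _.
apply: ler_wpM2r; first by apply: sumr_ge0 => i _; exact: ip_ge0.
have -> : d.+1%:R * C * A ^+ 2 / h ^+ 2 = d.+1%:R * (C / (h / A) ^+ 2).
  by field; rewrite !gt_eqF.
apply: ler_pM => //; first by rewrite divr_ge0 ?exprn_ge0 ?ltW.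
  by rewrite ler_nat.
rewrite ler_pM2l// lef_pV2 ?posrE ?exprn_gt0//.
by rewrite ler_sqr ?nnegrE ?(ltW hA) ?(ltW s0).
Qed.

(** * The quadratic form q and the energy norm *)

Section energy.
Variables (R : realType) (d : nat) (OmS : set 'rV[R]_d) (T M alpha gamma : R) (beta : 'rV[R]_d).
Hypotheses (oOmS : open OmS) (OmSM : forall x, OmS x -> `|x| <= M) (T0 : 0 < T).
Local Notation mu := (@lebesgue_st R d).
Local Notation pt := ('rV[R]_d * R)%type.
Local Notation Om := (cyl OmS T).
Local Notation S := (strm beta Om).
Implicit Types (u v w f : pt -> R).

Let oOm : open Om := open_cyl oOmS.
Let mOm := open_measurable_st oOm.

Definition qform w : R := 2 * ip mu Om w (S w).

Lemma qform_ge0 w : H1E OmS T w -> 0 <= qform w.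
Proof.
move=> hw; rewrite -lee_fin /qform -(traceT_sq oOmS OmSM T0 beta hw).
by apply: integral_ge0 => x _; rewrite lee_fin sqr_ge0.
Qed.

Lemma qformD u v c : H1 Om u -> H1 Om v ->
  qform (fun z => u z + c * v z) =
  qform u + 2 * c * (ip mu Om (S u) v + ip mu Om u (S v)) + c ^+ 2 * qform v.
Proof.
move=> Hu Hv; have LSu := strm_L2 beta oOm Hu; have LSv := strm_L2 beta oOm Hv.
have Luv := (H1D c oOm Hu Hv).1.
rewrite /qform ipC (strm_ipD beta oOmS c Hu Hv Luv).
have e f : L2 mu Om f -> ip mu Om f (fun z => u z + c * v z) = ip mu Om u f + c * ip mu Om v f.
  by move=> Lf; rewrite ipC; exact: (ipDZ mOm c Hu.1 Hv.1 Lf).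
have e1 := e _ LSu; have e2 := e _ LSv.
rewrite e1 e2 [ip mu Om v (S u)]ipC.
have r (a b k g : R) : 2 * (a + c * b + c * (k + c * g)) = 2 * a + 2 * c * (b + k) + c ^+ 2 * (2 * g) by ring.
exact: r.
Qed.

Lemma qform_polar u v : H1E OmS T u -> H1E OmS T v ->
  ip mu Om (S u) v + ip mu Om u (S v) <= qform u + 4^-1 * qform v.
Proof.
move=> hu hv; have := qform_ge0 (H1ED oOmS OmSM (- 2^-1) hu hv).
rewrite (qformD (- 2^-1) hu.1 hv.1).
set a := qform u; set b := qform v; set e := ip mu Om _ _ + ip mu Om _ _.
have r : a + 2 * - 2^-1 * e + (- 2^-1) ^+ 2 * b = a + 4^-1 * b - e by field.
by rewrite r subr_ge0.
Qed.

(** Makes the energy a real number, its trace term being [qform]; from here on the error analysis is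
    real arithmetic. *)
Lemma energy2E p h w : H1E OmS T w ->
  energy2 OmS T alpha gamma beta p h w =
  (qform w + (alpha * gradip OmS T w w + h ^+ p * nu beta * ip mu Om (S w) (S w) +
     gamma * ip mu Om w w))%:E.
Proof.
move=> hw; have Hw := hw.1; rewrite /energy2 (traceT_sq oOmS OmSM T0 beta hw) EFinD; congr (_ + _)%E.
have LS := strm_L2 beta oOm Hw; have LD j := H1_wdL2 j Hw.
have i2 := LS.2; have i3 := Hw.1.2.
have iD i := (LD (Some i)).2.
have iG := integrable_sumR mOm (index_enum 'I_d) iD.
have i1 : mu.-integrable Om (EFin \o (fun z => alpha * \sum_(i < d) wd Om (Some i) w z ^+ 2)).
  by have := integrableZl mOm alpha iG; exact.
have eG := Rintegral_sum mOm (index_enum 'I_d) iD.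
have eZ := RintegralZl alpha mOm iG.
have e := Rintegral_comb3 (h ^+ p * nu beta) gamma mOm i1 i2 i3.
have ipE' f : ip mu Om f f = (\int[mu]_(z in Om) (f z ^+ 2))%R by apply: eq_Rintegral => z _; rewrite expr2.
have eG' : alpha * gradip OmS T w w = (\int[mu]_(z in Om) (alpha * \sum_(i < d) wd Om (Some i) w z ^+ 2))%R.
  apply: etrans (esym eZ); congr (_ * _); apply: etrans (esym eG).
  by apply: eq_bigr => i _; exact: ipE'.
rewrite eG' !ipE'; apply: etrans (congr1 EFin e); apply: integral_EFinE => //.
have iZ c f : mu.-integrable Om (EFin \o f) -> mu.-integrable Om (EFin \o (fun z => c * f z)).
  by move=> jf; have := integrableZl mOm c jf; exact.
have i12 := integrableD mOm i1 (iZ (h ^+ p * nu beta) _ i2).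
by have := integrableD mOm i12 (iZ gamma _ i3); exact.
Qed.

Lemma approx2E h N (tess : 'I_N -> set pt) w : tessellation Om tess -> pw_lap OmS T tess w ->
  approx2 OmS T alpha beta h tess w =
  ((h ^+ 2 * nu beta)^-1 * ip mu Om w w + alpha * h ^+ 2 * lapsq tess w)%:E.
Proof.
move=> tes ww.
have sqE K c f : measurable K -> L2 mu K f ->
    (\int[mu]_(z in K) (c * f z ^+ 2)%:E)%E = (c * ip mu K f f)%:E.
  move=> mK Lf; have i := Lf.2; have iZ := integrableZl mK c i.
  apply: etrans (integral_EFinE mK iZ) _; congr EFin; apply: etrans (RintegralZl c mK i) _.
  by congr (_ * _); apply: eq_Rintegral => z _; rewrite expr2.
rewrite /approx2 EFinD (sqE Om _ w mOm ww.1.1); congr (_ + _)%E.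
rewrite /lapsq mulr_sumr -sumEFin; apply: eq_bigr => k _.
have oK : open (tess k) := @tess_open _ _ _ _ _ tes k.
exact: sqE (open_measurable_st oK) (wlap_L2 k ww).
Qed.

End energy.

(** * Scalar inequalities behind the error estimate *)

(** With Q k the value of a quadratic form at u + k v, the sum Q 1 + Q (-1) is 2 a + 2 b; dropping Q
    1 splits the form of a difference. *)
Lemma parallelogram_le (R : realDomainType) (Q : R -> R) (a b c : R) :
  (forall k, Q k = a + 2 * k * c + k ^+ 2 * b) -> 0 <= Q 1 -> Q (-1) <= 2 * a + 2 * b.
Proof. by move=> QE; rewrite !QE; lra. Qed.

(* With t = theta h^2 nu: q, G, Z, X, L stand for 2(w, S w), |grad w|^2, |w|^2,
   |S w|^2 and the elementwise |Delta w|^2, the suffixes x and e for xi and eta. *)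
Lemma coercive_estimate (R : realFieldType) (alpha gamma t qx Gx Zx Xx Lx qe Ge Ze Xe Le : R)
    (b1 b2 gm zm xm lm lx sx : R) :
  0 < t -> 0 <= alpha -> 0 <= gamma -> 0 <= qx -> 2 * sx = qx ->
  b1 + b2 <= qe + 4^-1 * qx ->
  b1 + alpha * gm + gamma * zm + t * (xm - alpha * lm + gamma * b2) =
    sx + alpha * Gx + gamma * Zx + t * (Xx - alpha * lx + gamma * sx) ->
  - b2 <= 2 / t * Ze + t / 8 * Xx ->
  gm <= Ge + 4^-1 * Gx ->
  zm <= 2^-1 * Ze + 2^-1 * Zx ->
  xm <= 2 * Xe + 8^-1 * Xx ->
  - alpha * lm <= 2 * (alpha ^+ 2 * Le) + 8^-1 * Xx ->
  gamma * b2 <= 2 * (gamma ^+ 2 * Ze) + 8^-1 * Xx ->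
  alpha * lx <= alpha ^+ 2 * Lx + 4^-1 * Xx ->
  t * (alpha ^+ 2 * Lx) <= alpha / 2 * Gx ->
  4^-1 * qx + alpha / 4 * Gx + gamma / 2 * Zx + t / 4 * Xx <=
  qe + 2 / t * Ze + alpha * Ge + gamma / 2 * Ze +
    t * (2 * Xe + 2 * (alpha ^+ 2 * Le) + 2 * (gamma ^+ 2 * Ze)).
Proof.
move=> t0 a0 g0 qx0 sxE hb gal h1 /(ler_wpM2l a0) h2 /(ler_wpM2l g0) h3 h4 h5 h6 h7 h8.
(* The budget: of t |S xi|^2, an eighth goes to [b2], an eighth to each of the three stabilisation
   products and a quarter to the Laplacian of xi, leaving a quarter. Of alpha |grad xi|^2 a quarter
   and a half are spent, and qx keeps 1/2 - 1/4. The term t gamma sx is nonnegative and dropped. *)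
have tn : 0 <= t := ltW t0.
have hS : t * (xm - alpha * lm + gamma * b2) <=
    t * (2 * Xe + 8^-1 * Xx + (2 * (alpha ^+ 2 * Le) + 8^-1 * Xx) + (2 * (gamma ^+ 2 * Ze) + 8^-1 * Xx)).
  by apply: ler_wpM2l => //; apply: lerD => //; apply: lerD => //; rewrite -mulNr.
have hX : t * (Xx - alpha ^+ 2 * Lx - 4^-1 * Xx) <= t * (Xx - alpha * lx).
  by apply: ler_wpM2l => //; lra.
have hs : 0 <= t * (gamma * sx) by rewrite mulr_ge0// mulr_ge0//; lra.
move: h1 hb gal hS hX; rewrite -sxE; set y := 2 / t * Ze; move: hs h2 h3 h8.
rewrite !mulrDr !mulrN.
move: (t * (gamma * sx)) (t * (alpha ^+ 2 * Lx)) => w1 w2; lra.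
Qed.

(** The constant has a 2 from splitting eta - xi, a factor 4 (1 + theta^-1) because the coercive
    bound keeps at least a quarter of each term but only theta / 4 of the streamline one, and a last
    factor collecting the coefficients of the right-hand side. There theta alpha stems from t
    alpha^2 |Delta eta|^2, and theta gamma h02 from t gamma^2 |eta|^2, where [c <= h02] trades h^2
    nu for a quantity independent of the mesh. *)
Lemma energy_split (R : realFieldType) (alpha gamma theta c h2 h02 nu qx Gx Zx Xx qe Ge Ze Xe Le : R) :
  0 < theta -> 0 < c -> 0 <= alpha -> 0 <= gamma -> 0 <= h2 -> 0 <= nu -> nu <= 1 ->
  c = h2 * nu -> c <= h02 ->
  0 <= qx -> 0 <= Gx -> 0 <= Zx -> 0 <= Xx -> 0 <= qe -> 0 <= Ge -> 0 <= Ze -> 0 <= Xe -> 0 <= Le ->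
  4^-1 * qx + alpha / 4 * Gx + gamma / 2 * Zx + theta * c / 4 * Xx <=
  qe + 2 / (theta * c) * Ze + alpha * Ge + gamma / 2 * Ze +
    theta * c * (2 * Xe + 2 * (alpha ^+ 2 * Le) + 2 * (gamma ^+ 2 * Ze)) ->
  (2 * qe + 2 * qx) + (alpha * (2 * Ge + 2 * Gx) + c * (2 * Xe + 2 * Xx) + gamma * (2 * Ze + 2 * Zx)) <=
  (2 + 8 * (1 + theta^-1) * (2 + 2 / theta + 2 * theta + 2 * theta * alpha + 2 * theta * gamma * h02)) *
  (qe + (alpha * Ge + c * Xe + gamma * Ze) + (c^-1 * Ze + alpha * h2 * Le)).
Proof.
move=> th0 c0 a0 g0 h20 nu0 nu1 cE ch qx0 Gx0 Zx0 Xx0 qe0 Ge0 Ze0 Xe0 Le0 H.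
set C1 := 2 + _ + _ + _ + _; set E := qe + _; set B := c^-1 * Ze + alpha * h2 * Le.
set A := 4^-1 * qx + _ + _ + _ in H.
have thi : 0 < theta^-1 by rewrite invr_gt0.
have ci : 0 < c^-1 by rewrite invr_gt0.
have h020 : 0 <= h02 by apply: le_trans ch; exact: ltW.
have p1 : 0 <= theta * alpha by rewrite mulr_ge0// ltW.
have p2 : 0 <= theta * gamma by rewrite mulr_ge0// ltW.
have p3 : 0 <= theta * gamma * h02 by rewrite mulr_ge0.
have aG : 0 <= alpha * Ge by rewrite mulr_ge0.
have cX : 0 <= c * Xe by rewrite mulr_ge0// ltW.
have gZ : 0 <= gamma * Ze by rewrite mulr_ge0.
have iZ : 0 <= c^-1 * Ze by rewrite mulr_ge0// ltW.
have aL : 0 <= alpha * h2 * Le by rewrite !mulr_ge0.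
have B0 : 0 <= B by rewrite addr_ge0.
have E0 : 0 <= E by rewrite /E; lra.
have AR : A <= C1 * (E + B).
  apply: (le_trans H).
  have e1 : 2 / (theta * c) * Ze = (2 * theta^-1) * (c^-1 * Ze) by field; rewrite !gt_eqF.
  have e2 : theta * c * (2 * (alpha ^+ 2 * Le)) <= 2 * (theta * alpha) * (alpha * h2 * Le).
    rewrite cE (_ : _ * _ = nu * (2 * (theta * alpha) * (alpha * h2 * Le))); last by ring.
    by apply: ler_piMl => //; apply: mulr_ge0 => //; apply: mulr_ge0.
  have e3 : theta * c * (2 * (gamma ^+ 2 * Ze)) <= 2 * (theta * gamma * h02) * (gamma * Ze).
    rewrite (_ : _ * _ = 2 * (theta * gamma * c) * (gamma * Ze)); last by ring.
    by rewrite ler_wpM2r// ler_pM2l// ler_wpM2l.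
  have e4 : theta * c * (2 * Xe) = 2 * theta * (c * Xe) by ring.
  rewrite e1 2!mulrDr e4 /E /B; move: e2 e3; rewrite /C1.
  set xa := alpha * Ge in aG *; set xc := c * Xe in cX *; set xg := gamma * Ze in gZ *.
  set xi := c^-1 * Ze in iZ *; set xl := alpha * h2 * Le in aL *.
  have -> : gamma / 2 * Ze = 2^-1 * xg by rewrite /xg; ring.
  move: (theta^-1) thi => ti ti0.
  have -> : 2 * theta * alpha = 2 * (theta * alpha) by ring.
  have -> : 2 * theta * gamma * h02 = 2 * (theta * gamma * h02) by ring.
  move: (theta * alpha) p1 (theta * gamma * h02) p3 => y1 y10 y3 y30.
  move: (theta * c * _) (theta * c * _) => z1 z2 hz1 hz2.
  clearbody xa xc xg xi xl.
  apply: (@le_trans _ _ (2 * (qe + xa + xg) + 2 * ti * xi + 2 * theta * xc + 2 * y1 * xl + 2 * y3 * xg)); first by lra.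
  nra.
have AX : qx + (alpha * Gx + c * Xx + gamma * Zx) <= 4 * (1 + theta^-1) * A.
  rewrite /A; have -> : theta * c / 4 * Xx = theta * (c * Xx) / 4 by ring.
  have aGx : 0 <= alpha * Gx by rewrite mulr_ge0.
  have cXx : 0 <= c * Xx by rewrite mulr_ge0// ltW.
  have gZx : 0 <= gamma * Zx by rewrite mulr_ge0.
  have -> : alpha / 4 * Gx = alpha * Gx / 4 by ring.
  have -> : gamma / 2 * Zx = gamma * Zx / 2 by ring.
  move: (alpha * Gx) aGx (c * Xx) cXx (gamma * Zx) gZx => y1 y10 y2 y20 y3 y30.
  have -> : 4 * (1 + theta^-1) * (4^-1 * qx + y1 / 4 + y3 / 2 + theta * y2 / 4) =
     (1 + theta^-1) * (qx + y1 + 2 * y3) + theta * y2 + y2 by field; rewrite gt_eqF.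
  have : 0 <= theta * y2 by rewrite mulr_ge0// ltW.
  have : 0 <= theta^-1 * (qx + y1 + 2 * y3) by apply: mulr_ge0; [exact: ltW|clear -qx0 y10 y30; lra].
  rewrite [(1 + theta^-1) * _]mulrDl mul1r; move: (theta^-1 * _) (theta * y2) => k1 k2 hk1 hk2.
  by clear -hk1 hk2 y10 y20 y30 qx0; lra.
have h4 : 0 <= 4 * (1 + theta^-1) by lra.
have := le_trans AX (ler_wpM2l h4 AR).
have -> : (2 + 8 * (1 + theta^-1) * C1) * (E + B) = 2 * (E + B) + 2 * (4 * (1 + theta^-1) * (C1 * (E + B))) by ring.
move: (4 * (1 + theta^-1) * _) AX => Y; rewrite /E => h.
move: h B0 aG cX gZ iZ aL; rewrite /B; clear => h; lra.
Qed.

(** The coefficient, of either sign, ends squared on the side of [u], leaving the term in [v] free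
    of it and ready for absorption. *)
Lemma ip_youngZ (R : realType) dX (X : measurableType dX) (mu : {measure set X -> \bar R})
    (K : set X) (a s : R) u v : measurable K -> 0 < s -> L2 mu K u -> L2 mu K v ->
  a * ip mu K u v <= s * (a ^+ 2 * ip mu K u u) + (4 * s)^-1 * ip mu K v v.
Proof.
move=> mK s0 Lu Lv; have La := L2Z mK a Lu; have := ip_young mK s0 La Lv.
have e : ip mu K (fun z => a * u z) (fun z => a * u z) = a ^+ 2 * ip mu K u u.
  by rewrite (ipZl mK a Lu La) ipC (ipZl mK a Lu Lu) mulrA -expr2.
by rewrite e (ipZl mK a Lu Lv).
Qed.

(** * Consistency, stability and the error estimate on one mesh *)

Section error_bound.
Variables (R : realType) (d : nat) (OmS : set 'rV[R]_d) (T M alpha gamma : R) (beta : 'rV[R]_d).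
Variables (N : nat) (tess : 'I_N -> set ('rV[R]_d * R)).
Hypotheses (oOmS : open OmS) (OmSM : forall x, OmS x -> `|x| <= M) (T0 : 0 < T).
Hypothesis tes : tessellation (cyl OmS T) tess.
Local Notation mu := (@lebesgue_st R d).
Local Notation pt := ('rV[R]_d * R)%type.
Local Notation Om := (cyl OmS T).
Local Notation S := (strm beta Om).
Local Notation qf := (qform OmS T beta).
Local Notation gradOm := (gradip OmS T).
Implicit Types (u v w f : pt -> R).

Let oOm : open Om := open_cyl oOmS.
Let mOm := open_measurable_st oOm.
Let oK k : open (tess k) := @tess_open _ _ _ _ _ tes k.
Let mK k := open_measurable_st (@oK k).
Let KO k : tess k `<=` Om := @tess_sub _ _ _ _ _ tes k.
Let LK k f : L2 mu Om f -> L2 mu (tess k) f := @tess_L2 _ _ _ _ _ oOm tes k f.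

Lemma gradip_young u v : H1 Om u -> H1 Om v ->
  gradOm u v <= gradOm u u + 4^-1 * gradOm v v.
Proof.
move=> Hu Hv; rewrite /gradip mulr_sumr -big_split/=; apply: ler_sum => i _.
have h1 := ip_young mOm ltr01 (H1_wdL2 (Some i) Hu) (H1_wdL2 (Some i) Hv).
by rewrite [1 * _]mul1r [4 * 1]mulr1 in h1.
Qed.

Lemma lapip_young a s u f : 0 < s -> pw_lap OmS T tess u -> L2 mu Om f ->
  a * lapip tess u f <= s * (a ^+ 2 * lapsq tess u) + (4 * s)^-1 * ip mu Om f f.
Proof.
move=> s0 wu Lf; rewrite (ip_tess oOm tes Lf Lf) /lapip /lapsq !mulr_sumr -big_split/=.
apply: ler_sum => k _.
by have := ip_youngZ a (mK k) s0 (wlap_L2 k wu) (LK k Lf); exact.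
Qed.

Lemma pw_lapS u : H1 Om u -> (exists l, is_wlap Om u l) -> pw_lap OmS T tess u.
Proof.
by move=> Hu [l ul]; split => // k; exists l; exact: is_wlapS oOm (@oK k) (@KO k) Hu ul.
Qed.

(** The weak form settles B(u, v). In the stabilisation term the elementwise Laplacian of u is the
    restriction of its global one, so the element residuals add up to f tested with the streamline
    derivative. *)
Lemma Bh_consistent p theta h f u v : L2 mu Om f ->
  weak_solution OmS T alpha gamma beta f u -> strong_solution OmS T alpha gamma beta f u ->
  H1E OmS T v ->
  Bh OmS T alpha gamma beta p theta h tess u v =
  Fform OmS T f (fun z => v z + theta * h ^+ p * nu beta * S v z).
Proof.
move=> Lf [hu weak] [ex strong] hv; have Hu := hu.1; have Hv := hv.1.
have wu := pw_lapS Hu ex; have ul := wlapP ex; have Ll := ul.1.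
have LSu := strm_L2 beta oOm Hu; have LSv := strm_L2 beta oOm Hv; have Lv := Hv.1; have Lu := Hu.1.
rewrite (BhE alpha gamma beta oOmS tes p theta h wu Hv) -(BformE alpha gamma beta oOmS Hu Hv) (weak v hv).
set c := theta * _ * _; have Lcv := L2Z mOm c LSv.
have eF : Fform OmS T f (fun z => v z + c * S v z) = ip mu Om f v + c * ip mu Om f (S v).
  transitivity (ip mu Om f (fun z => v z + c * S v z)); first by [].
  rewrite ipC; apply: etrans (ipDZ mOm c Lv LSv Lf) _.
  by congr (_ + c * _); exact: ipC.
rewrite eF; congr (_ + c * _).
have Lal := L2Z mOm (- alpha) Ll; have Lgu := L2Z mOm gamma Lu.
have L1 : L2 mu Om (fun z => S u z + (- alpha) * wlap Om u z) by exact: L2D.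
have L2' : L2 mu Om (fun z => S u z + (- alpha) * wlap Om u z + gamma * u z) by exact: L2D.
have ae : {ae mu, forall z, Om z -> f z = S u z + (- alpha) * wlap Om u z + gamma * u z}.
  apply: filterS strong => z h' Oz; rewrite -(h' Oz) /Lop.
  have r (a b x y : R) : b - alpha * x + a + gamma * y = a + b - alpha * x + gamma * y by ring.
  by rewrite mulNr; exact: r.
have e1 : ip mu Om f (S v) = ip mu Om (fun z => S u z + (- alpha) * wlap Om u z + gamma * u z) (S v).
  by apply: (eq_ip mOm ae _ Lf L2' LSv LSv); exact: aeW.
have e2 : lapip tess u (S v) = ip mu Om (wlap Om u) (S v).
  rewrite (ip_tess oOm tes Ll LSv); apply: eq_bigr => k _.
  have aek := wlap_unique (@oK k) (wlapP (wu.2 k)) (is_wlapS oOm (@oK k) (@KO k) Hu ul).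
  have Lk := LK k Ll; have LSk := LK k LSv.
  by apply: (eq_ip (mK k) aek _ (wlap_L2 k wu) Lk LSk LSk); exact: aeW.
rewrite e1 e2 -mulNr -(ipZl mOm (- alpha) Ll LSv) -(ipZl mOm gamma Lu LSv).
by rewrite -(ipDl mOm LSu Lal LSv) -(ipDl mOm L1 Lgu LSv).
Qed.

(** Parallelogram inequality for the four parts of the energy. For [qform] the nonnegativity at u +
    v is not algebraic: it is the trace identity in H^1_E. *)
Lemma sq_error u v : H1E OmS T u -> H1E OmS T v ->
  [/\ qf (fun z => u z + (-1) * v z) <= 2 * qf u + 2 * qf v,
      gradOm (fun z => u z + (-1) * v z) (fun z => u z + (-1) * v z) <= 2 * gradOm u u + 2 * gradOm v v,
      ip mu Om (S (fun z => u z + (-1) * v z)) (S (fun z => u z + (-1) * v z)) <=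
        2 * ip mu Om (S u) (S u) + 2 * ip mu Om (S v) (S v) &
      ip mu Om (fun z => u z + (-1) * v z) (fun z => u z + (-1) * v z) <=
        2 * ip mu Om u u + 2 * ip mu Om v v].
Proof.
move=> hu hv; have Hu := hu.1; have Hv := hv.1; have Lu := Hu.1; have Lv := Hv.1.
have LSu := strm_L2 beta oOm Hu; have LSv := strm_L2 beta oOm Hv.
have Huv k := H1D k oOm Hu Hv.
split.
- apply: (parallelogram_le (Q := fun k => qf (fun z => u z + k * v z))
    (c := ip mu Om (S u) v + ip mu Om u (S v))) => [k|]; first exact: qformD.
  exact: (qform_ge0 beta oOmS OmSM T0 (H1ED oOmS OmSM 1 hu hv)).
- apply: (parallelogram_le (Q := fun k => gradOm (fun z => u z + k * v z) (fun z => u z + k * v z))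
    (c := gradOm u v)) => [k|]; last exact: gradip_ge0.
  rewrite (gradipD oOmS k Hu Hv (Huv k)) [gradip _ _ u _]gradipC [gradip _ _ v _]gradipC.
  rewrite (gradipD oOmS k Hu Hv Hu) (gradipD oOmS k Hu Hv Hv) [gradip _ _ v u]gradipC.
  have r (a b g : R) : a + k * b + k * (b + k * g) = a + 2 * k * b + k ^+ 2 * g by ring.
  exact: r.
- apply: (parallelogram_le (Q := fun k => ip mu Om (S (fun z => u z + k * v z)) (S (fun z => u z + k * v z)))
    (c := ip mu Om (S u) (S v))) => [k|]; last exact: ip_ge0.
  have ae := ae_strmD beta oOmS k Hu Hv; have LS := strm_L2 beta oOm (Huv k).
  have Ls : L2 mu Om (fun z => S u z + k * S v z) by apply: L2D => //; exact: L2Z.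
  by apply: etrans (eq_ip mOm ae ae LS Ls LS Ls) (ip_sqDZ mOm k LSu LSv).
- apply: (parallelogram_le (Q := fun k => ip mu Om (fun z => u z + k * v z) (fun z => u z + k * v z))
    (c := ip mu Om u v)) => [k|]; last exact: ip_ge0.
  exact: (ip_sqDZ mOm k Lu Lv).
Qed.

Variables (r : nat) (theta h Cinv : R).
Hypotheses (a0 : 0 <= alpha) (g0 : 0 <= gamma) (th0 : 0 < theta) (h0 : 0 < h).
Hypothesis inv : forall v, Vh OmS T r tess v -> lapsq tess v <= Cinv / h ^+ 2 * gradOm v v.
Hypothesis thC : theta * alpha * Cinv <= 2^-1.

Lemma nu_gt0 : 0 < nu beta.
Proof.
rewrite invr_gt0 sqrtr_gt0; apply: (@lt_le_trans _ _ 1) => //.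
by rewrite lerDr; apply: sumr_ge0 => i _; exact: sqr_ge0.
Qed.

Lemma nu_le1 : nu beta <= 1.
Proof.
rewrite invf_le1 ?sqrtr_gt0; last first.
  by apply: (@lt_le_trans _ _ 1) => //; rewrite lerDr; apply: sumr_ge0 => i _; exact: sqr_ge0.
rewrite -[leLHS]sqrtr1; apply: ler_wsqrtr.
by rewrite lerDr; apply: sumr_ge0 => i _; exact: sqr_ge0.
Qed.

Lemma discrete_error_bound eta xi (t := theta * h ^+ 2 * nu beta) :
  H1E OmS T eta -> pw_lap OmS T tess eta -> Vh OmS T r tess xi ->
  Bh OmS T alpha gamma beta 2 theta h tess eta xi = Bh OmS T alpha gamma beta 2 theta h tess xi xi ->
  4^-1 * qf xi + alpha / 4 * gradOm xi xi + gamma / 2 * ip mu Om xi xi +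
    t / 4 * ip mu Om (S xi) (S xi) <=
  qf eta + 2 / t * ip mu Om eta eta + alpha * gradOm eta eta + gamma / 2 * ip mu Om eta eta +
    t * (2 * ip mu Om (S eta) (S eta) + 2 * (alpha ^+ 2 * lapsq tess eta) +
         2 * (gamma ^+ 2 * ip mu Om eta eta)).
Proof.
move=> he we Vx gal; have wx := Vh_pw_lap OmSM tes Vx; have [hx _ _] := Vx.
have He := he.1; have Hx := hx.1.
have Le := He.1; have Lx := Hx.1; have LSe := strm_L2 beta oOm He; have LSx := strm_L2 beta oOm Hx.
have t0 : 0 < t by rewrite !mulr_gt0 ?exprn_gt0 ?nu_gt0.
rewrite !(BhE alpha gamma beta oOmS tes) // in gal.
have s4 : (4 * 2)^-1 = 8^-1 :> R by congr (_^-1); ring.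
have two : 0 < 2 :> R by [].
have t2 : 0 < 2 / t by rewrite divr_gt0.
have half : 0 < 2^-1 :> R by rewrite invr_gt0.
have one : 0 < 1 :> R by [].
apply: (coercive_estimate (b1 := ip mu Om (S eta) xi) (b2 := ip mu Om eta (S xi))
  (gm := gradOm eta xi) (zm := ip mu Om eta xi) (xm := ip mu Om (S eta) (S xi))
  (lm := lapip tess eta (S xi)) (lx := lapip tess xi (S xi)) (sx := ip mu Om xi (S xi))
  (Lx := lapsq tess xi) t0 a0 g0).
- exact: (qform_ge0 beta oOmS OmSM T0 hx).
- by [].
- exact: (qform_polar beta oOmS OmSM T0 he hx).
- by apply: etrans gal _; rewrite [ip mu Om (S xi) xi]ipC.
(* Here S xi meets eta without any factor h; the weight 2 / t pays for it and produces the term (h^2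
   nu)^-1 |eta|^2 of the theorem. *)
- have := ip_youngZ (-1) mOm t2 Le LSx; rewrite [-1 * _]mulN1r sqrrN expr1n [1 * ip _ _ _ _]mul1r.
  have -> : (4 * (2 / t))^-1 = t / 8 by field; rewrite gt_eqF.
  exact.
- exact: gradip_young.
- have e : (4 * 2^-1)^-1 = 2^-1 :> R by field.
  by have hh := ip_young mOm half Le Lx; rewrite e in hh; exact: hh.
- by have hh := ip_young mOm two LSe LSx; rewrite s4 in hh; exact: hh.
- by have hh := lapip_young (- alpha) two we LSx; rewrite sqrrN s4 in hh; exact: hh.
- by have hh := ip_youngZ gamma mOm two Le LSx; rewrite s4 in hh; exact: hh.
- by have hh := lapip_young alpha one wx LSx; rewrite [1 * _]mul1r [4 * 1]mulr1 in hh; exact: hh.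
- have G0 := gradip_ge0 OmS T xi.
  have := inv Vx; set L := lapsq _ _; move: G0; set G := gradip _ _ _ _ => G0 hL.
  have a2 : 0 <= t * alpha ^+ 2 by rewrite mulr_ge0 ?sqr_ge0// ltW.
  rewrite mulrA; apply: (le_trans (ler_wpM2l a2 hL)).
  (* The h^2 in t cancels the h^-2 of the inverse inequality; what remains of the coefficient is nu
     times theta alpha Cinv, at most 1/2. *)
  have -> : t * alpha ^+ 2 * (Cinv / h ^+ 2 * G) = nu beta * (theta * alpha * Cinv) * (alpha * G).
    by rewrite /t; field; rewrite gt_eqF.
  have -> : alpha / 2 * G = 2^-1 * (alpha * G) by ring.
  apply: ler_wpM2r; first exact: mulr_ge0.
  have n1 := nu_le1; have n0 := nu_gt0.
  (* [Cinv] carries no sign here, so multiplication by [nu beta] is treated separately for either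
     sign. *)
  have [hh|hh] := leP 0 (theta * alpha * Cinv); first by apply: le_trans thC; exact: ler_piMl.
  by apply: (@le_trans _ _ 0); [rewrite pmulr_rle0// ltW|rewrite invr_ge0].
Qed.

Lemma error_estimate h02 f u uh chi : h ^+ 2 <= h02 ->
  L2 mu Om f -> weak_solution OmS T alpha gamma beta f u ->
  strong_solution OmS T alpha gamma beta f u ->
  sd_solution OmS T alpha gamma beta 2 theta h r tess f uh -> Vh OmS T r tess chi ->
  (energy2 OmS T alpha gamma beta 2 h (u \- uh)%R <=
   (2 + 8 * (1 + theta^-1) *
     (2 + 2 / theta + 2 * theta + 2 * theta * alpha + 2 * theta * gamma * h02))%:E *
   (energy2 OmS T alpha gamma beta 2 h (u \- chi)%R
    + approx2 OmS T alpha beta h tess (u \- chi)%R))%E.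
Proof.
move=> hh Lf weak strong [Vuh sd] Vchi.
have Vxi := VhB oOmS OmSM Vuh Vchi.
have hu := weak.1; have [hchi _ _] := Vchi; have [hxi _ _] := Vxi.
have he := H1EB oOmS OmSM hu hchi.
have wu := pw_lapS hu.1 strong.1; have wchi := Vh_pw_lap OmSM tes Vchi.
have wuh := Vh_pw_lap OmSM tes Vuh.
have dE v w : (v \- w : pt -> R) = fun z => v z + (-1) * w z by apply/funext => z /=; rewrite mulN1r.
have we : pw_lap OmS T tess (u \- chi) by rewrite dE; exact: (pw_lapD oOmS tes (-1) wu wchi).
(* Galerkin orthogonality: [u] and [uh] give the same value of [Bh] against the discrete function
   [uh \- chi]. *)
have gal : Bh OmS T alpha gamma beta 2 theta h tess (u \- chi) (uh \- chi) =
           Bh OmS T alpha gamma beta 2 theta h tess (uh \- chi) (uh \- chi).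
  have D w v : pw_lap OmS T tess w -> H1 Om v -> Bh OmS T alpha gamma beta 2 theta h tess (w \- chi) v =
      Bh OmS T alpha gamma beta 2 theta h tess w v + (-1) * Bh OmS T alpha gamma beta 2 theta h tess chi v.
    by move=> ww Hv; rewrite (dE w chi); exact: (BhD alpha gamma beta oOmS tes 2 theta h (-1) ww wchi Hv).
  rewrite (D _ _ wu hxi.1) (D _ _ wuh hxi.1).
  by rewrite (Bh_consistent 2 theta h Lf weak strong hxi) (sd _ Vxi).
have main := discrete_error_bound he we Vxi gal.
(* The error is eta - xi, so its energy splits into that of eta, kept, and that of xi, bounded by
   [main]. *)
have eE : (u \- uh : pt -> R) = fun z => (u \- chi) z + (-1) * (uh \- chi) z.
  by apply/funext => z /=; ring.
rewrite (energy2E alpha gamma beta oOmS OmSM T0 2 h he) (approx2E alpha beta oOmS h tes we).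
rewrite eE (energy2E alpha gamma beta oOmS OmSM T0 2 h (H1ED oOmS OmSM (-1) he hxi)).
rewrite -EFinD -EFinM lee_fin.
have [q1 q2 q3 q4] := sq_error he hxi.
have n0 := nu_gt0; have n1 := nu_le1.
have c0 : 0 < h ^+ 2 * nu beta by rewrite mulr_gt0 ?exprn_gt0.
have ch : h ^+ 2 * nu beta <= h02 by apply: le_trans hh; rewrite ler_piMr ?sqr_ge0.
move: main; rewrite -[theta * h ^+ 2 * nu beta]mulrA => main.
apply: (le_trans _ (energy_split th0 c0 a0 g0 (sqr_ge0 h) (ltW n0) n1 erefl ch
  (qform_ge0 beta oOmS OmSM T0 hxi) (gradip_ge0 OmS T _) (ip_ge0 mu Om _) (ip_ge0 mu Om _)
  (qform_ge0 beta oOmS OmSM T0 he) (gradip_ge0 OmS T _) (ip_ge0 mu Om _) (ip_ge0 mu Om _)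
  (lapsq_ge0 tess _) main)).
apply: (lerD q1); apply: lerD; [apply: lerD|]; apply: ler_wpM2l => //; exact: ltW.
Qed.

End error_bound.

(** * Choice of constants uniform in the mesh *)

Unset Implicit Arguments.
Set Strict Implicit.
Set Printing Implicit Defensive.

Theorem theorem4 (R : realType) (d : nat) (OmS : set 'rV[R]_d) (T : R)
    (alpha gamma : R) (beta : 'rV[R]_d) (r : nat) (kappa : R)
    (hd : (0 < d)%N) (openOmS : open OmS) (connOmS : connected OmS)
    (bndOmS : bounded_set OmS) (neOmS : OmS !=set0) (hT : 0 < T)
    (halpha : 0 <= alpha) (alpha_neq0 : alpha != 0) (hgamma : 0 <= gamma)
    (hr : (1 < r)%N) (hkappa : 0 < kappa) :
  exists theta0 : R, 0 < theta0 /\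
  forall theta : R, 0 < theta <= theta0 ->
  exists C : R, 0 < C /\
  forall (h : R) (N : nat) (tess : 'I_N -> set ('rV[R]_d * R))
      (f u uh : 'rV[R]_d * R -> R),
    0 < h ->
    tessellation (cyl OmS T) tess ->
    shape_regular kappa tess ->
    quasiuniform kappa h tess ->
    L2 (@lebesgue_st R d) (cyl OmS T) f ->
    weak_solution OmS T alpha gamma beta f u ->
    strong_solution OmS T alpha gamma beta f u ->
    sd_solution OmS T alpha gamma beta 2 theta h r tess f uh ->
    (energy2 OmS T alpha gamma beta 2 h (u \- uh)%R <=
     C%:E * ereal_inf [set energy2 OmS T alpha gamma beta 2 h (u \- chi)%R
                       + approx2 OmS T alpha beta h tess (u \- chi)%R
                      | chi in Vh OmS T r tess])%E.
Proof.
have [M OmSM] : exists M, forall x, OmS x -> `|x| <= M.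
  by have [M [_ hM]] := bndOmS; exists (M + 1) => x xO; apply: (hM (M + 1)) => //; rewrite ltrDl.
have a_gt0 : 0 < alpha by rewrite lt0r alpha_neq0.
have [Cinv Cinv0 inv] := @lap_inverse R d r kappa hkappa.
(* Positive because alpha is, and fixed before any mesh, since [Cinv] depends only on d, r and
   kappa. *)
exists (2 * (alpha * Cinv))^-1; split; first by rewrite invr_gt0 !mulr_gt0.
move=> theta /andP[th0 thle].
have thC : theta * alpha * Cinv <= 2^-1.
  rewrite -mulrA -ler_pdivlMr ?mulr_gt0//.
  by apply: (le_trans thle); rewrite invfM.
(* A bound for the diameter of every subset of the cylinder, hence of every element; kappa D will
   bound h. *)
pose D := d.+1%:R * (2 * Num.max M T).
pose C := 2 + 8 * (1 + theta^-1) *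
     (2 + 2 / theta + 2 * theta + 2 * theta * alpha + 2 * theta * gamma * (kappa * D) ^+ 2).
have C0 : 0 < C.
  rewrite ltr_pwDl// mulr_ge0//; first by rewrite mulr_ge0// addr_ge0// invr_ge0 ltW.
  have th := ltW th0; have thi : 0 <= theta^-1 by rewrite invr_ge0.
  have t2 : 0 <= 2 * theta by rewrite mulr_ge0.
  have p1 := mulr_ge0 t2 halpha.
  have p2 := mulr_ge0 (mulr_ge0 t2 hgamma) (sqr_ge0 (kappa * D)).
  by rewrite (addr_ge0 (addr_ge0 (addr_ge0 (addr_ge0 _ _) t2) p1) p2)// mulr_ge0.
exists C; split => // h N tess f u uh h0 tes sr qu Lf weak strong sd.
have Om0 : cyl OmS T !=set0.
  have [x xO] := neOmS; exists (x, T / 2); split => //=.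
  by rewrite in_itv/=; apply/andP; split; [rewrite divr_gt0|rewrite ltr_pdivrMr// ltr_pMr// ltr1n].
have [k _] := tess_inhabited tes Om0.
have hD : h <= kappa * D.
  have /andP[_ hk] := qu k; apply: (le_trans hk); rewrite ler_pM2l//.
  apply: diam_bound; last exact: (@tess_neq0 _ _ _ _ _ tes k).
  exact: subset_trans (@tess_sub _ _ _ _ _ tes k) (cyl_cube OmSM).
have hh : h ^+ 2 <= (kappa * D) ^+ 2 by rewrite ler_sqr ?nnegrE ?(ltW h0)// (le_trans (ltW h0)).
(* With the positive constant moved to the left, being below the infimum amounts to the estimate for
   each [chi]. *)
rewrite -lee_pdivrMl//; apply: le_ereal_inf_tmp => _ [chi Vchi <-].
rewrite lee_pdivrMl//.
exact: (error_estimate openOmS OmSM hT tes halpha hgamma th0 h0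
  (fun v => inv _ _ _ _ _ _ v openOmS OmSM hT tes sr qu h0) thC hh Lf weak strong sd Vchi).
Qed.
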